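(* Let $c>0$, $T>0$, $-\frac13<\lambda<0$ and $0<\beta<1-\frac{4\lambda+2}{\sqrt{(2\lambda+3)(8\lambda+3)}}$. Let $\psi(x,t)=-\log(1+ct)-\log(1+x+ct)$ and $\varphi=e^{\lambda\psi}$. Let $I\Subset I^\ast\Subset(0,T)$ be open time intervals, let $\eta\in C_c^\infty(I^\ast)$ satisfy $0\le\eta\le1$ and $\eta=1$ on $I$, and set $\mathcal T=\operatorname{supp}\eta'\cup\operatorname{supp}\eta''$. There exist constants $C>0$, $C_\eta>0$ and $S\ge1$, depending on $c,T,\lambda,\beta$ and on finitely many bounds for $\eta$, such that for every $$z\in C\bigl([0,T];H^2(0,\infty)\bigr)\cap C^1\bigl([0,T];H^1(0,\infty)\bigr)\cap C^2\bigl([0,T];L^2(0,\infty)\bigr)$$ and every $s\le -S$, $$\begin{aligned} &\int_{(0,\infty)\times I}e^{2s\varphi}\left((-s)^3\varphi^3|z|^2+(-s)(|z_t|^2+|z_x|^2)\right)dx\,dt \le C\int_{(0,\infty)\times I^\ast}e^{2s\varphi}|\square z|^2\,dx\,dt\\ &\quad +C\int_{I^\ast}e^{2s\varphi(0,t)}\left((-s)^3\varphi(0,t)^3|z(0,t)|^2+(-s)\varphi(0,t)\bigl(|z_t(0,t)|^2+|z_x(0,t)|^2\bigr)\right)dt\\ &\quad +C_\eta\int_{(0,\infty)\times\mathcal T}e^{2s\varphi}\bigl(|z_t|^2+|z|^2\bigr)dx\,dt. \end{aligned}$$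
   Context: All functions are real-valued. Variables are $(x,t)\in(0,\infty)\times(0,T)$. The wave operator is $\square z=z_{tt}-c^2z_{xx}$ with constant wave speed $c>0$. Explicitly $\varphi(x,t)=(1+ct)^{-\lambda}(1+x+ct)^{-\lambda}\ge 1$. The parameter $s$ is negative. ''Bounds for $\eta$'' means sup-norm bounds on $\eta$ and finitely many of its derivatives. $I\Subset I^\ast$ means that the closure of $I$ is compact and contained in $I^\ast$. *)

(* Defs.v *)
From HB Require Import structures.
From mathcomp Require Import all_boot all_order all_algebra.
From mathcomp Require Import all_classical all_reals all_analysis.
Import Order.TTheory GRing.Theory Num.Theory.
Import numFieldNormedType.Exports.

Set Implicit Arguments.
Unset Strict Implicit.
Unset Printing Implicit Defensive.

Local Open Scope classical_set_scope.
Local Open Scope ring_scope.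

(* Elements of L^2(0,oo) and of H^m(0,oo) are handled through representatives
   f : R -> R, of which only the values on ]0, +oo[, up to almost everywhere
   equality, are relevant. A curve t |-> z(.,t) is written z : R -> R -> R with
   the time variable first, so that z t x stands for z(x,t). *)

Section Defs.
Context {R : realType}.
Implicit Types (A B U : set R) (f g h : R -> R) (z : R -> R -> R).

Notation mu := (@lebesgue_measure R).

Definition halfline : set R := `]0, +oo[%classic.

Definition compactly_contained A B := compact (closure A) /\ closure A `<=` B.

Definition tsupport f : set R := closure [set x | f x != 0].

Definition smooth f := forall n x, derivable (derive1n n f) x 1.

Definition Cc_infty U f :=
  [/\ smooth f, compact (tsupport f) & tsupport f `<=` U].

Definition L2 f := (f \_ halfline) \in Lfun mu 2%:E.

Definition L2norm f : \bar R := 'N[mu]_2%:E[EFin \o (f \_ halfline)]%E.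

Definition weak_derivative f g :=
  forall h, Cc_infty halfline h ->
    (\int[mu]_(x in halfline) (f x * derive1 h x) =
     - \int[mu]_(x in halfline) (g x * h x))%R.

(* H^m(0,oo); sobolev 0 is L^2(0,oo). *)
Fixpoint sobolev (m : nat) f : Prop :=
  L2 f /\ if m is m'.+1 then
            exists g, weak_derivative f g /\ sobolev m' g
          else True.

(* The (a.e. unique) square integrable weak derivative of f, if any. *)
Definition Dx f : R -> R :=
  xget (fun=> 0) [set g | L2 g /\ weak_derivative f g].

Definition Hnorm (m : nat) f : \bar R :=
  (\sum_(j < m.+1) L2norm (iter j Dx f))%E.

(* f(0), for f in H^1(0,oo): the value at 0 of the representative of f that is
   continuous on [0, +oo[. *)
Definition trace f : R :=
  xget 0 [set a | exists g, [/\ {within `[0, +oo[%classic, continuous g},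
    {ae mu, forall x, halfline x -> f x = g x} & g 0 = a]].

(* g is the derivative at t0 of the curve z : [0,T] -> H^m(0,oo), for the norm
   of H^m; it is one-sided when t0 is 0 or T. *)
Definition curve_derivative (T : R) (m : nat) z (t0 : R) g :=
  Hnorm m (fun x => (t - t0)^-1 * (z t x - z t0 x) - g x)
    @[t --> within `[0, T]%classic t0^'] --> 0%E.

Definition curve_continuous (T : R) (m : nat) z :=
  (forall t, 0 <= t <= T -> sobolev m (z t)) /\
  (forall t0, 0 <= t0 <= T ->
    Hnorm m (fun x => z t x - z t0 x)
      @[t --> within `[0, T]%classic (nbhs t0)] --> 0%E).

(* z belongs to C^k([0,T]; H^m(0,oo)). *)
Fixpoint CkH (T : R) (k m : nat) z : Prop :=
  curve_continuous T m z /\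
  if k is k'.+1 then
    exists z', (forall t, 0 <= t <= T -> curve_derivative T m z t (z' t)) /\
               CkH T k' m z'
  else True.

(* Time derivative. A derivative in H^m is also a derivative in L^2, so the
   weakest norm is used here; it determines the derivative a.e. *)
Definition Dt (T : R) z (t : R) : R -> R :=
  xget (fun=> 0) [set g | L2 g /\ curve_derivative T 0 z t g].

Definition box (c T : R) z (t x : R) : R :=
  Dt T (Dt T z) t x - c ^+ 2 * Dx (Dx (z t)) x.

Definition psi (c x t : R) : R := - ln (1 + c * t) - ln (1 + x + c * t).

Definition phi (c lambda x t : R) : R := expR (lambda * psi c x t).

(* Integral of F over (0,oo) x J, as an iterated integral (x first): the curves
   are only given through their values t |-> z t as elements of L^2(0,oo), with
   no joint measurability of the representatives, but for F built from
   continuous curves the inner integral does not depend on the representatives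
   and is continuous in t. *)
Definition int_space_time (J : set R) (F : R -> R -> R) : \bar R :=
  (\int[mu]_(t in J) \int[mu]_(x in halfline) (F t x)%:E)%E.

End Defs.

(* Main.v *)
Require Import Defs.
From mathcomp Require Import all_boot all_order all_algebra.
From mathcomp Require Import all_classical all_reals all_analysis.
From mathcomp Require Import measurable_realfun lebesgue_integral_under ring lra.
Import Order.TTheory GRing.Theory Num.Theory.
Import numFieldNormedType.Exports.

(** Let a = - s phi and w_n = a^n exp (- 2 a), so that exp (2 s phi) = w_0, and let
   kappa = - lambda c / (1 + c T). Since lambda < 0, phi grows in both null directions
   d/dt + c d/dx and d/dt - c d/dx, with logarithmic derivative at least kappa
   ([weight_transport]).

   Consider a curve v of H^1 functions of x that vanishes at two times, a number
   b >= - c, and the source F = v_t + b v_x. Integrating the time derivative of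
   int w_(n+1) v^2 dx, and integrating by parts in x, the derivative of w_(n+1) along
   d/dt + b d/dx appears; it is at most - kappa w_(n+2) as soon as - s >= n + 1. After
   Young's inequality,

     int int w_(n+2) v^2 <= 4 / kappa^2 int int w_n F^2
                            + 2 b / kappa int w_(n+1)(0, t) v(0, t)^2 dt

   ([transport_estimate]). The wave operator factors, in both orders, into
   d/dt + c d/dx and d/dt - c d/dx. The estimate is used three times: with b = c and
   n = 0 for v = (d/dt - c d/dx) (eta z), which produces the boundary term; with
   b = - c and n = 0 for v = (d/dt + c d/dx) (eta z), where the boundary term may be
   dropped; with b = - c and n = 2 for v = eta z, whose source is the first null
   derivative ([localized_estimate]). The result bounds w_4 |eta z|^2 and
   w_2 (|v_t|^2 + |v_x|^2), for v = eta z, by w_0 |box (eta z)|^2 and the boundary term.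
   As a >= - s >= 3, this is stronger than the left-hand side over I, where eta = 1;
   and box (eta z) = eta box z + 2 eta' z_t + eta'' z gives the first and the last
   integrals of the right-hand side.

   Since z is only a curve in Sobolev spaces, all of this is done on inner products
   in x, as functions of time. Integration by parts in x ([weighted_ibp]) needs the
   continuous representative of an H^1 function ([sobolev_representative]). It is
   obtained by testing the weak derivative with smooth approximations of indicator
   functions of intervals, at Lebesgue points; these test functions are rescalings of
   a smooth transition from 0 to 1, and the rising part of eta is such a transition
   ([smooth_step_of_cutoff]). Traces are chosen time by time; their squares are
   continuous in time because f(0)^2 = - 2 int f f' ([sqr_trace]). *)

Set Implicit Arguments.
Unset Strict Implicit.
Unset Printing Implicit Defensive.

Local Open Scope classical_set_scope.
Local Open Scope ring_scope.

(** * Square integrable functions on the half-line *)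

Section L2.
Context {R : realType}.
Local Notation mu := (@lebesgue_measure R).
Local Notation hl := (@halfline R).
Implicit Types (f g h w : R -> R) (k : R).

Definition inner f g : R := \int[mu]_(x in hl) (f x * g x).

Definition norm2 f : R := Num.sqrt (inner f f).

Definition ae_hl f g := {ae mu, forall x, hl x -> f x = g x}.

Lemma measurable_halfline :
  measurable (hl : set (g_sigma_algebraType R.-ocitv.-measurable)).
Proof. exact: measurable_itv. Qed.
Hint Extern 0 (measurable halfline) => exact: measurable_halfline : core.

Lemma ae_mono (P Q : R -> Prop) : (forall x, P x -> Q x) ->
  {ae mu, forall x, P x} -> {ae mu, forall x, Q x}.
Proof. by move=> PQ; exact: (@filterS _ _ (ae_filter_ringOfSetsType mu)). Qed.

Lemma ae_mono2 (P Q S : R -> Prop) : (forall x, P x -> Q x -> S x) ->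
  {ae mu, forall x, P x} -> {ae mu, forall x, Q x} -> {ae mu, forall x, S x}.
Proof.
by move=> PQS; exact: (@filterS2 _ _ (ae_filter_ringOfSetsType mu)).
Qed.

Lemma EFin_Rintegral (D : set R) f :
  measurable (D : set (g_sigma_algebraType R.-ocitv.-measurable)) ->
  mu.-integrable D (EFin \o f) ->
  (\int[mu]_(x in D) (f x)%:E)%E = (\int[mu]_(x in D) f x)%:E.
Proof. by move=> mD If; rewrite /Rintegral fineK//; exact: integrable_fin_num. Qed.

Lemma integrable_mul_bounded (D : set R) f w C :
  measurable (D : set (g_sigma_algebraType R.-ocitv.-measurable)) ->
  measurable_fun D w -> (forall x, D x -> `|w x| <= C) ->
  mu.-integrable D (EFin \o f) ->
  mu.-integrable D (EFin \o (fun x => f x * w x)).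
Proof.
move=> mD mw wC If.
have : [bounded w x | x in D].
  by exists C; split; [exact: num_real|move=> M CM x Dx; exact: le_trans (wC _ Dx) (ltW CM)].
by move=> /(integrableMl mD If mw).
Qed.

Lemma L2P f : L2 f <-> measurable_fun hl f /\
  mu.-integrable hl (EFin \o (fun x => f x ^+ 2)).
Proof.
have sqE : EFin \o (fun x => (f \_ hl) x ^+ 2)
         = (EFin \o (fun x => f x ^+ 2)) \_ hl.
  by apply/funext => x /=; rewrite !patchE; case: ifP => // _; rewrite expr0n.
rewrite /L2; split.
  move=> /[dup] /Lfun2_integrable_sqr + /andP[/set_mem /= mf _].
  move: mf => /(measurable_restrictT f measurable_halfline) mf.
  by rewrite sqE => I; split => //; exact/integrable_mkcond.
move=> [mf If].
have mf' : measurable_fun setT (f \_ hl).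
  exact: (measurable_restrictT f measurable_halfline).1.
rewrite inE; apply/andP; split; first by rewrite inE.
rewrite inE/= /finite_norm unlock /Lnorm poweR_lty//.
rewrite [ltLHS](_ : _ = (\int[mu]_(x in hl) (f x ^+ 2)%R%:E)%E); last first.
  rewrite [RHS]integral_mkcond; apply: eq_integral => x _ /=.
  rewrite !patchE; case: ifP => _; last by rewrite normr0 powR0.
  by rewrite powR_mulrn// real_normK// num_real.
move/integrableP : If => [_]; apply: le_lt_trans.
rewrite le_eqVlt; apply/orP; left; apply/eqP/eq_integral => x _ /=.
by rewrite ger0_norm// sqr_ge0.
Qed.

Lemma L2_measurable f : L2 f -> measurable_fun hl f.
Proof. by move=> /L2P[]. Qed.

Lemma integrable_mulL2 f g : L2 f -> L2 g ->
  mu.-integrable hl (EFin \o (fun x => f x * g x)).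
Proof.
move=> /L2P[mf If] /L2P[mg Ig].
have := integrableD measurable_halfline If Ig; apply: le_integrable => //.
  by apply/measurable_EFinP; exact: measurable_funM.
move=> x _ /=; rewrite lee_fin.
rewrite (ger0_norm (addr_ge0 (sqr_ge0 _) (sqr_ge0 _))) normrM.
rewrite -(real_normK (num_real (f x))) -(real_normK (num_real (g x))).
have := sqr_ge0 (`|f x| - `|g x|).
have := normr_ge0 (f x); have := normr_ge0 (g x); nra.
Qed.

Lemma integrable_sqrL2 f : L2 f ->
  mu.-integrable hl (EFin \o (fun x => f x ^+ 2)).
Proof. by move=> /L2P[]. Qed.

Lemma L2D f g : L2 f -> L2 g -> L2 (fun x => f x + g x).
Proof.
move=> Lf Lg; apply/L2P; split.
  by apply: measurable_funD; exact: L2_measurable.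
rewrite (_ : _ \o _ = ((EFin \o (fun x => f x ^+ 2)%R) \+
  (EFin \o (fun x => f x * g x)%R) \+ (EFin \o (fun x => f x * g x)%R) \+
  (EFin \o (fun x => g x ^+ 2)%R))%E).
  by do ?apply: integrableD => //; do ?[exact: integrable_mulL2|exact: integrable_sqrL2].
by apply/funext => x /=; rewrite -!EFinD; congr EFin; ring.
Qed.

Lemma L2_mul_bounded w f K : measurable_fun hl w ->
  (forall x, hl x -> `|w x| <= K) -> L2 f -> L2 (fun x => w x * f x).
Proof.
move=> mw wK Lf; apply/L2P; split.
  by apply: measurable_funM => //; exact: L2_measurable.
have := integrableZl measurable_halfline (K ^+ 2) (integrable_sqrL2 Lf).
apply: le_integrable => //.
  apply/measurable_EFinP; apply: measurable_funX.
  by apply: measurable_funM => //; exact: L2_measurable.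
move=> x hx /=; rewrite lee_fin -exprMn !ger0_norm ?sqr_ge0// !exprMn.
rewrite ler_wpM2r ?sqr_ge0// -(real_normK (num_real (w x))).
by rewrite lerXn2r ?nnegrE//; [exact: le_trans (wK _ hx)|exact: wK].
Qed.

Lemma L2Z k f : L2 f -> L2 (fun x => k * f x).
Proof. by apply: (@L2_mul_bounded (cst k) f `|k|). Qed.

Lemma L2B f g : L2 f -> L2 g -> L2 (fun x => f x - g x).
Proof.
move=> Lf Lg.
rewrite (_ : (fun x => _) = (fun x => f x + (-1) * g x)).
  by apply: L2D => //; exact: L2Z.
by apply/funext => x; rewrite mulN1r.
Qed.

Lemma L2_0 : L2 (fun=> 0 : R).
Proof.
apply/L2P; split; first exact: measurable_cst.
rewrite (_ : _ \o _ = cst 0%E); first exact: integrable0.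
by apply/funext => x /=; rewrite expr0n.
Qed.

Lemma L2_ae f g : measurable_fun hl g -> ae_hl f g -> L2 f -> L2 g.
Proof.
move=> mg fg Lf; apply/L2P; split => //; apply/integrableP; split.
  by apply/measurable_EFinP; exact: measurable_funX.
have /integrableP[_] := integrable_sqrL2 Lf; apply: le_lt_trans.
rewrite le_eqVlt; apply/orP; left; apply/eqP; apply: ae_eq_integral => //.
- apply: measurableT_comp => //; apply/measurable_EFinP.
  by apply: measurable_funX.
- apply: measurableT_comp => //; apply/measurable_EFinP.
  by apply: measurable_funX; exact: L2_measurable.
- by move: fg; apply: ae_mono => x /= fg hx; rewrite fg.
Qed.

Lemma innerC f g : inner f g = inner g f.
Proof. by apply: eq_Rintegral => x _; rewrite mulrC. Qed.

Lemma innerDl f1 f2 g : L2 f1 -> L2 f2 -> L2 g ->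
  inner (fun x => f1 x + f2 x) g = inner f1 g + inner f2 g.
Proof.
move=> L1 L2 Lg; rewrite /inner.
under eq_Rintegral do rewrite mulrDl.
by rewrite RintegralD//; exact: integrable_mulL2.
Qed.

Lemma innerZl k f g : L2 f -> L2 g ->
  inner (fun x => k * f x) g = k * inner f g.
Proof.
move=> Lf Lg; rewrite /inner.
under eq_Rintegral do rewrite -mulrA.
by rewrite RintegralZl//; exact: integrable_mulL2.
Qed.

Lemma innerDr f g1 g2 : L2 f -> L2 g1 -> L2 g2 ->
  inner f (fun x => g1 x + g2 x) = inner f g1 + inner f g2.
Proof. by move=> *; rewrite innerC innerDl// !(innerC f). Qed.

Lemma innerZr k f g : L2 f -> L2 g ->
  inner f (fun x => k * g x) = k * inner f g.
Proof. by move=> *; rewrite innerC innerZl// innerC. Qed.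

Lemma inner_ge0 f : 0 <= inner f f.
Proof. by apply: Rintegral_ge0 => x _; rewrite -expr2 sqr_ge0. Qed.
Hint Resolve inner_ge0 : core.

Lemma ae_inner f1 f2 g1 g2 : L2 f1 -> L2 f2 -> L2 g1 -> L2 g2 ->
  ae_hl f1 f2 -> ae_hl g1 g2 -> inner f1 g1 = inner f2 g2.
Proof.
move=> Lf1 Lf2 Lg1 Lg2 f12 g12; congr fine; apply: ae_eq_integral => //.
- exact: (measurable_int _ (integrable_mulL2 _ _)).
- exact: (measurable_int _ (integrable_mulL2 _ _)).
- by apply: ae_mono2 f12 g12 => x /= fx gx hx; rewrite fx// gx.
Qed.

(** The quadratic polynomial in k whose sign yields [cauchy_schwarz]. *)
Lemma inner_sqrD k f g : L2 f -> L2 g ->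
  inner (fun x => f x + k * g x) (fun x => f x + k * g x) =
  inner f f + k * inner f g *+ 2 + k ^+ 2 * inner g g.
Proof.
move=> Lf Lg; have Lkg := L2Z k Lg.
have Lfg := L2D Lf Lkg.
rewrite innerDl// innerDr// innerDr// innerZl// innerZl// innerZr//.
by rewrite (innerZr _ Lg Lg) (innerC g f); ring.
Qed.

Lemma cauchy_schwarz f g : L2 f -> L2 g -> `|inner f g| <= norm2 f * norm2 g.
Proof.
move=> Lf Lg; rewrite /norm2 -sqrtrM// -sqrtr_sqr ler_sqrt ?mulr_ge0//.
have ff0 := inner_ge0 f; have gg0 := inner_ge0 g.
set A := inner f f in ff0 *; set B := inner f g; set D := inner g g in gg0 *.
have key k : 0 <= A + k * B *+ 2 + k ^+ 2 * D.
  by rewrite -inner_sqrD.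
have [D0|D0] := eqVneq D 0.
  have [B0|B0] := eqVneq B 0; first by rewrite B0 D0 expr0n/= mulr0.
  have := key (- (A + 1) / (2 * B)); rewrite D0 mulr0 addr0 -mulr_natr.
  rewrite (_ : A + _ = -1); last by field.
  by rewrite oppr_ge0 ler10.
have Dp : 0 < D by rewrite lt_neqAle eq_sym D0.
have := key (- B / D); rewrite -mulr_natr.
rewrite (_ : A + _ + _ = (A * D - B ^+ 2) / D); last by field.
by rewrite pmulr_lge0 ?invr_gt0// subr_ge0.
Qed.

Lemma norm2_ge0 f : 0 <= norm2 f.
Proof. exact: sqrtr_ge0. Qed.
Hint Resolve norm2_ge0 : core.

Lemma sqr_norm2 f : norm2 f ^+ 2 = inner f f.
Proof. by rewrite sqr_sqrtr. Qed.

Lemma norm2Z k f : L2 f -> norm2 (fun x => k * f x) = `|k| * norm2 f.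
Proof.
move=> Lf; rewrite /norm2 innerZl ?innerZr//; last exact: L2Z.
by rewrite mulrA -expr2 sqrtrM ?sqr_ge0// sqrtr_sqr.
Qed.

Lemma norm2D f g : L2 f -> L2 g ->
  norm2 (fun x => f x + g x) <= norm2 f + norm2 g.
Proof.
move=> Lf Lg; rewrite -(@ler_pXn2r _ 2)// ?nnegrE ?addr_ge0//.
rewrite sqr_norm2; have := inner_sqrD 1 Lf Lg.
under eq_fun do rewrite mul1r.
move=> ->; rewrite expr1n !mul1r sqrrD !sqr_norm2 lerD2r lerD2l lerMn2r/=.
exact: le_trans (ler_norm _) (cauchy_schwarz _ _).
Qed.

(** Carleman weights and their derivatives act on L2 as bounded multipliers. *)
Lemma norm2_mul_bounded w f K : 0 <= K -> measurable_fun hl w ->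
  (forall x, hl x -> `|w x| <= K) -> L2 f ->
  norm2 (fun x => w x * f x) <= K * norm2 f.
Proof.
move=> K0 mw wK Lf; rewrite -[K in leRHS]ger0_norm// -norm2Z//.
rewrite /norm2 ler_sqrt//; apply: le_Rintegral => //.
- by apply: integrable_mulL2; exact: L2_mul_bounded wK _.
- by apply: integrable_mulL2; exact: L2Z.
move=> x hx; rewrite -!expr2 !exprMn ler_wpM2r ?sqr_ge0//.
rewrite -(real_normK (num_real (w x))).
by rewrite lerXn2r ?nnegrE//; exact: wK.
Qed.

Lemma ae_norm2 f g : L2 f -> L2 g -> ae_hl f g -> norm2 f = norm2 g.
Proof. by move=> Lf Lg fg; rewrite /norm2 (@ae_inner f g f g). Qed.

Lemma L2normE f : L2 f -> L2norm f = (norm2 f)%:E.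
Proof.
move=> Lf; rewrite /L2norm unlock /Lnorm.
rewrite [X in (X `^ _)%E](_ : _ = (\int[mu]_(x in hl) (f x * f x)%R%:E)%E); last first.
  rewrite [RHS]integral_mkcond; apply: eq_integral => x _ /=. rewrite !patchE.
  case: ifP => _; last by rewrite normr0 powR0.
  by rewrite powR_mulrn// real_normK ?num_real// expr2.
rewrite -[X in (X `^ _)%E]fineK; last first.
  by apply: integrable_fin_num => //; exact: integrable_mulL2.
by rewrite poweR_EFin powR12_sqrt//; exact: inner_ge0.
Qed.

End L2.
#[export] Hint Extern 0 (measurable halfline) => exact: measurable_halfline : core.
#[export] Hint Resolve inner_ge0 norm2_ge0 : core.

(** * Smooth transitions *)

Section test_functions.
Context {R : realType}.
Local Notation mu := (@lebesgue_measure R).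
Local Notation hl := (@halfline R).
Implicit Types (f g h P : R -> R) (k x y : R).

Lemma derive1_val f x df : is_derive x 1 f df -> derive1 f x = df.
Proof. by move=> fx; rewrite derive1E derive_val. Qed.

Lemma smooth_is_derive f n x : smooth f ->
  is_derive x 1 (derive1n n f) (derive1n n.+1 f x).
Proof. by move=> sf; apply: DeriveDef; rewrite ?derive1nS ?derive1E. Qed.

Lemma derive1n_near f g x n : {near x, f =1 g} ->
  \forall y \near x, derive1n n f y = derive1n n g y.
Proof.
move=> fg; elim: n => // n /near_join; apply: filterS => y fgy.
by rewrite !derive1nS !derive1E; exact: near_eq_derive.
Qed.

(** Derivatives depend on germs only, so that functions can be glued along open
   sets on which the pieces agree. *)
Lemma smooth_near f : (forall x, exists2 g, smooth g & {near x, f =1 g}) ->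
  smooth f.
Proof.
move=> H n x; have [g sg fg] := H x.
apply: (@near_eq_derivable _ _ _ (derive1n n g)); last exact: sg.
by apply: derive1n_near; move: fg; apply: filterS => y ->.
Qed.

Lemma derive1n_cst k n : derive1n n.+1 (cst k : R -> R) = cst 0.
Proof.
elim: n => [|n IH]; first by rewrite derive1n1; apply/funext => x; exact: derive1_cst.
by rewrite derive1nS IH; apply/funext => x; exact: derive1_cst.
Qed.

Lemma smooth_cst k : smooth (cst k : R -> R).
Proof.
by case=> [|n] x; rewrite ?derive1n_cst; exact: derivable_cst.
Qed.

Lemma is_derive_line k b x : is_derive x 1 (fun x => k * x + b) k.
Proof.
have -> : (fun x => k * x + b) = (k *: id + cst b) by apply/funext.
by apply: is_derive_eq; rewrite addr0 [LHS]mulr1.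
Qed.

Lemma is_derive_affine f k b df x : is_derive (k * x + b) 1 f df ->
  is_derive x 1 (fun x => f (k * x + b)) (k * df).
Proof.
move=> fdf; rewrite mulrC.
exact: (@is_derive1_comp _ f (fun x => k * x + b) x _ _ fdf (is_derive_line k b x)).
Qed.

Lemma is_derive_scale f k df x : is_derive x 1 f df ->
  is_derive x 1 (fun x => k * f x) (k * df).
Proof. by move=> fdf; exact: (is_deriveZ k fdf). Qed.

Lemma derive1n_affine f k b n : smooth f ->
  derive1n n (fun x => f (k * x + b)) =
  (fun x => k ^+ n * derive1n n f (k * x + b)).
Proof.
move=> sf; elim: n => [|n IH]; first by apply/funext => x; rewrite mul1r.
apply/funext => x; rewrite derive1nS IH; apply: derive1_val.
by rewrite exprSr -mulrA; apply/is_derive_scale/is_derive_affine/smooth_is_derive.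
Qed.

Lemma smooth_affine f k b : smooth f -> smooth (fun x => f (k * x + b)).
Proof.
move=> sf n x; rewrite derive1n_affine//.
by have [] := is_derive_scale (k ^+ n) (is_derive_affine (smooth_is_derive n (k * x + b) sf)).
Qed.

Lemma derive1nB f g n : smooth f -> smooth g ->
  derive1n n (f - g) = derive1n n f - derive1n n g.
Proof.
move=> sf sg; elim: n => // n IH; apply/funext => x.
rewrite derive1nS IH; apply: derive1_val.
by apply: is_deriveB; exact: smooth_is_derive.
Qed.

Lemma smoothB f g : smooth f -> smooth g -> smooth (f - g).
Proof.
move=> sf sg n x; rewrite derive1nB//.
by apply: derivableB; [exact: sf|exact: sg].
Qed.

Lemma smooth_derive1 f : smooth f -> smooth (derive1 f).
Proof. by move=> sf n x; rewrite -derive1Sn; exact: sf. Qed.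

Lemma smooth_continuous f : smooth f -> continuous f.
Proof.
by move=> sf x; apply: differentiable_continuous; apply/derivable1_diffP/(sf 0%N).
Qed.

(** The bound K on P and on its derivative is the one that dominates the kernels
   [k * derive1 P (k * x - k * a)] and the plateaux below, uniformly in a. *)
Definition smooth_step P (tau K : R) :=
  [/\ smooth P, 0 < tau, (forall y, y <= 0 -> P y = 0),
      (forall y, tau <= y -> P y = 1) &
      (forall y, `|P y| <= K /\ `|derive1 P y| <= K)].

(** Beyond a point tau around which the cutoff equals 1, it may be continued by
   the constant 1: near tau both pieces agree, so the result is smooth. *)
Lemma smooth_step_of_cutoff f (tau : R) : smooth f -> (forall y, 0 <= f y <= 1) ->
  (forall y, y <= 0 -> f y = 0) -> 0 < tau -> {near tau, f =1 cst 1} ->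
  exists P K, smooth_step P tau K.
Proof.
move=> sf f01 f0 tau0 ftau.
pose P y := if y < tau then f y else 1.
have Pl y : y < tau -> {near y, P =1 f}.
  by move=> yt; near=> z; rewrite /P ifT//; near: z; exact: lt_nbhsl.
have Pr y : tau <= y -> {near y, P =1 cst 1}.
  rewrite le_eqVlt => /predU1P[<-|ty].
    by move: ftau; apply: filterS => z fz; rewrite /P fz; case: ifP.
  by near=> z; rewrite /P ifF//; apply/negbTE; rewrite -leNgt ltW//; near: z; exact: lt_nbhsr.
have sP : smooth P.
  apply: smooth_near => x; have [xt|xt] := ltP x tau.
    by exists f => //; exact: Pl.
  by exists (cst 1); [exact: smooth_cst|exact: Pr].
have P'0 y : ~~ (0 <= y <= tau) -> derive1 P y = 0.
  rewrite negb_and -!ltNge => /orP[y0|yt].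
    have Py : {near y, P =1 cst 0}.
      near=> z; have z0 : z < 0 by near: z; exact: lt_nbhsl.
      by rewrite /P ifT ?f0// ?(lt_trans z0)// ltW.
    by have := nbhs_singleton (derive1n_near 1 Py); rewrite !derive1n1 => ->; exact: derive1_cst.
  have := nbhs_singleton (derive1n_near 1 (Pr _ (ltW yt))).
  by rewrite !derive1n1 => ->; exact: derive1_cst.
have cP' : {within `[0, tau], continuous (fun y => `|derive1 P y|)}.
  apply: continuous_subspaceT => y.
  apply: continuous_comp; last exact: norm_continuous.
  exact: (smooth_continuous (smooth_derive1 sP)).
have [c _ cK] := EVT_max (ltW tau0) cP'.
exists P, (1 + `|derive1 P c|); split => //.
- by move=> y y0; rewrite /P ifT ?f0//; exact: le_lt_trans tau0.
- by move=> y ty; rewrite /P ltNge ty.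
move=> y; split.
  have [fy0 fy1] := andP (f01 y).
  rewrite /P; case: ifP => _; rewrite ?normr1 ?lerDl//.
  by rewrite ger0_norm// (le_trans fy1)// lerDl.
have [y0|/P'0 ->] := boolP (0 <= y <= tau); last by rewrite normr0 addr_ge0.
by rewrite (le_trans (cK y _))// ?in_itv//= lerDr.
Unshelve. all: by end_near. Qed.

End test_functions.

(** * Weak derivatives at Lebesgue points *)

Section local_integrability.
Context {R : realType}.
Local Notation mu := (@lebesgue_measure R).
Local Notation hl := (@halfline R).
Implicit Types (f g h P F : R -> R) (k x y a b : R).

Lemma Rintegral_derivative F f a b : a < b ->
  (forall x, a <= x <= b -> is_derive x 1 F (f x)) ->
  (forall x, a <= x <= b -> {for x, continuous f}) ->
  \int[mu]_(x in `[a, b]) f x = F b - F a.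
Proof.
move=> ab dF cf.
have cF x : a <= x <= b -> {for x, continuous F}.
  by move=> /dF [dFx _]; apply: differentiable_continuous; exact/derivable1_diffP.
rewrite /Rintegral (@continuous_FTC2 _ f F a b)//.
- apply/continuous_within_itvP => //; split.
  + by move=> x; rewrite in_itv/= => /andP[ax xb]; apply: cf; rewrite !ltW.
  + by apply: cvg_at_right_filter; apply: cf; rewrite lexx ltW.
  + by apply: cvg_at_left_filter; apply: cf; rewrite lexx ltW.
- split.
  + by move=> x; rewrite in_itv/= => /andP[ax xb]; have [] // := dF x _; rewrite !ltW.
  + by apply: cvg_at_right_filter; apply: cF; rewrite lexx ltW.
  + by apply: cvg_at_left_filter; apply: cF; rewrite lexx ltW.
- by move=> x; rewrite in_itv/= => /andP[ax xb]; apply/derive1_val/dF; rewrite !ltW.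
Qed.

Lemma L2_restrict_measurable f : L2 f -> measurable_fun setT (f \_ hl).
Proof. by move=> /L2_measurable mf; exact: (measurable_restrictT f measurable_halfline).1. Qed.

Lemma L2_integrable_compact f (K : set R) : L2 f -> compact K ->
  mu.-integrable K (EFin \o (f \_ hl)).
Proof.
move=> Lf cK.
have mK : measurable (K : set (g_sigma_algebraType R.-ocitv.-measurable)).
  exact: compact_measurable.
have mF := L2_restrict_measurable Lf.
have I1 : mu.-integrable K (cst 1%E).
  have := @measurable_bounded_integrable _ _ _ mu (cst 1) K mK (compact_finite_measure cK) (measurable_cst _).
  by apply; exact: bounded_cst.
have I2 : mu.-integrable K (EFin \o (fun x => (f \_ hl) x ^+ 2)).
  apply: (@integrableS _ _ _ _ setT) => //.
  rewrite (_ : _ \o _ = (EFin \o (fun x => f x ^+ 2)) \_ hl).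
    by apply/(integrable_mkcond _ _).1 => //; exact: integrable_sqrL2.
  by apply/funext => x /=; rewrite !patchE; case: ifP => // _; rewrite expr0n.
have := integrableD mK I1 I2; apply: le_integrable => //.
  by apply/measurable_EFinP; exact: measurable_funTS.
move=> x _ /=; rewrite lee_fin; set y := (f \_ hl) x.
rewrite (ger0_norm (addr_ge0 ler01 (sqr_ge0 y))) -(real_normK (num_real y)).
by have := sqr_ge0 (`|y| - 1); have := normr_ge0 y; nra.
Qed.

Lemma L2_locally_integrable f : L2 f -> locally_integrable setT (f \_ hl).
Proof.
move=> Lf; split; [exact: L2_restrict_measurable|exact: openT|].
by move=> K _ cK; have /integrableP[] := L2_integrable_compact Lf cK.
Qed.

End local_integrability.

Section steps.
Context {R : realType}.
Local Notation mu := (@lebesgue_measure R).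
Local Notation hl := (@halfline R).
Implicit Types (f g h P F : R -> R) (k x y a b : R).

Lemma tsupport_out h x : ~ tsupport h x -> {near x, h =1 cst 0}.
Proof.
move=> nx; have : nbhs x (~` tsupport h).
  by apply: open_nbhs_nbhs; split => //; exact/closed_openC/closed_closure.
apply: filterS => y ny; apply/eqP/negPn/negP => hy; apply: ny.
exact: subset_closure.
Qed.

Lemma derive1n_tsupport_out h n x : ~ tsupport h x -> derive1n n h x = 0.
Proof.
move=> /tsupport_out/(derive1n_near n)/nbhs_singleton ->.
by case: n => [|n]; rewrite ?derive1n_cst.
Qed.

Lemma L2_compact_support h (K : set R) : continuous h -> compact K ->
  (forall x, ~ K x -> h x = 0) -> L2 h.
Proof.
move=> ch cK h0; apply/L2P; split; first by apply: measurable_funTS; exact: continuous_measurable_fun.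
have mK : measurable (K : set (g_sigma_algebraType R.-ocitv.-measurable)).
  exact: compact_measurable.
apply: (@integrableS _ _ _ _ setT) => //.
rewrite (_ : _ \o _ = (EFin \o (fun x => h x ^+ 2)) \_ K).
  apply/(integrable_mkcond _ _).1 => //.
  apply: continuous_compact_integrable => //.
  by apply: continuous_subspaceT => x; under eq_fun do rewrite expr2; apply: continuousM; exact: ch.
apply/funext => x /=; rewrite patchE; case: ifPn => // /negP xK.
by rewrite h0 ?expr0n// => Kx; apply: xK; rewrite inE.
Qed.

Lemma L2_test h (U : set R) : Cc_infty U h -> L2 h.
Proof.
move=> [sh ch hU]; apply: (L2_compact_support (smooth_continuous sh) ch) => x.
exact: (@derive1n_tsupport_out h 0).
Qed.

Lemma L2_derive1_test h (U : set R) : Cc_infty U h -> L2 (derive1 h).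
Proof.
move=> [sh ch hU].
apply: (L2_compact_support (smooth_continuous (smooth_derive1 sh)) ch) => x.
exact: (@derive1n_tsupport_out h 1).
Qed.

Variables (P : R -> R) (tau K : R).
Hypothesis stepP : smooth_step P tau K.

Let sP : smooth P. Proof. by have [] := stepP. Qed.
Let tau0 : 0 < tau. Proof. by have [] := stepP. Qed.
Let P0 y : y <= 0 -> P y = 0. Proof. by have [_ _ h _ _] := stepP; exact: h. Qed.
Let P1 y : tau <= y -> P y = 1. Proof. by have [_ _ _ h _] := stepP; exact: h. Qed.
Let PK y : `|P y| <= K. Proof. by have [_ _ _ _ h] := stepP; have [] := h y. Qed.
Let P'K y : `|derive1 P y| <= K.
Proof. by have [_ _ _ _ h] := stepP; have [] := h y. Qed.

Let P'0 y : ~~ (0 <= y <= tau) -> derive1 P y = 0.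
Proof.
rewrite negb_and -!ltNge => /orP[y0|yt].
  have Py : {near y, P =1 cst 0}.
    by near=> z; apply: P0; apply: ltW; near: z; exact: lt_nbhsl.
  by have := nbhs_singleton (derive1n_near 1 Py); rewrite !derive1n1 => ->; exact: derive1_cst.
have Py : {near y, P =1 cst 1}.
  by near=> z; apply: P1; apply: ltW; near: z; exact: lt_nbhsr.
by have := nbhs_singleton (derive1n_near 1 Py); rewrite !derive1n1 => ->; exact: derive1_cst.
Unshelve. all: by end_near. Qed.

(** A smooth approximation of the indicator function of ]a, b]; it differs from
   it only on intervals of length tau / k, to the right of a and of b. *)
Definition plateau k a b : R -> R :=
  (fun x => P (k * x + - (k * a))) - (fun x => P (k * x + - (k * b))).

Lemma derive1_plateau k a b x : derive1 (plateau k a b) x =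
  k * derive1 P (k * x - k * a) - k * derive1 P (k * x - k * b).
Proof.
by apply: derive1_val; apply: is_deriveB;
  apply: is_derive_affine; exact: (smooth_is_derive 0 _ sP).
Qed.

Lemma plateau_test k a b : 0 < k -> 0 < a -> a <= b -> Cc_infty hl (plateau k a b).
Proof.
move=> k0 a0 ab; rewrite /plateau.
have sub : tsupport (plateau k a b) `<=` `[a, b + tau / k].
  have cl := (closure_id _).1 (@interval_closed _ (BLeft a) (BRight (b + tau / k)) isT isT).
  rewrite cl; apply: closureS => x /=.
  apply: contra_neqT; rewrite in_itv/= negb_and -!ltNge => /orP[xa|xb].
    by rewrite /plateau !fctE !P0 ?subrr// -mulrBr pmulr_rle0// subr_le0 ltW// (lt_le_trans xa).
  rewrite /plateau !fctE !P1 ?subrr// -mulrBr mulrC -ler_pdivrMr// lerBrDr addrC ltW//.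
  by rewrite (le_lt_trans _ xb)// lerD2r.
split.
- by apply: smoothB; exact: smooth_affine.
- apply: (subclosed_compact _ (@segment_compact _ a (b + tau / k)) sub).
  exact: closed_closure.
- by move=> x /sub; rewrite /halfline /= !in_itv/= andbT => /andP[+ _]; exact: lt_le_trans.
Qed.

(** With k = n + 1, the kernel has integral 1, is bounded by k K and lives on
   [a, a + tau / k]. Hence the error is at most 4 tau K times the mean of |F - F a|
   over the ball of radius 2 tau / k around a, and this mean tends to 0 at a Lebesgue point. *)
Lemma approximate_identity F a : locally_integrable setT F -> lebesgue_pt F a ->
  (forall C : set R, compact C -> mu.-integrable C (EFin \o F)) ->
  \int[mu]_x (F x * (n.+1%:R * derive1 P (n.+1%:R * x - n.+1%:R * a)))
    @[n --> \oo] --> F a.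
Proof.
move=> locF Fa intF.
have mF : measurable_fun setT F by case: locF.
pose k n : R := n.+1%:R.
have k0 n : 0 < k n by rewrite ltr0n.
pose r n : R := 2 * tau / k n.
have r0 n : 0 < r n by rewrite divr_gt0// mulr_gt0.
pose p n x := k n * derive1 P (k n * x - k n * a).
have cp n : continuous (p n).
  have := @smooth_affine _ (derive1 P) (k n) (- (k n * a)) (smooth_derive1 sP).
  move=> /smooth_continuous ch x.
  by apply: cvgM; [exact: cvg_cst|exact: ch].
have p0 n x : ~~ (a <= x <= a + tau / k n) -> p n x = 0.
  move=> H; rewrite /p P'0 ?mulr0//; apply: contra H.
  rewrite -mulrBr pmulr_rge0// subr_ge0 => /andP[-> /=].
  by rewrite mulrC -ler_pdivlMr// lerBlDr addrC.
have at0 n : a < a + tau / k n by rewrite ltrDl divr_gt0.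
have ip n : \int[mu]_(x in `[a, a + tau / k n]) p n x = 1.
  have dP x : a <= x <= a + tau / k n ->
      is_derive x 1 (fun x => P (k n * x + - (k n * a))) (p n x).
    by move=> _; apply: is_derive_affine; exact: (smooth_is_derive 0 _ sP).
  rewrite (Rintegral_derivative (at0 n) dP); last by move=> x _; exact: cp.
  rewrite P1 ?P0 ?subr0 ?subrr//.
  by rewrite mulrDr addrAC subrr add0r mulrCA divff ?mulr1// gt_eqF.
pose B n := `[a, a + tau / k n]%classic : set R.
have mB n : measurable (B n : set (g_sigma_algebraType R.-ocitv.-measurable)).
  exact: measurable_itv.
have cB n : compact (B n) by exact: segment_compact.
have pK n x : `|p n x| <= k n * K.
  by rewrite normrM gtr0_norm// ler_pM2l.
have iF n : mu.-integrable (B n) (EFin \o F) by exact: intF.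
have i1 n : mu.-integrable (B n) (EFin \o cst (F a)).
  apply: continuous_compact_integrable => //.
  by apply: continuous_subspaceT; exact: cst_continuous.
have mp n : measurable_fun (B n) (p n).
  by apply: measurable_funTS; exact: continuous_measurable_fun.
have iFp n : mu.-integrable (B n) (EFin \o (fun x => F x * p n x)).
  exact: (@integrable_mul_bounded _ _ _ _ (k n * K)).
have i1p n : mu.-integrable (B n) (EFin \o (fun x => F a * p n x)).
  exact: (@integrable_mul_bounded _ _ (cst (F a)) _ (k n * K)).
have iD n : mu.-integrable (B n) (EFin \o (fun x => F x - F a)).
  exact: (integrableB (mB n) (iF n) (i1 n)).
have iDp n : mu.-integrable (B n) (EFin \o (fun x => (F x - F a) * p n x)).
  exact: (@integrable_mul_bounded _ _ (fun x => F x - F a) _ (k n * K)).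
have E n : \int[mu]_x (F x * p n x) - F a
         = \int[mu]_(x in B n) ((F x - F a) * p n x).
  under [RHS]eq_Rintegral do rewrite mulrBl.
  rewrite RintegralB//; congr (_ - _).
    rewrite [RHS]Rintegral_mkcond; apply: eq_Rintegral => x _; rewrite patchE.
    case: ifPn => // /negP xB; rewrite p0 ?mulr0//; apply/negP => H; apply: xB.
    by rewrite inE /B /= in_itv.
  rewrite RintegralZl// ?ip ?mulr1//.
  have := @integrable_mul_bounded _ _ (cst 1) _ (k n * K) (mB n) (mp n).
  rewrite (_ : (fun x => cst 1 x * p n x) = p n); last by apply/funext => x; rewrite mul1r.
  apply; first by move=> x _; exact: pK.
  apply: continuous_compact_integrable => //.
  by apply: continuous_subspaceT; exact: cst_continuous.
have K0 : 0 <= K by exact: le_trans (PK 0).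
have bound n : (`|\int[mu]_x (F x * p n x) - F a|%:E
    <= (4 * tau * K)%:E * davg F a (r n))%E.
  rewrite E EFin_normr_Rintegral//.
  apply: (le_trans (le_abse_integral mu (mB n) _)); first exact: (measurable_int _ (iDp n)).
  have dE : (\int[mu]_(x in ball a (r n)) `|(F x - F a)%:E| =
     (r n *+ 2)%:E * davg F a (r n))%E.
    rewrite /davg /iavg lebesgue_measure_ball ?ltW// muleA inver ?gt_eqF ?pmulrn_lgt0//.
    rewrite -EFinM divff ?mul1e// gt_eqF// pmulrn_lgt0//.
  have -> : (4 * tau * K)%:E = ((k n * K)%:E * (r n *+ 2)%:E)%E.
    rewrite -EFinM /r; congr EFin; rewrite -mulr_natr; field.
    by rewrite gt_eqF// k0.
  rewrite -muleA -dE.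
  have mFD (C : set R) : measurable C -> measurable_fun C (fun x => `|(F x - F a)%:E|%E).
    move=> mC; apply: measurableT_comp => //; apply/measurable_EFinP.
    by apply: measurable_funB => //; exact: measurable_funTS.
  rewrite -ge0_integralZl//; last 3 first.
    exact: measurable_ball.
    by apply: mFD; exact: measurable_ball.
    by rewrite lee_fin mulr_ge0// ltW.
  apply: (@le_trans _ _ (\int[mu]_(x in B n) ((k n * K)%:E * `|(F x - F a)%:E|))%E).
    apply: ge0_le_integral => //.
    - exact: (measurable_int _ (integrable_abse (iDp n))).
    - by apply: emeasurable_funM => //; apply: mFD; exact: measurable_itv.
    - move=> x _; rewrite /= lee_fin normrM mulrC; apply: ler_wpM2r => //; exact: pK.
  apply: ge0_subset_integral => //.
  - exact: measurable_ball.
  - by apply: emeasurable_funM => //; apply: mFD; exact: measurable_ball.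
  - by move=> x _; rewrite mule_ge0// lee_fin mulr_ge0// ltW.
  move=> x; rewrite /B /= in_itv/= ball_itv /= in_itv/= => /andP[ax xb].
  rewrite (lt_le_trans _ ax) ?ltrBlDr ?ltrDl//= (le_lt_trans xb)// ltrD2l /r.
  by rewrite ltr_pM2r ?invr_gt0// ltr_pMl// ltr1n.
have rc0 : r n @[n --> \oo] --> 0.
  rewrite /r -(mulr0 (2 * tau)); apply: cvgM; first exact: cvg_cst.
  exact: cvg_harmonic.
have H1 : davg F a (r n) @[n --> \oo] --> 0%E.
  by move/cvge_at_rightP : Fa => /(_ r); apply.
have H2 : ((4 * tau * K)%:E * davg F a (r n))%E @[n --> \oo] --> 0%E.
  by rewrite -(mule0 (4 * tau * K)%:E); apply: cvgeM => //; exact: cvg_cst.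
have H3 : (`|\int[mu]_x (F x * p n x) - F a|%:E)%E @[n --> \oo] --> 0%E.
  apply: (squeeze_cvge _ (@cvg_cst _ 0%E _ _ _) H2).
  by apply: nearW => m; rewrite bound andbT lee_fin.
by move/fine_cvgP : H3 => [_ H3]; apply/subr_cvg0; exact: norm_cvg0.
Unshelve. all: by end_near. Qed.

Lemma step_cvg a x :
  P (n.+1%:R * x + - (n.+1%:R * a)) @[n --> \oo] --> ((a < x)%R%:R : R).
Proof.
apply: cvg_near_cst; have [ax|xa] := ltP a x; last first.
  by apply: nearW => n; rewrite P0// -mulrBr pmulr_rle0// subr_le0.
near=> n; rewrite P1// -mulrBr -ler_pdivrMr ?subr_gt0//.
near: n; by have [N _ HN] := nbhs_infty_ger (tau / (x - a)); exists N => // n /HN /= /le_trans; apply; rewrite ler_nat.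
Unshelve. all: by end_near. Qed.

Lemma plateau_cvg g a b : L2 g -> 0 < a -> a < b ->
  \int[mu]_(x in hl) (g x * plateau n.+1%:R a b x) @[n --> \oo] -->
  \int[mu]_(x in `]a, b]) g x.
Proof.
move=> Lg a0 ab.
pose G := g \_ hl.
have mG : measurable_fun setT G by exact: L2_restrict_measurable.
have cpl k : continuous (plateau k a b).
  by apply: smooth_continuous; apply: smoothB; exact: smooth_affine.
have K0 : 0 <= K by exact: le_trans (PK 0).
pose D := `[a, b + tau]%classic : set R.
have mD : measurable (D : set (g_sigma_algebraType R.-ocitv.-measurable)).
  exact: measurable_itv.
have sub n x : ~ D x -> plateau n.+1%:R a b x = 0.
  rewrite /D /= in_itv/= => /negP; rewrite negb_and -!ltNge => /orP[xa|xb].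
    by rewrite /plateau !fctE !P0 ?subrr// -mulrBr pmulr_rle0// subr_le0 ltW// (lt_trans xa).
  have xt : tau <= n.+1%:R * (x - b).
    rewrite (@le_trans _ _ (1 * (x - b)))//; first by rewrite mul1r lerBrDl ltW.
    by rewrite ler_wpM2r ?ler1n// subr_ge0 ltW// (lt_trans _ xb)// ltrDl.
  rewrite /plateau !fctE !P1 ?subrr// -mulrBr// (le_trans xt)// ler_wpM2l//.
  by rewrite lerD2l lerN2 ltW.
have EL n : \int[mu]_(x in hl) (g x * plateau n.+1%:R a b x) =
    \int[mu]_(x in D) (G x * plateau n.+1%:R a b x).
  rewrite Rintegral_mkcond [RHS]Rintegral_mkcond; apply: eq_Rintegral => x _.
  rewrite !patchE /G patchE; case: ifPn => [hx|nhx]; last first.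
    by case: ifP => //; rewrite mul0r.
  by case: ifPn => // /negP xD; rewrite sub ?mulr0// => Dx; apply: xD; rewrite inE.
have ER : \int[mu]_(x in `]a, b]) g x = \int[mu]_(x in D) (G x * \1_(`]a, b]) x).
  rewrite Rintegral_mkcond [RHS]Rintegral_mkcond; apply: eq_Rintegral => x _.
  rewrite !patchE /G patchE indicE; case: ifPn => [|nx]; last by rewrite mulr0 if_same.
  rewrite inE /= in_itv/= => /andP[ax xb].
  rewrite !ifT ?mulr1// inE.
    by rewrite /halfline/= in_itv/= andbT (lt_trans a0).
  by rewrite /D /= in_itv/= ltW//= (le_trans xb)// lerDl ltW.
under eq_fun do rewrite EL; rewrite ER.
have cD : compact D by exact: segment_compact.
have iG : mu.-integrable D (EFin \o G) by exact: L2_integrable_compact.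
apply: fine_cvg; rewrite /Rintegral fineK; last first.
  apply: integrable_fin_num => //.
  apply: (@integrable_mul_bounded _ _ _ _ 1) => //.
  - by move=> x _; rewrite indicE; case: (_ \in _); rewrite ?normr1 ?normr0.
apply: (@dominated_cvg _ _ _ mu D mD _ _ (fun x => (2 * K * `|G x|)%:E)).
- move=> n; apply/measurable_EFinP; apply: measurable_funM.
    exact: measurable_funTS.
  by apply: measurable_funTS; exact: continuous_measurable_fun.
- move=> x _; apply: cvg_EFin; first exact: nearW.
  apply: cvgM; first exact: cvg_cst.
  have -> : \1_(`]a, b]) x = (a < x)%R%:R - (b < x)%R%:R :> R.
    rewrite indicE mem_setE in_itv/= (leNgt x b).
    have [bx|xb] := ltP b x; first by rewrite (lt_trans ab bx) subrr.
    by rewrite andbT subr0.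
  rewrite (_ : (fun n : nat => _) = (fun n : nat =>
    P (n.+1%:R * x + - (n.+1%:R * a)) - P (n.+1%:R * x + - (n.+1%:R * b))))//.
  by apply: cvgB; exact: step_cvg.
- by move=> x _.
- under eq_fun do rewrite EFinM.
  apply: integrableZl => //.
  exact: (integrable_norm iG).
- move=> n x _; rewrite lee_fin normrM mulrC ler_wpM2r//.
  have -> : 2 * K = K + K by ring.
  by apply: le_trans (ler_normB _ _) _; apply: lerD.
Unshelve. all: by end_near. Qed.

Lemma L2_approximate_identity k a : 0 < k ->
  L2 (fun x => k * derive1 P (k * x - k * a)).
Proof.
move=> k0; apply: (@L2_compact_support _ `[a, a + tau / k]).
- move=> x; apply: cvgM; first exact: cvg_cst.
  exact: (smooth_continuous (@smooth_affine _ (derive1 P) k (- (k * a)) (smooth_derive1 sP))).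
- exact: segment_compact.
move=> x; rewrite /= in_itv/= => H; rewrite P'0 ?mulr0//.
apply/negP => /andP[]; rewrite -mulrBr pmulr_rge0// subr_ge0 => ax xt.
by apply: H; rewrite ax/= -lerBlDl ler_pdivlMr// mulrC.
Qed.

(** The test function is the plateau over ]a, b]: its derivative is the difference
   of two approximate identities, at a and at b, while the plateau itself tends to
   the indicator function of ]a, b]. *)
Lemma weak_derivative_increment f g a b : L2 f -> L2 g -> weak_derivative f g ->
  0 < a -> a < b -> lebesgue_pt (f \_ hl) a -> lebesgue_pt (f \_ hl) b ->
  f b - f a = \int[mu]_(x in `]a, b]) g x.
Proof.
move=> Lf Lg fg a0 ab fa fb.
have lim c : 0 < c -> lebesgue_pt (f \_ hl) c ->
    \int[mu]_(x in hl) (f x * (n.+1%:R * derive1 P (n.+1%:R * x - n.+1%:R * c)))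
      @[n --> \oo] --> f c.
  move=> c0 fc; have -> : f c = (f \_ hl) c.
    by rewrite patchE ifT// inE /halfline/= in_itv/= c0.
  have := approximate_identity (L2_locally_integrable Lf) fc
    (fun C => @L2_integrable_compact _ f C Lf).
  apply: cvg_trans; apply: near_eq_cvg; apply: nearW => n.
  rewrite [RHS]Rintegral_mkcond; apply: eq_Rintegral => x _.
  by rewrite !patchE; case: ifP => // _; rewrite mul0r.
have H n : \int[mu]_(x in hl) (f x * (n.+1%:R * derive1 P (n.+1%:R * x - n.+1%:R * b))) -
    \int[mu]_(x in hl) (f x * (n.+1%:R * derive1 P (n.+1%:R * x - n.+1%:R * a))) =
    \int[mu]_(x in hl) (g x * plateau n.+1%:R a b x).
  have n0 : 0 < n.+1%:R :> R by [].
  have := fg _ (plateau_test n0 a0 (ltW ab)).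
  under eq_Rintegral do rewrite derive1_plateau mulrBr.
  rewrite RintegralB//.
  - by move=> fgn; rewrite -opprB fgn opprK.
  - by apply: integrable_mulL2 => //; exact: L2_approximate_identity.
  - by apply: integrable_mulL2 => //; exact: L2_approximate_identity.
have b0 : 0 < b by exact: lt_trans ab.
apply: (cvg_unique (@Rhausdorff R) (cvgB (lim b b0 fb) (lim a a0 fa))).
apply: cvg_trans (plateau_cvg Lg a0 ab); apply: near_eq_cvg; apply: nearW => n.
by rewrite -H.
Qed.

End steps.

(** * Continuous representatives and traces *)

Section representative.
Context {R : realType}.
Local Notation mu := (@lebesgue_measure R).
Local Notation hl := (@halfline R).
Implicit Types (f g p q F G : R -> R) (k x y a b : R).

Lemma halflineE x : hl x = (0 < x) :> Prop.
Proof. by rewrite /halfline/= in_itv/= andbT. Qed.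

(** Absolute continuity of F on [0, b], with density p. *)
Definition primitive b F p := mu.-integrable `[0, b] (EFin \o p) /\
  forall x, 0 <= x <= b -> F x = F 0 + \int[mu]_(y in `[0, x]) p y.

Lemma primitive_within b F p : 0 <= b -> primitive b F p ->
  {within `[0, b], continuous F}.
Proof.
move=> b0 [ip Fp].
have cI := parameterized_integral_continuous b0 ip.
have : {within `[0, b],
    continuous (fun x => F 0 + parameterized_integral mu 0 x p)}.
  by move=> x; apply: cvgD; [exact: cvg_cst|exact: cI].
apply: subspace_eq_continuous => x; rewrite inE /= in_itv/= => xb.
by rewrite [RHS]Fp.
Qed.

Lemma primitive_continuous F p : (forall b, 0 <= b -> primitive b F p) ->
  {within `[0, +oo[, continuous F}.
Proof.
move=> prim.
have key b : 0 < b -> {within `[0, b], continuous F}.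
  by move=> b0; exact: primitive_within (ltW b0) (prim _ (ltW b0)).
apply/continuous_within_itvcyP; split.
  move=> x; rewrite in_itv/= andbT => x0.
  have x1 : 0 < x + 1 := addr_gt0 x0 ltr01.
  have [cF _ _] := (continuous_within_itvP F x1).1 (key _ x1).
  by apply: cF; rewrite in_itv/= x0 ltrDl ltr01.
by have [] := (continuous_within_itvP F ltr01).1 (key _ ltr01).
Qed.

(** Two functions that are right-continuous at 0 and have different values there
   differ on some ]0, e[, which is not negligible. *)
Lemma trace_eq f F : {within `[0, +oo[, continuous F} -> ae_hl f F -> trace f = F 0.
Proof.
move=> cF fF; rewrite /trace; case: xgetP => [a _|]; last first.
  by move=> /(_ (F 0)) H; exfalso; apply: H; exists F.
move=> [g [cg fg <-]]; apply/eqP; rewrite -subr_eq0; apply/negPn/negP => d0.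
have [_ rF] := (continuous_within_itvcyP _ _).1 cF.
have [_ rg] := (continuous_within_itvcyP _ _).1 cg.
have rd : (fun x => g x - F x) x @[x --> (0 : R)^'+] --> g 0 - F 0.
  by apply: cvgB.
have : \forall x \near (0 : R)^'+, g x - F x != 0.
  have [gt0|lt0] := ltP 0 (g 0 - F 0).
    by near=> x; rewrite gt_eqF//; near: x; exact: (cvgr_gt _ rd _ gt0).
  have {}lt0 : g 0 - F 0 < 0 by rewrite lt_neqAle d0.
  by near=> x; rewrite lt_eqF//; near: x; exact: (cvgr_lt _ rd _ lt0).
move=> [e /= e0 He].
have gF : {ae mu, forall x, hl x -> g x = F x}.
  by apply: ae_mono2 fg fF => x /= fx Fx hx; rewrite -fx// Fx.
have [N [mN N0 sN]] := gF.
have : (mu (`]0%R, e[%classic : set R) <= mu N)%E.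
  apply: le_measure; rewrite ?inE//.
  move=> x; rewrite /= in_itv/= => /andP[x0 xe]; apply: sN => /= H.
  have := He x; rewrite /= sub0r normrN gtr0_norm// => /(_ xe x0).
  by rewrite H ?subrr ?eqxx// halflineE.
by rewrite N0 lebesgue_measure_itv/= lte_fin e0 sube0 lee_fin leNgt e0.
Unshelve. all: by end_near. Qed.

Hypothesis step : exists P : R -> R, exists tau K, smooth_step P tau K.

(** The difference w of two weak derivatives of f is a weak derivative of 0, so that
   its integral over every ]a, b] vanishes, hence w itself at its Lebesgue points. *)
Lemma weak_derivative_unique f g1 g2 : L2 f -> L2 g1 -> L2 g2 ->
  weak_derivative f g1 -> weak_derivative f g2 -> ae_hl g1 g2.
Proof.
move=> Lf L1 L2' w1 w2; have [P [tau [K stepP]]] := step.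
pose w x := g1 x - g2 x.
have Lw : L2 w by exact: L2B.
have ww : weak_derivative (fun=> 0) w.
  move=> h ch; rewrite (_ : \int[mu]_(x in _) (0 * _) = 0); last first.
    by under eq_Rintegral do rewrite mul0r; rewrite Rintegral_cst// mul0r.
  under eq_Rintegral do rewrite mulrBl.
  have Lh := L2_test ch.
  rewrite RintegralB//; try exact: integrable_mulL2.
  by rewrite opprB -[X in _ = X - _](opprK) -(w1 _ ch) -(w2 _ ch) addrC subrr.
have leb0 x : lebesgue_pt ((fun=> 0) \_ hl) x.
  rewrite (_ : _ \_ _ = cst 0); last first.
    by apply/funext => y; rewrite patchE; case: ifP.
  by apply: (@continuous_lebesgue_pt _ _ _ setT) => //; [exact: open_nbhsT|exact: cvg_cst].
have I0 a b : 0 < a -> a < b -> \int[mu]_(x in `]a, b]) w x = 0.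
  move=> a0 ab; rewrite -(weak_derivative_increment stepP L2_0 Lw ww a0 ab)//.
  by rewrite subrr.
have := lebesgue_differentiation (L2_locally_integrable Lw).
apply: ae_mono => x lx; rewrite halflineE => x0; apply/eqP; rewrite -subr_eq0; apply/eqP.
have x2 : x / 2 < x by rewrite ltr_pdivrMr// ltr_pMr// ltr1n.
have hx : 0 < x / 2 by rewrite divr_gt0.
have iw : mu.-integrable `]x / 2, x + 1] (EFin \o (w \_ hl)).
  have := L2_integrable_compact Lw (@segment_compact _ (x / 2) (x + 1)).
  by apply: integrableS => //; apply: subset_itvr; rewrite bnd_simp.
have x1 : x < x + 1 by rewrite ltrDl.
have [] := FTC1_lebesgue_pt x1 iw _ lx; first exact: x2.
move=> _; rewrite patchE ifT ?inE ?halflineE// => wx; rewrite -/(w x) -wx.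
rewrite derive1E (@near_eq_derive _ _ _ _ (cst 0)) ?derive_cst//.
near=> y; have xy : x / 2 < y by near: y; exact: lt_nbhsr.
rewrite /= -[RHS](I0 _ _ hx xy); apply: eq_Rintegral => z.
rewrite inE /= in_itv/= => /andP[xz _]; rewrite patchE ifT// inE halflineE.
exact: lt_trans xz.
Unshelve. all: by end_near. Qed.

(** Starting from a Lebesgue point a of f, the function f a + int_a^x g agrees with f
   at all the Lebesgue points of f. *)
Lemma sobolev_representative f g : L2 f -> L2 g -> weak_derivative f g ->
  exists F, (forall b, 0 <= b -> primitive b F (g \_ hl)) /\ ae_hl f F.
Proof.
move=> Lf Lg fg; have [P [tau [K stepP]]] := step.
have aeL := lebesgue_differentiation (L2_locally_integrable Lf).
have [a a0 la] : exists2 a, 0 < a & lebesgue_pt (f \_ hl) a.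
  apply: contrapT => H; have [N [mN N0 sN]] := aeL.
  have : (mu (`]0%R, 1%R[%classic : set R) <= mu N)%E.
    apply: le_measure; rewrite ?inE//.
    move=> x; rewrite /= in_itv/= => /andP[x0 _]; apply: sN => /= lx.
    by apply: H; exists x.
  by rewrite N0 lebesgue_measure_itv/= lte_fin ltr01 sube0 lee_fin ler10.
have iG b : mu.-integrable `[0, b] (EFin \o (g \_ hl)).
  by apply: L2_integrable_compact => //; exact: segment_compact.
pose I x := \int[mu]_(y in `[0, x]) (g \_ hl) y.
have I0 : I 0 = 0 by rewrite /I set_itv1 Rintegral_set1.
have ID x y : 0 < x -> x < y -> I y - I x = \int[mu]_(z in `]x, y]) g z.
  move=> x0 xy; rewrite /I Rintegral_itvB ?bnd_simp//; [|exact: ltW|exact: ltW].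
  apply: eq_Rintegral => z; rewrite inE /= in_itv/= => /andP[xz _].
  by rewrite patchE ifT// inE halflineE (lt_trans x0).
exists (fun x => f a - I a + I x); split.
  by move=> b b0; split => // x _; rewrite I0 addr0.
move: aeL; apply: ae_mono => x lx; rewrite halflineE => x0.
have [xa|ax|->] := ltgtP x a; last by rewrite subrK.
  have := weak_derivative_increment stepP Lf Lg fg x0 xa lx la.
  by rewrite -(ID _ _ x0 xa) => H; lra.
have := weak_derivative_increment stepP Lf Lg fg a0 ax la lx.
by rewrite -(ID _ _ a0 ax) => H; lra.
Qed.

End representative.

(** * Products of absolutely continuous functions *)

Section product_rule.
Context {R : realType}.
Local Notation mu := (@lebesgue_measure R).
Local Notation hl := (@halfline R).
Implicit Types (f g p q F G : R -> R) (k x y a b : R).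

(** Fubini on the triangle [0 <= z <= y <= b]. This is integration by parts for
   two primitives that vanish at 0, without any continuity of their densities. *)
Lemma integral_triangle p q b : 0 <= b ->
  mu.-integrable `[0, b] (EFin \o p) -> mu.-integrable `[0, b] (EFin \o q) ->
  \int[mu]_(y in `[0, b]) (p y * \int[mu]_(z in `[0, y]) q z) =
  \int[mu]_(z in `[0, b]) (q z * \int[mu]_(y in `[z, b]) p y).
Proof.
move=> b0 ip iq.
pose D := `[0, b]%classic : set R.
have mD : measurable (D : set (g_sigma_algebraType R.-ocitv.-measurable)).
  exact: measurable_itv.
have res (r : R -> R) : EFin \o (r \_ D) = (EFin \o r) \_ D.
  by rewrite restrict_EFin.
have iP : mu.-integrable setT (EFin \o (p \_ D)).
  by rewrite res; apply/(integrable_mkcond _ mD).1.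
have iQ : mu.-integrable setT (EFin \o (q \_ D)).
  by rewrite res; apply/(integrable_mkcond _ mD).1.
have mP : measurable_fun setT (p \_ D).
  by apply/measurable_EFinP; exact: measurable_int iP.
have mQ : measurable_fun setT (q \_ D).
  by apply/measurable_EFinP; exact: measurable_int iQ.
pose T := g_sigma_algebraType R.-ocitv.-measurable.
pose f (yz : T * T) : \bar R :=
  ((p \_ D) yz.1 * (q \_ D) yz.2 * ((yz.2 : R) <= yz.1)%R%:R)%:E.
have mf : measurable_fun setT f.
  apply/measurable_EFinP; apply: measurable_funM.
    apply: measurable_funM.
      by apply: measurableT_comp => //; exact: measurable_fst.
    by apply: measurableT_comp => //; exact: measurable_snd.
  rewrite (_ : (fun yz : T * T => ((yz.2 : R) <= yz.1)%R%:R : R) =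
      \1_([set yz : T * T | (yz.2 : R) <= yz.1])).
    apply: measurable_indic; rewrite -[X in measurable X]setTI.
    exact: measurable_fun_le.
  by apply/funext => yz; rewrite indicE mem_setE.
have If : (mu \x mu)%E.-integrable setT f.
  apply/integrable12ltyP => //.
  have [_ Pfin] := integrableP _ _ _ iP; have [_ Qfin] := integrableP _ _ _ iQ.
  apply: (@le_lt_trans _ _ (\int[mu]_y ((\int[mu]_z `|(q \_ D) z|%:E) * `|(p \_ D) y|%:E))%E).
    apply: ge0_le_integral => //.
    - by move=> y _; exact: integral_ge0.
    - apply: (@measurable_fun_fubini_tonelli_F _ _ _ _ _ mu (abse \o f)).
        exact: measurableT_comp.
      by move=> x; exact: abse_ge0.
    - by apply: measurable_funeM; apply/measurable_EFinP; exact: measurableT_comp.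
    move=> y _; rewrite muleC -ge0_integralZl//; last first.
      by apply/measurable_EFinP; exact: measurableT_comp.
    apply: ge0_le_integral => //.
    - apply: measurableT_comp => //.
      exact: (measurableT_comp mf (pair1_measurable y)).
    - by apply: measurable_funeM; apply/measurable_EFinP; exact: measurableT_comp.
    - move=> z _; rewrite /f /= lee_fin !normrM ler_piMr ?mulr_ge0//.
      by rewrite normr_nat lern1 leq_b1.
  rewrite ge0_integralZl//; last 2 first.
    by apply/measurable_EFinP; exact: measurableT_comp.
    exact: integral_ge0.
  by rewrite lte_mul_pinfty// ?integral_ge0// ge0_fin_numE// integral_ge0.
have int_sub (r : R -> R) (x y : R) : 0 <= x -> y <= b ->
    mu.-integrable D (EFin \o r) -> mu.-integrable `[x, y] (EFin \o r).
  move=> x0 yb; apply: integrableS => //.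
  by apply: subset_itvScc; rewrite bnd_simp.
have mI (x y : R) : measurable (`[x, y]%classic : set T) by exact: measurable_itv.
have L y : (\int[mu]_z f (y, z))%E =
    (((fun y => p y * \int[mu]_(z in `[0, y]) q z) \_ D) y)%:E.
  rewrite patchE; case: ifPn => yD; last first.
    rewrite (eq_integral (cst 0%E)) ?integral0// => z _.
    by rewrite /f /= patchE (negbTE yD) !mul0r.
  have := yD; rewrite inE /D /= in_itv/= => /andP[y0 yb].
  have iqy := int_sub _ _ _ (lexx 0) yb iq.
  rewrite -RintegralZl// -EFin_Rintegral//; last first.
    exact: (integrableZl (mI 0 y) (p y) iqy).
  rewrite [RHS]integral_mkcond; apply: eq_integral => z _.
  rewrite /f /= !patchE yD /D !mem_setE !in_itv/=.
  have [z0|z0] := leP 0 z; last by rewrite mulr0 mul0r.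
  have [zy|zy] := leP (z : R) y; last by rewrite mulr0.
  by rewrite (le_trans zy yb) mulr1.
have M z : (\int[mu]_y f (y, z))%E =
    (((fun z => q z * \int[mu]_(y in `[z, b]) p y) \_ D) z)%:E.
  rewrite patchE; case: ifPn => zD; last first.
    rewrite (eq_integral (cst 0%E)) ?integral0// => y _.
    by rewrite /f /= [X in _ * X * _]patchE (negbTE zD) mulr0 mul0r.
  have := zD; rewrite inE /D /= in_itv/= => /andP[z0 zb].
  have ipz := int_sub _ _ _ z0 (lexx b) ip.
  rewrite -RintegralZl// -EFin_Rintegral//; last first.
    exact: (integrableZl (mI z b) (q z) ipz).
  rewrite [RHS]integral_mkcond; apply: eq_integral => y _.
  rewrite /f /= !patchE zD /D !mem_setE !in_itv/=.
  have [zy|zy] := leP (z : R) y; last by rewrite mulr0.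
  by rewrite (le_trans z0 zy)/= mulr1; case: ifP; rewrite ?mul0r// mulrC.
rewrite [LHS]Rintegral_mkcond [RHS]Rintegral_mkcond /Rintegral; congr fine.
transitivity (\int[mu]_y \int[mu]_z f (y, z))%E.
  by apply: eq_integral => y _; rewrite L.
by rewrite (Fubini If); apply: eq_integral => z _; rewrite M.
Qed.

Lemma integrable_mul_continuous b p G : 0 <= b ->
  mu.-integrable `[0, b] (EFin \o p) -> {within `[0, b], continuous G} ->
  mu.-integrable `[0, b] (EFin \o (fun x => p x * G x)).
Proof.
move=> b0 ip cG.
have cnG : {within `[0, b], continuous (fun x => `|G x|)}.
  by move=> x; apply: continuous_comp; [exact: cG|exact: norm_continuous].
have [c _ cK] := EVT_max b0 cnG.
apply: (@integrable_mul_bounded _ _ _ _ `|G c|) => //.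
by apply: subspace_continuous_measurable_fun => //; exact: measurable_itv.
Qed.

(** Once the values at 0 are split off, only the product of two primitives
   vanishing at 0 remains, to which [integral_triangle] applies. *)
Lemma primitiveM b F G p q : 0 <= b -> primitive b F p -> primitive b G q ->
  primitive b (fun x => F x * G x) (fun x => p x * G x + F x * q x).
Proof.
move=> b0 pF pG.
have cF := primitive_within b0 pF; have cG := primitive_within b0 pG.
case: (pF) (pG) => [ip Fp] [iq Gq].
have mI (x y : R) : measurable (`[x, y]%classic : set (g_sigma_algebraType R.-ocitv.-measurable)).
  exact: measurable_itv.
have ipG := integrable_mul_continuous b0 ip cG.
have iFq : mu.-integrable `[0, b] (EFin \o (fun x => F x * q x)).
  rewrite (_ : (fun x => F x * q x) = (fun x => q x * F x)).
    exact: integrable_mul_continuous.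
  by apply/funext => x; rewrite mulrC.
split; first exact: (integrableD (mI 0 b) ipG iFq).
move=> x /andP[x0 xb].
have sub (r : R -> R) : mu.-integrable `[0, b] (EFin \o r) ->
    mu.-integrable `[0, x] (EFin \o r).
  by apply: integrableS => //; apply: subset_itvScc; rewrite bnd_simp.
have {}ip := sub _ ip; have {}iq := sub _ iq.
pose Ip y := \int[mu]_(z in `[0, y]) p z; pose Iq y := \int[mu]_(z in `[0, y]) q z.
have cIp : {within `[0, x], continuous Ip}.
  exact: (parameterized_integral_continuous x0 ip).
have cIq : {within `[0, x], continuous Iq}.
  exact: (parameterized_integral_continuous x0 iq).
have ipIq := integrable_mul_continuous x0 ip cIq.
have iqIp := integrable_mul_continuous x0 iq cIp.
have tri := integral_triangle x0 ip iq.
have triE : \int[mu]_(y in `[0, x]) (p y * Iq y) =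
    Ip x * Iq x - \int[mu]_(y in `[0, x]) (q y * Ip y).
  rewrite tri -RintegralZl// -RintegralB//; last exact: (integrableZl (mI 0 x) _ iq).
  apply: eq_Rintegral => z; rewrite inE /= in_itv/= => /andP[z0 zx].
  rewrite (mulrC (Ip x)) -mulrBr; congr (_ * _).
  rewrite /Ip (@Rintegral_itvB _ p (BLeft 0) (BRight x) z) ?bnd_simp//.
  rewrite Rintegral_itv_obnd_cbnd//; move: ip; apply: integrableS => //.
  by apply: subset_itvr; rewrite bnd_simp.
have iGp : mu.-integrable `[0, x] (EFin \o (fun y => G 0 * p y)).
  exact: (integrableZl (mI 0 x) (G 0) ip).
have iFq0 : mu.-integrable `[0, x] (EFin \o (fun y => F 0 * q y)).
  exact: (integrableZl (mI 0 x) (F 0) iq).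
have i1 : mu.-integrable `[0, x] (EFin \o (fun y => G 0 * p y + p y * Iq y)).
  exact: (integrableD (mI 0 x) iGp ipIq).
have i2 : mu.-integrable `[0, x] (EFin \o (fun y => F 0 * q y + q y * Ip y)).
  exact: (integrableD (mI 0 x) iFq0 iqIp).
have -> : \int[mu]_(y in `[0, x]) (p y * G y + F y * q y) =
  \int[mu]_(y in `[0, x]) (G 0 * p y + p y * Iq y) +
  \int[mu]_(y in `[0, x]) (F 0 * q y + q y * Ip y).
  rewrite -RintegralD//.
  apply: eq_Rintegral => y; rewrite inE /= in_itv/= => /andP[y0 yx].
  have yb : 0 <= y <= b by rewrite y0 (le_trans yx).
  by rewrite Gq// Fp//; rewrite -/(Iq y) -/(Ip y); ring.
rewrite !RintegralD//.
rewrite !RintegralZl// triE -/(Ip x) -/(Iq x).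
by rewrite Fp ?x0// Gq ?x0// -/(Ip x) -/(Iq x); ring.
Qed.

End product_rule.

(** * Weighted integration by parts on the half-line *)

Section integration_by_parts.
Context {R : realType}.
Local Notation mu := (@lebesgue_measure R).
Local Notation hl := (@halfline R).
Implicit Types (f g p q F G H h w : R -> R) (k x y a b : R).

Lemma primitive_C1 b F f : 0 <= b ->
  (forall x, 0 <= x -> is_derive x 1 F (f x)) ->
  (forall x, 0 <= x -> {for x, continuous f}) -> primitive b F f.
Proof.
move=> b0 dF cf; split.
  apply: continuous_compact_integrable; first exact: segment_compact.
  apply: continuous_in_subspaceT => x; rewrite inE/= in_itv/= => /andP[x0 _].
  exact: cf.
move=> x /andP[]; rewrite le_eqVlt => /predU1P[<-|x0] _.
  by rewrite set_itv1 Rintegral_set1 addr0.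
have dF0 y : 0 <= y <= x -> is_derive y 1 F (f y) by move=> /andP[+ _]; exact: dF.
rewrite (Rintegral_derivative x0 dF0); first by rewrite addrC subrK.
by move=> y /andP[y0 _]; exact: cf.
Qed.

(** That H vanishes at infinity is not assumed but results from integrability. The
   linear cutoff 1 - x / N makes the identity exact on [0, N], with the error term
   - H / N in the density, and dominated convergence removes the cutoff. *)
Lemma integral_density H h : (forall b, 0 <= b -> primitive b H h) ->
  mu.-integrable hl (EFin \o H) -> mu.-integrable hl (EFin \o h) ->
  \int[mu]_(x in hl) h x = - H 0.
Proof.
move=> prim iH ih.
pose N n : R := n.+1%:R.
have N0 n : 0 < N n by rewrite ltr0n.
pose chi n x := 1 - (N n)^-1 * x.
pose k n x := if x <= N n then h x * chi n x + H x * - (N n)^-1 else 0.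
have pchi n : primitive (N n) (chi n) (fun=> - (N n)^-1).
  apply: primitive_C1; first exact: ltW.
    move=> x _; rewrite /chi.
    have -> : (fun x => 1 - (N n)^-1 * x) = cst 1 - (N n)^-1 *: id by apply/funext.
    by apply: is_derive_eq; rewrite sub0r [(N n)^-1 *: 1]mulr1.
  by move=> x _; exact: cst_continuous.
have kE n : \int[mu]_(x in hl) k n x = - H 0.
  have [ik /(_ (N n))] := primitiveM (ltW (N0 n)) (prim _ (ltW (N0 n))) (pchi n).
  rewrite lexx ltW// => /(_ isT); rewrite {1 2}/chi mulVf ?gt_eqF//.
  rewrite subrr mulr0 mulr0 subr0 mulr1 => /eqP; rewrite eq_sym addrC addr_eq0 => /eqP <-.
  rewrite -Rintegral_itv_obnd_cbnd; last first.
    by move: ik; apply: integrableS => //; apply: subset_itvr; rewrite bnd_simp.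
  rewrite Rintegral_mkcond [RHS]Rintegral_mkcond; apply: eq_Rintegral => x _.
  rewrite !patchE /halfline !mem_setE !in_itv/= andbT /k.
  by case: ltP => //= _; case: leP.
have mk n : measurable_fun hl (k n).
  have -> : k n = (fun x => h x * chi n x + H x * - (N n)^-1) \_ `]-oo, N n].
    by apply/funext => x; rewrite patchE mem_setE in_itv.
  have mN : measurable (`]-oo, N n]%classic : set R) by exact: measurable_itv.
  have mhl : measurable (hl : set R) by exact: measurable_itv.
  apply: (measurable_restrict _ mN mhl).1.
  apply: (@measurable_funS _ _ _ _ hl) => //.
  have mh : measurable_fun hl h by apply/measurable_EFinP; exact: measurable_int ih.
  have mH : measurable_fun hl H by apply/measurable_EFinP; exact: measurable_int iH.
  apply: measurable_funD; apply: measurable_funM => //.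
  by apply: measurable_funB => //; exact: measurable_funM.
have kbound n x : hl x -> `|k n x| <= `|h x| + `|H x|.
  rewrite halflineE /k => x0; have [xN|xN] := leP x (N n); last by rewrite normr0 addr_ge0.
  have /andP[c0 c1] : 0 <= chi n x <= 1.
    rewrite /chi subr_ge0 gerBl mulr_ge0 ?invr_ge0 ?(ltW x0) ?(ltW (N0 n))// andbT.
    by rewrite mulrC ler_pdivrMr// mul1r.
  rewrite (le_trans (ler_normD _ _))// !normrM lerD//.
    by rewrite ler_piMr// ger0_norm.
  rewrite ler_piMr// normrN ger0_norm ?invr_ge0 ?(ltW (N0 n))//.
  by rewrite invf_le1// /N ler1n.
have klim x : k n x @[n --> \oo] --> h x.
  have : h x * chi n x + H x * - (N n)^-1 @[n --> \oo] --> h x * (1 - 0 * x) + H x * - 0.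
    have inv0 : (N n)^-1 @[n --> \oo] --> 0 by exact: cvg_harmonic.
    apply: cvgD; apply: cvgM; try exact: cvg_cst.
      by apply: cvgB; [exact: cvg_cst|apply: cvgM => //; exact: cvg_cst].
    exact: cvgN.
  rewrite mul0r subr0 mulr1 oppr0 mulr0 addr0; apply: cvg_trans.
  apply: near_eq_cvg; have [M _ HM] := nbhs_infty_ger x; exists M => // n /HM /= xn.
  by rewrite /k ifT// (le_trans xn)// ler_nat.
have : \int[mu]_(x in hl) k n x @[n --> \oo] --> \int[mu]_(x in hl) h x.
  apply: fine_cvg; rewrite -EFin_Rintegral//.
  apply: (@dominated_cvg _ _ _ mu hl measurable_halfline _ _ (fun x => (`|h x| + `|H x|)%:E)).
  - by move=> n; apply/measurable_EFinP; exact: mk.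
  - by move=> x _; apply: cvg_EFin; [exact: nearW|exact: klim].
  - by move=> x _.
  - under eq_fun do rewrite EFinD.
    by apply: integrableD => //; exact: integrable_norm.
  - by move=> n x hx; rewrite lee_fin; exact: kbound.
under eq_fun do rewrite kE.
move=> /(cvg_lim (@Rhausdorff R)) <-; by apply: cvg_lim => //; exact: cvg_cst.
Qed.

Lemma measurable_halfline_continuous F :
  (forall x, 0 < x -> {for x, continuous F}) -> measurable_fun hl F.
Proof.
move=> cF; apply: open_continuous_measurable_fun; first exact: interval_open.
by move=> x; rewrite inE halflineE; exact: cF.
Qed.

Lemma ae_hl_eq f g : (forall x, 0 < x -> f x = g x) -> ae_hl f g.
Proof. by move=> fg; apply: aeW => x; rewrite halflineE; exact: fg. Qed.

Lemma ae_hl_mull w f g : ae_hl f g -> ae_hl (fun x => w x * f x) (fun x => w x * g x).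
Proof. by apply: ae_mono => x fg hx; rewrite fg. Qed.

Hypothesis step : exists P : R -> R, exists tau K, smooth_step P tau K.

(** For the continuous representative F of f, the product w F F is absolutely
   continuous and integrable: minus its value at 0 is the integral of its density. *)
Lemma weighted_ibp w w' K f g : L2 f -> L2 g -> weak_derivative f g ->
  (forall x, 0 <= x -> is_derive x 1 w (w' x)) ->
  (forall x, 0 <= x -> {for x, continuous w'}) ->
  (forall x, 0 < x -> `|w x| <= K /\ `|w' x| <= K) ->
  inner (fun x => w' x * f x) f + 2 * inner (fun x => w x * f x) g =
  - w 0 * trace f ^+ 2.
Proof.
move=> Lf Lg fg dw cw' wK.
have [F [pF fF]] := sobolev_representative step Lf Lg fg.
have cF := primitive_continuous pF.
rewrite (trace_eq cF fF).
have cw x : 0 <= x -> {for x, continuous w}.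
  by move=> x0; have [dwx _] := dw x x0; apply: differentiable_continuous; exact/derivable1_diffP.
have mw : measurable_fun hl w.
  by apply: measurable_halfline_continuous => x /ltW; exact: cw.
have mw' : measurable_fun hl w'.
  by apply: measurable_halfline_continuous => x /ltW; exact: cw'.
have mF : measurable_fun hl F.
  apply: measurable_halfline_continuous => x x0.
  by have [+ _] := (continuous_within_itvcyP _ _).1 cF; apply; rewrite in_itv/= x0.
have LF : L2 F by exact: L2_ae fF Lf.
pose G := g \_ hl.
have gG : ae_hl g G.
  by apply: ae_hl_eq => x x0; rewrite /G patchE ifT// inE halflineE.
have mG : measurable_fun hl G.
  by apply: measurable_funTS; exact: L2_restrict_measurable.
have LG : L2 G by exact: L2_ae gG Lg.
have bw x : hl x -> `|w x| <= K by rewrite halflineE => /wK[].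
have bw' x : hl x -> `|w' x| <= K by rewrite halflineE => /wK[].
have Lw h : L2 h -> L2 (fun x => w x * h x) by exact: L2_mul_bounded bw.
have Lw' h : L2 h -> L2 (fun x => w' x * h x) by exact: L2_mul_bounded bw'.
have prim b (b0 : 0 <= b) :=
  primitiveM b0 (primitiveM b0 (primitive_C1 b0 dw cw') (pF b b0)) (pF b b0).
have LS : L2 (fun x => w' x * F x + w x * G x) by apply: L2D; [exact: Lw'|exact: Lw].
have iH : mu.-integrable hl (EFin \o (fun x => w x * F x * F x)).
  by apply: integrable_mulL2 => //; exact: Lw.
have i1 := integrable_mulL2 LS LF.
have i2 := integrable_mulL2 (Lw _ LF) LG.
have := integral_density prim iH (integrableD measurable_halfline i1 i2).
rewrite RintegralD// -/(inner _ _) -/(inner (fun x => w x * F x) _).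
rewrite innerDl//; [|exact: Lw'|exact: Lw].
rewrite (@ae_inner _ (fun x => w' x * f x) (fun x => w' x * F x) f F)//; first last.
- exact: ae_hl_mull.
- exact: Lw'.
- exact: Lw'.
rewrite (@ae_inner _ (fun x => w x * f x) (fun x => w x * F x) g G)//; first last.
- exact: ae_hl_mull.
- exact: Lw.
- exact: Lw.
have -> : inner (fun x => w x * G x) F = inner (fun x => w x * F x) G.
  by apply: eq_Rintegral => x _; ring.
by move=> E; rewrite mulNr expr2 mulrA -E; ring.
Qed.

(** The case of the constant weight 1. It shows how a squared trace depends on f:
   it is an inner product, although the trace itself is defined by choice. *)
Lemma sqr_trace f g : L2 f -> L2 g -> weak_derivative f g ->
  trace f ^+ 2 = - 2 * inner f g.
Proof.
move=> Lf Lg fg.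
have := @weighted_ibp (cst 1) (cst 0) 1 f g Lf Lg fg.
have -> : inner (fun x => cst 0 x * f x) f = 0.
  rewrite /inner; under eq_Rintegral do rewrite /= !mul0r.
  by rewrite Rintegral_cst// mul0r.
rewrite (_ : (fun x => cst 1 x * f x) = f); last by apply/funext => x; rewrite mul1r.
rewrite add0r mulN1r mulNr => ->; first by rewrite opprK.
- by move=> x _; exact: cst_continuous.
- by move=> x _; rewrite /= normr0 normr1.
Qed.

End integration_by_parts.

(** * The Carleman weights *)

Section pointwise_derivatives.
Context {R : realType}.
Implicit Types (f g : R -> R) (x y df dg : R) (n : nat).

Lemma is_derive_ln_comp f x df : 0 < f x -> is_derive x 1 f df ->
  is_derive x 1 (fun y => ln (f y)) ((f x)^-1 * df).
Proof. by move=> fx dfx; exact: (@is_derive1_comp _ (@ln R) f x _ _ (is_derive1_ln fx) dfx). Qed.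

Lemma is_derive_expR_comp f x df : is_derive x 1 f df ->
  is_derive x 1 (fun y => expR (f y)) (expR (f x) * df).
Proof. by move=> dfx; exact: (@is_derive1_comp _ (@expR R) f x _ _ (is_derive_expR _) dfx). Qed.

Lemma is_derive_sub f g x df dg : is_derive x 1 f df -> is_derive x 1 g dg ->
  is_derive x 1 (fun y => f y - g y) (df - dg).
Proof. by move=> dfx dgx; exact: is_deriveB. Qed.

Lemma is_derive_opp f x df : is_derive x 1 f df ->
  is_derive x 1 (fun y => - f y) (- df).
Proof. by move=> dfx; exact: is_deriveN. Qed.

Lemma is_derive_mul f g x df dg : is_derive x 1 f df -> is_derive x 1 g dg ->
  is_derive x 1 (fun y => f y * g y) (df * g x + f x * dg).
Proof.
move=> dfx dgx; have := is_deriveM dfx dgx.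
by move/is_derive_eq; apply; rewrite addrC [_ *: _]mulrC.
Qed.

Lemma is_derive_pow f n x df : is_derive x 1 f df ->
  is_derive x 1 (fun y => f y ^+ n) (n%:R * f x ^+ n.-1 * df).
Proof.
move=> dfx; have := is_deriveX n dfx.
rewrite (_ : f ^+ n = (fun y => f y ^+ n)).
  by move/is_derive_eq; apply; rewrite mulr_natl.
by apply/funext => y; elim: n => // n IH; rewrite !exprS -IH.
Qed.

Lemma is_derive_continuous f x df : is_derive x 1 f df -> {for x, continuous f}.
Proof.
by move=> [dfx _]; apply: differentiable_continuous; exact/derivable1_diffP.
Qed.

End pointwise_derivatives.

Section weights.
Context {R : realType}.
Local Notation hl := (@halfline R).
Variables (c lambda sigma : R).
Hypotheses (c0 : 0 < c) (lambda0 : lambda < 0) (sigma0 : 0 < sigma).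
Implicit Types (t x b : R) (n : nat).

Local Notation phi := (phi c lambda).

Definition scaled_phi t x := sigma * phi x t.

(** The weights [(sigma phi)^n exp (- 2 sigma phi)]; the factor
   [exp (2 s phi)] of the estimate is the one of index 0. *)
Definition weight n t x := scaled_phi t x ^+ n * expR (- (2 * scaled_phi t x)).

(** The logarithmic derivatives of phi in t and in x. *)
Definition logphi_t t x := - lambda * c * ((1 + c * t)^-1 + (1 + x + c * t)^-1).
Definition logphi_x t x := - lambda * (1 + x + c * t)^-1.

Let q0 t : 0 <= t -> 0 < 1 + c * t.
Proof. by move=> t0; rewrite ltr_pwDl// mulr_ge0// ltW. Qed.

Let p0 t x : 0 <= t -> 0 <= x -> 0 < 1 + x + c * t.
Proof. by move=> t0 x0; rewrite -addrA addrCA ltr_wpDl// q0. Qed.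

Lemma phi_ge1 t x : 0 <= t -> 0 <= x -> 1 <= phi x t.
Proof.
move=> t0 x0; rewrite -expR0 ler_expR; apply: mulr_le0; first exact: ltW.
rewrite /psi -opprD oppr_le0.
have ct0 : 0 <= c * t by rewrite mulr_ge0// ltW.
by apply: addr_ge0; apply: ln_ge0; rewrite -?addrA lerDl ?addr_ge0.
Qed.

Lemma scaled_phi_ge t x : 0 <= t -> 0 <= x -> sigma <= scaled_phi t x.
Proof. by move=> t0 x0; rewrite /scaled_phi ler_peMr ?phi_ge1// ltW. Qed.

Lemma scaled_phi_ge0 t x : 0 <= scaled_phi t x.
Proof. by rewrite mulr_ge0 ?expR_ge0// ltW. Qed.

Lemma weight_ge0 n t x : 0 <= weight n t x.
Proof. by rewrite mulr_ge0 ?expR_ge0// exprn_ge0// scaled_phi_ge0. Qed.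

Lemma weightS n t x : weight n.+1 t x = scaled_phi t x * weight n t x.
Proof. by rewrite /weight exprS mulrA. Qed.

(** With y the scaled phase, y / n <= exp (y / n) gives y^n <= n^n exp y; half of the
   exponential decay suffices. *)
Lemma weight_le n t x : weight n t x <= n%:R ^+ n.
Proof.
have y0 := scaled_phi_ge0 t x; rewrite /weight; move: (scaled_phi t x) y0 => y y0.
rewrite expRN ler_pdivrMr ?expR_gt0//.
case: n => [|n]; first by rewrite !expr0 mul1r -expR0 ler_expR mulr_ge0.
have n0 : 0 < n.+1%:R :> R by [].
rewrite -ler_pdivrMl ?exprn_gt0// mulrC -expr_div_n.
apply: (@le_trans _ _ (expR y)); last by rewrite ler_expR ler_peMl// ler1n.
have {2}-> : y = n.+1%:R * (y / n.+1%:R) by rewrite mulrC divfK// gt_eqF.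
rewrite expRM_natl lerXn2r// ?nnegrE ?expR_ge0 ?divr_ge0//.
by rewrite (le_trans _ (expR_ge1Dx _))// lerDr.
Qed.

Lemma is_derive_phi_t t x : 0 <= t -> 0 <= x ->
  is_derive t 1 (fun t => scaled_phi t x) (scaled_phi t x * logphi_t t x).
Proof.
move=> t0 x0.
have dq : is_derive t 1 (fun t => 1 + c * t) c.
  by rewrite (_ : (fun t => _) = (fun t => c * t + 1)); [exact: is_derive_line|apply/funext => y; rewrite addrC].
have dp : is_derive t 1 (fun t => 1 + x + c * t) c.
  by rewrite (_ : (fun t => _) = (fun t => c * t + (1 + x))); [exact: is_derive_line|apply/funext => y; rewrite addrC].
have dlq := @is_derive_ln_comp _ (fun t => 1 + c * t) t c (q0 t0) dq.
have dlp := @is_derive_ln_comp _ (fun t => 1 + x + c * t) t c (p0 t0 x0) dp.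
have dpsi := is_derive_sub (is_derive_opp dlq) dlp.
have := is_derive_scale sigma (is_derive_expR_comp (is_derive_scale lambda dpsi)).
move=> /is_derive_eq; apply; rewrite /logphi_t /scaled_phi /Defs.phi /psi.
by ring.
Qed.

Lemma is_derive_phi_x t x : 0 <= t -> 0 <= x ->
  is_derive x 1 (scaled_phi t) (scaled_phi t x * logphi_x t x).
Proof.
move=> t0 x0.
have dp : is_derive x 1 (fun x => 1 + x + c * t) 1.
  rewrite (_ : (fun x => _) = (fun x => 1 * x + (1 + c * t))); first exact: is_derive_line.
  by apply/funext => y; ring.
have dlp := @is_derive_ln_comp _ (fun x => 1 + x + c * t) x 1 (p0 t0 x0) dp.
have dpsi := is_derive_sub (is_derive_cst (- ln (1 + c * t)) x 1) dlp.
have := is_derive_scale sigma (is_derive_expR_comp (is_derive_scale lambda dpsi)).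
move=> /is_derive_eq; apply; rewrite /logphi_x /scaled_phi /Defs.phi /psi /cst.
by ring.
Qed.

Lemma is_derive_weight (f : R -> R) n t r :
  is_derive t 1 f (f t * r) ->
  is_derive t 1 (fun t => f t ^+ n * expR (- (2 * f t)))
    ((n%:R * (f t ^+ n * expR (- (2 * f t))) -
      2 * (f t ^+ n.+1 * expR (- (2 * f t)))) * r).
Proof.
move=> df.
have de := is_derive_expR_comp (is_derive_opp (is_derive_scale 2 df)).
have := is_derive_mul (is_derive_pow n df) de.
move=> /is_derive_eq; apply; case: n => [|n] /=; first by rewrite expr0 expr1; ring.
by rewrite !exprS; ring.
Qed.

Definition weight_t n t x := (n%:R * weight n t x - 2 * weight n.+1 t x) * logphi_t t x.
Definition weight_x n t x := (n%:R * weight n t x - 2 * weight n.+1 t x) * logphi_x t x.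

Lemma is_derive_weight_t n t x : 0 <= t -> 0 <= x ->
  is_derive t 1 (fun t => weight n t x) (weight_t n t x).
Proof. by move=> t0 x0; apply: is_derive_weight; exact: is_derive_phi_t. Qed.

Lemma is_derive_weight_x n t x : 0 <= t -> 0 <= x ->
  is_derive x 1 (weight n t) (weight_x n t x).
Proof. by move=> t0 x0; apply: is_derive_weight; exact: is_derive_phi_x. Qed.

Lemma continuous_weight_t n t x : 0 <= t -> 0 <= x ->
  {for t, continuous (fun t => weight_t n t x)}.
Proof.
move=> t0 x0.
have cw m : {for t, continuous (fun t => weight m t x)}.
  exact: is_derive_continuous (is_derive_weight_t m t0 x0).
have ct : {for t, continuous (fun t : R => c * t)}.
  by apply: cvgM; [exact: cvg_cst|exact: cvg_id].
apply: cvgM.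
  by apply: cvgB; (apply: cvgM; [exact: cvg_cst|exact: cw]).
apply: cvgM; first exact: cvg_cst.
apply: cvgD; apply: cvgV.
- by rewrite gt_eqF// q0.
- by apply: cvgD; [exact: cvg_cst|exact: ct].
- by rewrite gt_eqF// p0.
- by apply: cvgD; [exact: cvg_cst|exact: ct].
Qed.

Lemma continuous_weight_x n t x : 0 <= t -> 0 <= x ->
  {for x, continuous (weight_x n t)}.
Proof.
move=> t0 x0.
have cw m : {for x, continuous (weight m t)}.
  exact: is_derive_continuous (is_derive_weight_x m t0 x0).
apply: cvgM.
  by apply: cvgB; (apply: cvgM; [exact: cvg_cst|exact: cw]).
apply: cvgM; first exact: cvg_cst.
apply: cvgV; first by rewrite gt_eqF// p0.
by apply: cvgD; [apply: cvgD; [exact: cvg_cst|exact: cvg_id]|exact: cvg_cst].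
Qed.

Definition weight_bound n : R := n%:R ^+ n.
Definition weight_deriv_bound n : R :=
  (n%:R * weight_bound n + 2 * weight_bound n.+1) * (- lambda * (1 + c) * 2).

Lemma norm_weight n t x : `|weight n t x| <= weight_bound n.
Proof. by rewrite ger0_norm ?weight_ge0// weight_le. Qed.

Let inv_le1 (y : R) : 1 <= y -> 0 <= y^-1 <= 1.
Proof.
move=> y1; have y0 : 0 < y by exact: lt_le_trans y1.
by rewrite invr_ge0 ltW//= invf_le1.
Qed.

Let nl0 : 0 <= - lambda. Proof. by rewrite oppr_ge0 ltW. Qed.

Let invq t : 0 <= t -> 0 <= (1 + c * t)^-1 <= 1.
Proof. by move=> t0; rewrite inv_le1// lerDl mulr_ge0// ltW. Qed.

Let invp t x : 0 <= t -> 0 <= x -> 0 <= (1 + x + c * t)^-1 <= 1.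
Proof.
by move=> t0 x0; rewrite inv_le1// -addrA lerDl addr_ge0// mulr_ge0// ltW.
Qed.

Lemma norm_weight_deriv n t x r : `|r| <= - lambda * (1 + c) * 2 ->
  `|(n%:R * weight n t x - 2 * weight n.+1 t x) * r| <= weight_deriv_bound n.
Proof.
move=> rb; rewrite normrM ler_pM//.
apply: le_trans (ler_normB _ _) _; rewrite (normrM _ (weight n t x)) (normrM _ (weight n.+1 t x)) !normr_nat lerD//.
  by apply: ler_wpM2l => //; exact: norm_weight.
by apply: ler_wpM2l => //; exact: norm_weight.
Qed.

Lemma norm_weight_t n t x : 0 <= t -> 0 <= x ->
  `|weight_t n t x| <= weight_deriv_bound n.
Proof.
move=> t0 x0; apply: norm_weight_deriv; rewrite /logphi_t.
have /andP[] := invq t0; have /andP[] := invp t0 x0.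
set p := (1 + x + c * t)^-1; set q := (1 + c * t)^-1 => p_0 p_1 q_0 q_1.
rewrite ger0_norm ?mulr_ge0 ?addr_ge0 ?(ltW c0)//.
rewrite -!mulrA ler_wpM2l//; have := c0; nra.
Qed.

Lemma norm_weight_x n t x : 0 <= t -> 0 <= x ->
  `|weight_x n t x| <= weight_deriv_bound n.
Proof.
move=> t0 x0; apply: norm_weight_deriv; rewrite /logphi_x.
have /andP[p_0 p_1] := invp t0 x0.
rewrite ger0_norm ?mulr_ge0//.
rewrite -!mulrA ler_wpM2l//; have := c0; nra.
Qed.

(** The logarithmic derivative of phi along d/dt + b d/dx is
   - lambda (c / (1 + c t) + (c + b) / (1 + x + c t)), at least
   - lambda c / (1 + c T) when b >= - c: both null directions are admissible. Where
   sigma phi >= n + 1, the exponential then wins over the factor (sigma phi)^(n + 1)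
   and the weight decreases at a definite rate. *)
Lemma weight_transport n t x b T : 0 <= t -> t <= T -> 0 <= x -> - c <= b ->
  n.+1%:R <= sigma ->
  weight_t n.+1 t x + b * weight_x n.+1 t x <=
  - (- lambda * c / (1 + c * T)) * weight n.+2 t x.
Proof.
move=> t0 tT x0 cb ns.
have a_n : n.+1%:R <= scaled_phi t x by rewrite (le_trans ns)// scaled_phi_ge.
have -> : weight_t n.+1 t x + b * weight_x n.+1 t x =
  (n.+1%:R - 2 * scaled_phi t x) * weight n.+1 t x * (logphi_t t x + b * logphi_x t x).
  by rewrite /weight_t /weight_x (weightS n.+1); ring.
have rE : - lambda * c / (1 + c * T) <= logphi_t t x + b * logphi_x t x.
  have qT : (1 + c * T)^-1 <= (1 + c * t)^-1.
    rewrite lef_pV2 ?posrE ?q0//; last exact: le_trans tT.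
    by rewrite lerD2l ler_pM2l.
  rewrite /logphi_t /logphi_x.
  have /andP[p_0 _] := invp t0 x0.
  have H1 : - lambda * c * (1 + c * T)^-1 <= - lambda * c * (1 + c * t)^-1.
    by rewrite ler_wpM2l// mulr_ge0// ltW.
  have H2 : 0 <= - lambda * ((c + b) * (1 + x + c * t)^-1).
    by rewrite !mulr_ge0// addrC -lerBlDr sub0r.
  by rewrite mulrDr (le_trans H1)//; lra.
have k0 : 0 <= - lambda * c / (1 + c * T).
  by rewrite divr_ge0 ?mulr_ge0 ?(ltW c0)// ltW// q0// (le_trans t0).
have w0 := weight_ge0 n.+1 t x.
rewrite (weightS n.+1); move: (weight n.+1 t x) (logphi_t t x + _) (scaled_phi t x)
  (- lambda * c / _) w0 rE k0 a_n => W r a k W0 kr k0 an.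
have aW : n.+1%:R * W <= a * W by rewrite ler_wpM2r.
have aW0 : 0 <= a * W by rewrite (le_trans _ aW)// mulr_ge0.
have : a * W * k <= a * W * r by rewrite ler_wpM2l.
have : (n.+1%:R - 2 * a) * W * r <= - (a * W) * r.
  rewrite ler_wpM2r ?(le_trans k0)//; lra.
lra.
Qed.

End weights.

(** * Curves of square integrable functions *)

Section curves.
Context {R : realType}.
Local Notation mu := (@lebesgue_measure R).
Local Notation hl := (@halfline R).
Implicit Types (f g : R -> R) (u v w z : R -> R -> R) (t s T : R).

Section cvg_norm2.
Context (F : set_system R) {FF : Filter F}.

Lemma cvg_norm2D u v : (\forall s \near F, L2 (u s)) -> (\forall s \near F, L2 (v s)) ->
  norm2 (u s) @[s --> F] --> 0 -> norm2 (v s) @[s --> F] --> 0 ->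
  norm2 (fun x => u s x + v s x) @[s --> F] --> 0.
Proof.
move=> Lu Lv u0 v0.
have uv0 : norm2 (u s) + norm2 (v s) @[s --> F] --> 0.
  by rewrite -[X in _ --> X](addr0 0); exact: cvgD.
apply: (squeeze_cvgr _ (@cvg_cst _ 0 _ _ _) uv0).
by near=> s; rewrite norm2_ge0 norm2D//; near: s.
Unshelve. all: by end_near. Qed.

Lemma cvg_norm2Z (k : R -> R) (l : R) u : (\forall s \near F, L2 (u s)) ->
  k s @[s --> F] --> l -> norm2 (u s) @[s --> F] --> 0 ->
  norm2 (fun x => k s * u s x) @[s --> F] --> 0.
Proof.
move=> Lu kl u0.
have ku0 : `|k s| * norm2 (u s) @[s --> F] --> 0.
  by rewrite -[X in _ --> X](mulr0 `|l|); apply: cvgM => //; exact: cvg_norm.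
apply: cvg_trans ku0; apply: near_eq_cvg.
by near=> s; rewrite norm2Z//; near: s.
Unshelve. all: by end_near. Qed.

Lemma cvg_norm2Zl (k : R -> R) f : L2 f -> k s @[s --> F] --> 0 ->
  norm2 (fun x => k s * f x) @[s --> F] --> 0.
Proof.
move=> Lf k0.
have kf0 : `|k s| * norm2 f @[s --> F] --> 0.
  rewrite -[X in _ --> X](mul0r (norm2 f)); apply: cvgM; last exact: cvg_cst.
  by rewrite -[X in _ --> X](@normr0 _ R); exact: cvg_norm.
apply: cvg_trans kf0; apply: near_eq_cvg.
by apply: nearW => s; rewrite norm2Z.
Qed.

(** By Cauchy-Schwarz, moving vectors and a moving weight can be treated one after
   the other: it suffices that the weight converges against the fixed f and g. *)
Lemma cvg_inner_weight w u v f g (K l : R) : L2 f -> L2 g ->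
  (\forall s \near F, [/\ L2 (u s), L2 (v s), measurable_fun hl (w s) &
     forall x, hl x -> `|w s x| <= K]) ->
  norm2 (fun x => u s x - f x) @[s --> F] --> 0 ->
  norm2 (fun x => v s x - g x) @[s --> F] --> 0 ->
  inner (fun x => w s x * f x) g @[s --> F] --> l ->
  inner (fun x => w s x * u s x) (v s) @[s --> F] --> l.
Proof.
move=> Lf Lg H uf vg wl.
pose A s := norm2 (fun x => u s x - f x); pose B s := norm2 (fun x => v s x - g x).
have K1 : 0 <= `|K| by [].
pose D s := `|K| * (A s * (norm2 g + B s)) + `|K| * (norm2 f * B s).
have D0 : D s @[s --> F] --> 0.
  have -> : 0 = `|K| * (0 * (norm2 g + 0)) + `|K| * (norm2 f * 0) by ring.
  apply: cvgD.
    apply: cvgM; first exact: cvg_cst.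
    by apply: cvgM => //; apply: cvgD => //; exact: cvg_cst.
  apply: cvgM; first exact: cvg_cst.
  by apply: cvgM => //; exact: cvg_cst.
have : inner (fun x => w s x * u s x) (v s) - inner (fun x => w s x * f x) g
    @[s --> F] --> 0.
  apply: norm_cvg0; apply: (squeeze_cvgr _ (@cvg_cst _ 0 _ _ _) D0).
  near=> s; rewrite normr_ge0/=.
  have [Lu Lv mw wK] : [/\ L2 (u s), L2 (v s), measurable_fun hl (w s) &
     forall x, hl x -> `|w s x| <= K] by near: s.
  have wK' x : hl x -> `|w s x| <= `|K| by move=> /wK /le_trans; apply; exact: ler_norm.
  have Luf := L2B Lu Lf; have Lvg := L2B Lv Lg.
  have Lw h : L2 h -> L2 (fun x => w s x * h x) by exact: L2_mul_bounded wK'.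
  have -> : inner (fun x => w s x * u s x) (v s) - inner (fun x => w s x * f x) g =
      inner (fun x => w s x * (u s x - f x)) (v s) +
      inner (fun x => w s x * f x) (fun x => v s x - g x).
    have e1 : inner (fun x => w s x * u s x) (v s) =
        inner (fun x => w s x * (u s x - f x) + w s x * f x) (v s).
      by apply: eq_Rintegral => x _; ring.
    have e2 : inner (fun x => w s x * f x) (v s) =
        inner (fun x => w s x * f x) (fun x => (v s x - g x) + g x).
      by apply: eq_Rintegral => x _; ring.
    rewrite e1 innerDl//; [|exact: Lw|exact: Lw].
    by rewrite e2 innerDr//; [ring|exact: Lw].
  apply: le_trans (ler_normD _ _) _; apply: lerD.
    apply: le_trans (cauchy_schwarz (Lw _ Luf) Lv) _.
    rewrite mulrA; apply: ler_pM; rewrite ?norm2_ge0//; first exact: (norm2_mul_bounded K1 mw wK' Luf).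
    have -> : v s = (fun x => g x + (v s x - g x)) by apply/funext => x; ring.
    exact: (norm2D Lg Lvg).
  apply: le_trans (cauchy_schwarz (Lw _ Lf) Lvg) _.
  by rewrite mulrA; apply: ler_pM; rewrite ?norm2_ge0//; exact: (norm2_mul_bounded K1 mw wK' Lf).
move=> H0.
have : (inner (fun x => w s x * u s x) (v s) - inner (fun x => w s x * f x) g) +
    inner (fun x => w s x * f x) g @[s --> F] --> 0 + l by exact: cvgD.
rewrite add0r; apply: cvg_trans.
by apply: near_eq_cvg; apply: nearW => s /=; rewrite subrK.
Unshelve. all: by end_near. Qed.

End cvg_norm2.

Variable T : R.

(** Curves are considered over the open interval only, so that limits in time
   are two-sided. *)
Definition L2_continuous u := forall t, 0 < t < T ->
  L2 (u t) /\ norm2 (fun x => u s x - u t x) @[s --> t] --> 0.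

Definition L2_derivative u u' := forall t, 0 < t < T ->
  norm2 (fun x => h^-1 * (u (h + t) x - u t x) - u' t x) @[h --> 0^'] --> 0.

Lemma near_time t : 0 < t < T -> \forall s \near t, 0 < s < T.
Proof.
by move=> /andP[t0 tT]; near=> s; apply/andP; split; near: s;
  [exact: lt_nbhsr|exact: lt_nbhsl].
Unshelve. all: by end_near. Qed.

Lemma cvg_shift_time t : h + t @[h --> (0 : R)^'] --> t.
Proof.
apply: cvg_within_filter.
have : h + t @[h --> (0 : R)] --> 0 + t by apply: cvgD; [exact: cvg_id|exact: cvg_cst].
by rewrite add0r.
Qed.

Lemma near_shift_time t : 0 < t < T -> \forall h \near (0 : R)^', 0 < h + t < T.
Proof. by move=> tT; exact: (cvg_shift_time (near_time tT)). Qed.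

Lemma near_L2 u t : L2_continuous u -> 0 < t < T -> \forall s \near t, L2 (u s).
Proof. by move=> cu tT; apply: filterS (near_time tT) => s /cu[]. Qed.

Lemma near_L2_shift u t : L2_continuous u -> 0 < t < T ->
  \forall h \near (0 : R)^', L2 (u (h + t)).
Proof. by move=> cu tT; apply: filterS (near_shift_time tT) => s /cu[]. Qed.

Lemma L2_continuous_shift u t : L2_continuous u -> 0 < t < T ->
  norm2 (fun x => u (h + t) x - u t x) @[h --> 0^'] --> 0.
Proof.
move=> cu tT; have [_ ut] := cu t tT.
exact: (cvg_comp _ _ (@cvg_shift_time t) ut).
Qed.

Lemma near_ae_cvg (F : set_system R) {FF : Filter F} u v :
  (\forall s \near F, [/\ L2 (u s), L2 (v s) & ae_hl (u s) (v s)]) ->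
  norm2 (u s) @[s --> F] --> 0 -> norm2 (v s) @[s --> F] --> 0.
Proof.
move=> uv; apply: cvg_trans; apply: near_eq_cvg.
by apply: filterS uv => s [Lu Lv uvs]; apply: ae_norm2 => //; move: uvs; apply: ae_mono => x e /e ->.
Qed.

Lemma L2_continuous_ae u v : L2_continuous u ->
  (forall t, 0 < t < T -> L2 (v t) /\ ae_hl (u t) (v t)) -> L2_continuous v.
Proof.
move=> cu uv t tT; have [Lv uvt] := uv t tT; have [Lu ut] := cu t tT; split => //.
apply: near_ae_cvg ut; apply: filterS (near_time tT) => s sT.
have [Lvs uvs] := uv s sT; have [Lus _] := cu s sT.
split; [exact: L2B|exact: L2B|].
by apply: ae_mono2 uvs uvt => x e1 e2 hx; rewrite e1// e2.
Qed.

Lemma L2_derivative_ae u u' v v' : L2_continuous u -> L2_continuous u' ->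
  L2_derivative u u' ->
  (forall t, 0 < t < T -> L2 (v t) /\ ae_hl (u t) (v t)) ->
  (forall t, 0 < t < T -> L2 (v' t) /\ ae_hl (u' t) (v' t)) -> L2_derivative v v'.
Proof.
move=> cu cu' du uv uv' t tT; apply: near_ae_cvg (du t tT).
apply: filterS (near_shift_time tT) => h hT.
have [Lv uvt] := uv t tT; have [Lvs uvs] := uv _ hT.
have [Lu _] := cu t tT; have [Lus _] := cu _ hT.
have [Lv' uvt'] := uv' t tT; have [Lu' _] := cu' t tT.
split.
- by apply: L2B => //; apply: L2Z; exact: L2B.
- by apply: L2B => //; apply: L2Z; exact: L2B.
have := ae_mono2 (fun x => @conj _ _) uvs uvt.
by apply: ae_mono2 uvt' => x e3 [e1 e2] hx; rewrite e1// e2// e3.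
Qed.

Lemma L2_continuousD u v : L2_continuous u -> L2_continuous v ->
  L2_continuous (fun t x => u t x + v t x).
Proof.
move=> cu cv t tT; have [Lu ut] := cu t tT; have [Lv vt] := cv t tT.
split; first exact: L2D.
under eq_fun do under eq_fun do rewrite opprD addrACA.
by apply: cvg_norm2D => //; near=> s; apply: L2B => //; near: s; exact: near_L2.
Unshelve. all: by end_near. Qed.

Lemma L2_continuousZ (k : R -> R) u : (forall t, 0 < t < T -> {for t, continuous k}) ->
  L2_continuous u -> L2_continuous (fun t x => k t * u t x).
Proof.
move=> ck cu t tT; have [Lu ut] := cu t tT; split; first exact: L2Z.
rewrite (_ : (fun s => _) = (fun s => norm2 (fun x => k s * (u s x - u t x) + (k s - k t) * u t x))).
  apply: cvg_norm2D.
  - by near=> s; apply: L2Z; apply: L2B => //; near: s; exact: near_L2.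
  - by near=> s; exact: L2Z.
  - apply: (@cvg_norm2Z _ _ k (k t) (fun s x => u s x - u t x)) => //; last exact: ck.
    by near=> s; apply: L2B => //; near: s; exact: near_L2.
  - apply: cvg_norm2Zl => //; apply/subr_cvg0; exact: ck.
by apply/funext => s; congr norm2; apply/funext => x; ring.
Unshelve. all: by end_near. Qed.

Lemma L2_derivativeD u u' v v' : L2_continuous u -> L2_continuous v ->
  L2_continuous u' -> L2_continuous v' ->
  L2_derivative u u' -> L2_derivative v v' ->
  L2_derivative (fun t x => u t x + v t x) (fun t x => u' t x + v' t x).
Proof.
move=> cu cv cu' cv' du dv t tT.
have [Lu _] := cu t tT; have [Lv _] := cv t tT.
have [Lu' _] := cu' t tT; have [Lv' _] := cv' t tT.
rewrite (_ : (fun h => _) = (fun h => norm2 (fun x =>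
  (h^-1 * (u (h + t) x - u t x) - u' t x) + (h^-1 * (v (h + t) x - v t x) - v' t x)))).
  apply: cvg_norm2D; [| |exact: du|exact: dv].
    by near=> h; apply: L2B => //; apply: L2Z; apply: L2B => //; near: h; exact: near_L2_shift.
  by near=> h; apply: L2B => //; apply: L2Z; apply: L2B => //; near: h; exact: near_L2_shift.
by apply/funext => h; congr norm2; apply/funext => x; ring.
Unshelve. all: by end_near. Qed.

Lemma is_derive_cvg (f : R -> R) t df : is_derive t 1 f df ->
  h^-1 * (f (h + t) - f t) @[h --> 0^'] --> df.
Proof.
move=> [dft <-]; apply: cvg_trans dft; apply: near_eq_cvg; apply: nearW => h /=.
by rewrite [h *: 1]mulr1.
Qed.

Lemma cvg_is_derive (f : R -> R) t df :
  h^-1 * (f (h + t) - f t) @[h --> 0^'] --> df -> is_derive t 1 f df.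
Proof.
move=> fdf.
have H : h^-1 *: ((f \o shift t) (h *: 1) - f t) @[h --> 0^'] --> df.
  apply: cvg_trans fdf; apply: near_eq_cvg; apply: nearW => h /=.
  by rewrite [h *: 1]mulr1.
apply: DeriveDef; first by apply/cvg_ex; exists df.
exact: (cvg_lim _ H).
Qed.

Lemma L2_derivativeZ (k k' : R -> R) u u' : L2_continuous u -> L2_continuous u' ->
  (forall t, 0 < t < T -> is_derive t 1 k (k' t)) -> L2_derivative u u' ->
  L2_derivative (fun t x => k t * u t x) (fun t x => k' t * u t x + k t * u' t x).
Proof.
move=> cu cu' dk du t tT.
have [Lu _] := cu t tT; have [Lu' _] := cu' t tT.
have Lh : \forall h \near (0 : R)^', L2 (fun x => h^-1 * (u (h + t) x - u t x) - u' t x).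
  by near=> h; apply: L2B => //; apply: L2Z; apply: L2B => //; near: h; exact: near_L2_shift.
have kh : k (h + t) @[h --> 0^'] --> k t.
  exact: (cvg_comp _ _ (@cvg_shift_time t) (is_derive_continuous (dk t tT))).
rewrite (_ : (fun h => _) = (fun h => norm2 (fun x =>
  (k (h + t) * (h^-1 * (u (h + t) x - u t x) - u' t x) + (k (h + t) - k t) * u' t x) +
  (h^-1 * (k (h + t) - k t) - k' t) * u t x))).
  apply: cvg_norm2D.
  - by near=> h; apply: L2D; apply: L2Z => //; near: h.
  - by near=> h; exact: L2Z.
  - apply: cvg_norm2D.
    + by near=> h; apply: L2Z; near: h.
    + by near=> h; exact: L2Z.
    + exact: (@cvg_norm2Z _ _ (fun h => k (h + t)) (k t)
        (fun h x => h^-1 * (u (h + t) x - u t x) - u' t x) Lh kh (du t tT)).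
    + by apply: cvg_norm2Zl => //; apply/subr_cvg0.
  - apply: cvg_norm2Zl => //; apply/subr_cvg0; exact: is_derive_cvg (dk t tT).
by apply/funext => h; congr norm2; apply/funext => x; ring.
Unshelve. all: by end_near. Qed.

Definition bounded_weight (K : R) w := forall t, 0 < t < T ->
  measurable_fun hl (w t) /\
  (forall x, hl x -> `|w t x| <= K /\ {for t, continuous (w ^~ x)}).

Lemma inner_continuous w K u v : bounded_weight K w ->
  L2_continuous u -> L2_continuous v ->
  forall t, 0 < t < T -> {for t, continuous (fun s => inner (fun x => w s x * u s x) (v s))}.
Proof.
move=> wK cu cv t tT.
have [Lu ut] := cu t tT; have [Lv vt] := cv t tT.
apply: (@cvg_inner_weight _ _ w u v (u t) (v t) K) => //.
  apply: filterS (near_time tT) => s sT; have [mw wKs] := wK s sT.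
  by split=> [||//|x /wKs[]//]; [have [] := cu s sT|have [] := cv s sT].
have Lw s : 0 < s < T -> L2 (fun x => w s x * u t x).
  move=> sT; have [mw wKs] := wK s sT.
  by apply: (@L2_mul_bounded _ (w s) (u t) K mw _ Lu) => x hx; have [] := wKs x hx.
have tI : t \in (`]0, T[%classic : set R) by rewrite inE /= in_itv.
apply: (@continuity_under_integral _ _ _ mu (fun s x => w s x * u t x * v t x) hl _
  0 T _ _ (fun x => K * `|u t x * v t x|) _ _ t tI) => //.
- by move=> s /=; rewrite in_itv/= => sT; apply: integrable_mulL2 => //; exact: Lw.
- apply: aeW => x hx s; rewrite inE /= in_itv/= => sT.
  have [_ /(_ x hx)[_ cw]] := wK s sT.
  by apply: cvgM; [apply: cvgM; [exact: cw|exact: cvg_cst]|exact: cvg_cst].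
- apply: (integrableZl measurable_halfline K (f := fun x => `|u t x * v t x|%:E)).
  exact/integrable_norm/integrable_mulL2.
move=> s /=; rewrite in_itv/= => sT; apply: aeW => x hx.
have [_ /(_ x hx)[b _]] := wK s sT.
by rewrite -mulrA normrM ler_wpM2r.
Qed.

Lemma L2_continuous_cst f : L2 f -> L2_continuous (fun=> f).
Proof.
move=> Lf t tT; split => //.
rewrite (_ : (fun s => _) = cst 0); first exact: cvg_cst.
apply/funext => s; rewrite (_ : (fun x => _) = (fun x => 0 * f x)).
  by rewrite norm2Z// normr0 mul0r.
by apply/funext => x; rewrite subrr mul0r.
Qed.

Lemma bounded_weight_inner_cvg w wt K f : bounded_weight K w -> bounded_weight K wt ->
  (forall t x, 0 < t < T -> hl x -> is_derive t 1 (w ^~ x) (wt t x)) -> L2 f ->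
  forall t, 0 < t < T ->
  h^-1 * (inner (fun x => w (h + t) x * f x) f - inner (fun x => w t x * f x) f)
    @[h --> 0^'] --> inner (fun x => wt t x * f x) f.
Proof.
move=> wK wtK dw Lf t tT.
have Iff := integrable_mulL2 Lf Lf.
have dwf s x : 0 < s < T -> hl x ->
    is_derive s 1 (fun s => w s x * f x * f x) (wt s x * f x * f x).
  move=> sT hx; have := is_derive_scale (f x * f x) (dw s x sT hx).
  rewrite (_ : (fun y => _) = (fun s => w s x * f x * f x)); last first.
    by apply/funext => y; ring.
  by move/is_derive_eq; apply; ring.
have tI : (`]0, T[%classic : set R) t by rewrite /= in_itv.
pose F s x := w s x * f x * f x; pose G x := `|K| * `|f x * f x|.
have i1 s : (`]0, T[%classic : set R) s -> mu.-integrable hl (EFin \o F s).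
  rewrite /= in_itv/= => sT; have [mw wKs] := wK s sT.
  apply: integrable_mulL2 => //; apply: (@L2_mul_bounded _ (w s) f K mw _ Lf) => x hx.
  by have [] := wKs x hx.
have i2 s x : (`]0, T[%classic : set R) s -> hl x -> derivable (F ^~ x) s 1.
  by rewrite /= in_itv/= => sT hx; have [] := dwf s x sT hx.
have i3 x : 0 <= G x by rewrite mulr_ge0.
have i4 : mu.-integrable hl (EFin \o G).
  apply: (integrableZl measurable_halfline `|K| (f := fun x => `|f x * f x|%:E)).
  exact: integrable_norm.
have i5 s x : (`]0, T[%classic : set R) s -> hl x -> `|partial1of2 F s x| <= G x.
  rewrite /= in_itv/= => sT hx; rewrite /partial1of2 (derive1_val (dwf s x sT hx)).
  have [_ /(_ x hx)[b _]] := wtK s sT.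
  by rewrite -mulrA normrM ler_wpM2r// (le_trans b)// ler_norm.
have := cvg_differentiation_under_integral measurable_halfline tI i1 i2 i3 i4 i5.
rewrite (_ : \int[mu]_(y in hl) partial1of2 F t y = inner (fun x => wt t x * f x) f)//.
apply: eq_Rintegral => x; rewrite inE => hx.
by rewrite /partial1of2 (derive1_val (dwf t x tT hx)).
Qed.

(** The difference quotient splits exactly into the one of the weight, against the
   fixed u t, and w (h + t) times the product of the quotient of u with
   u (h + t) + u t; differentiating under the integral is needed for the former
   only, and no pointwise differentiability of u in time is involved. *)
Lemma is_derive_energy w wt K u u' : bounded_weight K w -> bounded_weight K wt ->
  (forall t x, 0 < t < T -> hl x -> is_derive t 1 (w ^~ x) (wt t x)) ->
  L2_continuous u -> L2_continuous u' -> L2_derivative u u' ->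
  forall t, 0 < t < T -> is_derive t 1 (fun s => inner (fun x => w s x * u s x) (u s))
    (inner (fun x => wt t x * u t x) (u t) + 2 * inner (fun x => w t x * u t x) (u' t)).
Proof.
move=> wK wtK dw cu cu' du t tT; apply: cvg_is_derive.
have [Lu ut] := cu t tT; have [Lu' _] := cu' t tT.
pose D h x := h^-1 * (u (h + t) x - u t x).
pose S h x := u (h + t) x + u t x.
have nh : \forall h \near (0 : R)^', 0 < h + t < T := near_shift_time tT.
have nL := near_L2_shift cu tT.
have C1 := bounded_weight_inner_cvg wK wtK dw Lu tT.
have Lt2 : L2 (fun x => 2 * u t x) by exact: L2Z.
have C2 : inner (fun x => w (h + t) x * D h x) (S h) @[h --> 0^'] -->
    inner (fun x => w t x * u' t x) (fun x => 2 * u t x).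
  apply: (@cvg_inner_weight _ _ (fun h => w (h + t)) D S (u' t) (fun x => 2 * u t x) K) => //.
  - near=> h; have hT : 0 < h + t < T by near: h.
    have Luh : L2 (u (h + t)) by near: h.
    have [mw wKs] := wK _ hT; split => //.
    + by apply: L2Z; exact: L2B.
    + exact: L2D.
    + by move=> x /wKs[].
  - exact: (du t tT).
  - rewrite (_ : (fun h => _) = (fun h => norm2 (fun x => u (h + t) x - u t x))).
      exact: L2_continuous_shift.
    by apply/funext => h; congr norm2; apply/funext => x; rewrite /S; ring.
  - have := inner_continuous wK (L2_continuous_cst Lu') (L2_continuous_cst Lt2) tT.
    by move=> H; exact: (cvg_comp _ _ (@cvg_shift_time t) H).
have e : inner (fun x => w t x * u' t x) (fun x => 2 * u t x) =
    2 * inner (fun x => w t x * u t x) (u' t).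
  rewrite innerZr//; last first.
    have [mw wKs] := wK t tT.
    by apply: (@L2_mul_bounded _ (w t) (u' t) K mw _ Lu') => x hx; have [] := wKs x hx.
  by congr (_ * _); apply: eq_Rintegral => x _; ring.
rewrite e in C2; apply: cvg_trans (cvgD C1 C2).
  apply: near_eq_cvg; near=> h.
  have hT : 0 < h + t < T by near: h.
  have Luh : L2 (u (h + t)) by near: h.
  have [mw wKs] := wK _ hT.
  have Lw g : L2 g -> L2 (fun x => w (h + t) x * g x).
    by move=> Lg; apply: (@L2_mul_bounded _ (w (h + t)) g K mw _ Lg) => x hx; have [] := wKs x hx.
  rewrite !fctE /=; have -> : inner (fun x => w (h + t) x * D h x) (S h) =
    h^-1 * (inner (fun x => w (h + t) x * u (h + t) x) (u (h + t)) -
            inner (fun x => w (h + t) x * u t x) (u t)).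
    have Ld := L2B Luh Lu.
    have -> : (fun x => w (h + t) x * D h x) = (fun x => h^-1 * (w (h + t) x * (u (h + t) x - u t x))).
      by apply/funext => x; rewrite /D; ring.
    rewrite innerZl; [|exact: Lw|exact: L2D]; congr (_ * _).
    rewrite /inner -RintegralB//; last 2 first.
    - by apply: integrable_mulL2 => //; exact: Lw.
    - by apply: integrable_mulL2 => //; exact: Lw.
    by apply: eq_Rintegral => x _; rewrite /S; ring.
  by rewrite /=; ring.
Unshelve. all: by end_near. Qed.

Lemma continuous_energy_density w wt K u u' : bounded_weight K w -> bounded_weight K wt ->
  L2_continuous u -> L2_continuous u' -> forall t, 0 < t < T ->
  {for t, continuous (fun s => inner (fun x => wt s x * u s x) (u s) +
                        2 * inner (fun x => w s x * u s x) (u' s))}.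
Proof.
move=> wK wtK cu cu' t tT; apply: cvgD; first exact: (inner_continuous wtK cu cu tT).
apply: cvgM; first exact: cvg_cst.
exact: (inner_continuous wK cu cu' tT).
Qed.

End curves.

(** * Transport estimates along null directions *)

Section transport.
Context {R : realType}.
Local Notation mu := (@lebesgue_measure R).
Local Notation hl := (@halfline R).
Variables (c lambda sigma T : R).
Hypotheses (c0 : 0 < c) (lambda0 : lambda < 0) (sigma0 : 0 < sigma) (T0 : 0 < T).
Hypothesis step : exists P : R -> R, exists tau K, smooth_step P tau K.
Implicit Types (t x b : R) (n : nat) (u v : R -> R -> R).

Local Notation w := (weight c lambda sigma).
Local Notation w_t := (weight_t c lambda sigma).
Local Notation w_x := (weight_x c lambda sigma).

Definition weight_const n := @weight_bound R n + weight_deriv_bound c lambda n.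

Let wb0 n : 0 <= @weight_bound R n. Proof. by rewrite exprn_ge0. Qed.
Let wd0 n : 0 <= weight_deriv_bound c lambda n.
Proof. by apply: le_trans (norm_weight_t c0 lambda0 sigma0 n (lexx 0) (lexx 0)). Qed.

Lemma measurable_weight n t : 0 < t -> measurable_fun hl (w n t).
Proof.
move=> t0; apply: measurable_halfline_continuous => x x0.
exact: is_derive_continuous (is_derive_weight_x lambda sigma c0 n (ltW t0) (ltW x0)).
Qed.

Lemma measurable_weight_t n t : 0 < t -> measurable_fun hl (w_t n t).
Proof.
move=> t0; apply: measurable_funM.
  by apply: measurable_funB; apply: measurable_funM => //; exact: measurable_weight.
apply: measurable_funM => //; apply: measurable_funD => //.
apply: measurable_halfline_continuous => x x0; apply: cvgV.
  by rewrite gt_eqF// addr_gt0 ?mulr_gt0// addr_gt0.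
by apply: cvgD; [apply: cvgD; [exact: cvg_cst|exact: cvg_id]|exact: cvg_cst].
Qed.

Lemma measurable_weight_x n t : 0 < t -> measurable_fun hl (w_x n t).
Proof.
move=> t0; apply: measurable_halfline_continuous => x x0.
exact: continuous_weight_x (ltW t0) (ltW x0).
Qed.

Lemma bounded_weight_weight n K : @weight_bound R n <= K -> bounded_weight T K (w n).
Proof.
move=> nK t /andP[t0 tT]; split; first exact: measurable_weight.
move=> x; rewrite halflineE => x0; split.
  by rewrite (le_trans (norm_weight _ _ _ _ _ _))//.
exact: is_derive_continuous (is_derive_weight_t lambda sigma c0 n (ltW t0) (ltW x0)).
Qed.

Lemma bounded_weight_weight_t n K : weight_deriv_bound c lambda n <= K ->
  bounded_weight T K (w_t n).
Proof.
move=> nK t /andP[t0 tT]; split; first exact: measurable_weight_t.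
move=> x; rewrite halflineE => x0; split.
  by rewrite (le_trans (norm_weight_t c0 lambda0 sigma0 n (ltW t0) (ltW x0))).
exact: continuous_weight_t (ltW t0) (ltW x0).
Qed.

Let kappa := - lambda * c / (1 + c * T).

Lemma kappa_gt0 : 0 < kappa.
Proof. by rewrite divr_gt0 ?mulr_gt0 ?oppr_gt0// addr_gt0// mulr_gt0. Qed.

Lemma L2_weight n t f : 0 < t -> L2 f -> L2 (fun x => w n t x * f x).
Proof.
move=> t0 Lf.
by apply: (@L2_mul_bounded _ (w n t) f (@weight_bound R n) (measurable_weight n t0) _ Lf) => x _;
   exact: norm_weight.
Qed.

Lemma L2_weight_t n t f : 0 < t -> L2 f -> L2 (fun x => w_t n t x * f x).
Proof.
move=> t0 Lf.
apply: (@L2_mul_bounded _ (w_t n t) f (weight_deriv_bound c lambda n)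
  (measurable_weight_t n t0) _ Lf) => x; rewrite halflineE => x0.
exact: (norm_weight_t c0 lambda0 sigma0 n (ltW t0) (ltW x0)).
Qed.

Lemma L2_weight_x n t f : 0 < t -> L2 f -> L2 (fun x => w_x n t x * f x).
Proof.
move=> t0 Lf.
apply: (@L2_mul_bounded _ (w_x n t) f (weight_deriv_bound c lambda n)
  (measurable_weight_x n t0) _ Lf) => x; rewrite halflineE => x0.
exact: (norm_weight_x c0 lambda0 sigma0 n (ltW t0) (ltW x0)).
Qed.

(** With F = ft + b fx, integration by parts in x trades fx for the derivative of the
   weight along d/dt + b d/dx, which is at most - kappa w_(n+2). Young's inequality
   2 w_(n+1) f F <= kappa / 2 w_(n+2) f^2 + 2 / kappa w_n F^2 uses up half of this
   gain. *)
Lemma transport_density n b t f ft fx : - c <= b -> n.+1%:R <= sigma -> 0 < t < T ->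
  L2 f -> L2 ft -> L2 fx -> weak_derivative f fx ->
  inner (fun x => w_t n.+1 t x * f x) f + 2 * inner (fun x => w n.+1 t x * f x) ft +
    kappa / 2 * inner (fun x => w n.+2 t x * f x) f <=
  2 / kappa * inner (fun x => w n t x * (ft x + b * fx x)) (fun x => ft x + b * fx x) +
    b * (w n.+1 t 0 * trace f ^+ 2).
Proof.
move=> cb ns /andP[t0 tT] Lf Lft Lfx fxf.
have ibp := @weighted_ibp _ step (w n.+1 t) (w_x n.+1 t) (weight_const n.+1) f fx Lf Lfx fxf.
have {}ibp : inner (fun x => w_x n.+1 t x * f x) f + 2 * inner (fun x => w n.+1 t x * f x) fx =
    - w n.+1 t 0 * trace f ^+ 2.
  apply: ibp.
  - by move=> x x0; exact: (is_derive_weight_x lambda sigma c0 n.+1 (ltW t0) x0).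
  - by move=> x x0; exact: (continuous_weight_x c0 (ltW t0) x0).
  move=> x x0; split.
    by rewrite (le_trans (norm_weight _ _ _ _ _ _))// lerDl.
  by rewrite (le_trans (norm_weight_x c0 lambda0 sigma0 n.+1 (ltW t0) (ltW x0)))// lerDr.
pose F x := ft x + b * fx x.
have LF : L2 F by apply: L2D => //; exact: L2Z.
have Lw m g : L2 g -> L2 (fun x => w m t x * g x) by exact: L2_weight.
have Lwt := L2_weight_t n.+1 t0 Lf; have Lwx := L2_weight_x n.+1 t0 Lf.
have k0 := kappa_gt0.
have key : inner (fun x => w_t n.+1 t x * f x) f + b * inner (fun x => w_x n.+1 t x * f x) f
   + 2 * inner (fun x => w n.+1 t x * f x) F + kappa / 2 * inner (fun x => w n.+2 t x * f x) f
   <= 2 / kappa * inner (fun x => w n t x * F x) F.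
  have i1 := integrable_mulL2 Lwt Lf; have i2 := integrable_mulL2 Lwx Lf.
  have i3 := integrable_mulL2 (Lw n.+1 f Lf) LF; have i4 := integrable_mulL2 (Lw n.+2 f Lf) Lf.
  have i5 := integrable_mulL2 (Lw n F LF) LF.
  have Z (k : R) g : mu.-integrable hl (EFin \o g) -> mu.-integrable hl (EFin \o (fun x => k * g x)).
    by move=> ig; exact: (integrableZl measurable_halfline k ig).
  have D g1 g2 : mu.-integrable hl (EFin \o g1) -> mu.-integrable hl (EFin \o g2) ->
     mu.-integrable hl (EFin \o (fun x => g1 x + g2 x)).
    by move=> j1 j2; exact: (integrableD measurable_halfline j1 j2).
  have j1 := Z b _ i2; have j2 := D _ _ i1 j1; have j3 := Z 2 _ i3.
  have j4 := D _ _ j2 j3; have j5 := Z (kappa / 2) _ i4; have j6 := D _ _ j4 j5.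
  have j7 := Z (2 / kappa) _ i5.
  rewrite /inner -!RintegralZl// -!RintegralD//; apply: le_Rintegral => //.
  move=> x; rewrite halflineE => x0.
  have := weight_transport c0 lambda0 sigma0 (ltW t0) (ltW tT) (ltW x0) cb ns.
  rewrite -/kappa !(weightS _ _ _ n.+1) (weightS _ _ _ n).
  have := weight_ge0 c lambda sigma0 n t x.
  move: (w n t x) (w_t n.+1 t x) (w_x n.+1 t x) (scaled_phi c lambda sigma t x) (f x) (F x).
  move=> W wt wx a y z W0 tr.
  have : (wt + b * wx) * y ^+ 2 <= - kappa * (a * (a * W)) * y ^+ 2.
    by rewrite ler_wpM2r ?sqr_ge0.
  have : 0 <= W * ((kappa / 2) * (a * y - 2 / kappa * z) ^+ 2).
    by rewrite mulr_ge0// mulr_ge0 ?sqr_ge0// divr_ge0// ltW.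
  have -> : W * ((kappa / 2) * (a * y - 2 / kappa * z) ^+ 2) =
      kappa / 2 * (a * (a * W)) * y ^+ 2 - 2 * (a * W) * y * z + 2 / kappa * W * z ^+ 2.
    by field; rewrite gt_eqF.
  by move=> h1 h2; lra.
have e : inner (fun x => w n.+1 t x * f x) F =
    inner (fun x => w n.+1 t x * f x) ft + b * inner (fun x => w n.+1 t x * f x) fx.
  by rewrite innerDr ?innerZr//; try exact: Lw; exact: L2Z.
move: key; rewrite e.
have H : b * (w n.+1 t 0 * trace f ^+ 2) = b * - (inner (fun x => w_x n.+1 t x * f x) f +
    2 * inner (fun x => w n.+1 t x * f x) fx).
  by congr (b * _); rewrite ibp mulNr opprK.
lra.
Qed.

Lemma continuous_integrable (h : R -> R) a b : 0 < a -> b < T ->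
  (forall t, 0 < t < T -> {for t, continuous h}) ->
  mu.-integrable `[a, b] (EFin \o h).
Proof.
move=> a0 bT ch; apply: continuous_compact_integrable; first exact: segment_compact.
apply: continuous_in_subspaceT => t; rewrite inE/= in_itv/= => /andP[at_ tb].
by apply: ch; rewrite (lt_le_trans a0 at_) (le_lt_trans tb bT).
Qed.

Lemma weight_inner_continuous n u v : L2_continuous T u -> L2_continuous T v ->
  forall t, 0 < t < T -> {for t, continuous (fun s => inner (fun x => w n s x * u s x) (v s))}.
Proof. by move=> cu cv; exact: (inner_continuous (bounded_weight_weight (lexx _)) cu cv). Qed.

Lemma continuous_weight0 n t : 0 < t -> {for t, continuous (fun s => w n s 0)}.
Proof.
move=> t0.
exact: (is_derive_continuous (is_derive_weight_t lambda sigma c0 n (ltW t0) (lexx 0))).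
Qed.

(** Through [sqr_trace] the squared trace is an inner product of continuous curves,
   so that boundary terms can be integrated in time. *)
Lemma continuous_sqr_trace u ux : L2_continuous T u -> L2_continuous T ux ->
  (forall t, 0 < t < T -> weak_derivative (u t) (ux t)) ->
  forall t, 0 < t < T -> {for t, continuous (fun s => trace (u s) ^+ 2)}.
Proof.
move=> cu cux uux t tT.
have H : {for t, continuous (fun s => - 2 * inner (u s) (ux s))}.
  apply: cvgM; first exact: cvg_cst.
  have b1 : bounded_weight T 1 (fun _ _ => 1 : R).
    move=> s sT; split; first exact: measurable_cst.
    by move=> x _; split; [rewrite normr1|exact: cst_continuous].
  have E s : inner (fun x => 1 * u s x) (ux s) = inner (u s) (ux s).
    by apply: eq_Rintegral => x _; rewrite mul1r.
  have H : inner (fun x => 1 * u s x) (ux s) @[s --> t] --> inner (u t) (ux t).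
    by rewrite -E; exact: (inner_continuous b1 cu cux tT).
  apply: cvg_trans H; apply: near_eq_cvg.
  by apply: nearW => s; rewrite E.
have e s : 0 < s < T -> trace (u s) ^+ 2 = - 2 * inner (u s) (ux s).
  move=> sT; have [Lu _] := cu s sT; have [Lux _] := cux s sT.
  exact: (sqr_trace step Lu Lux (uux s sT)).
have {}H : - 2 * inner (u s) (ux s) @[s --> t] --> trace (u t) ^+ 2.
  by rewrite (e t tT).
apply: cvg_trans H; apply: near_eq_cvg.
by apply: filterS (near_time tT) => s /e ->.
Qed.

(** A Carleman estimate for the transport operator d/dt + b d/dx, with a gain of two
   powers of sigma phi. As u vanishes at alpha and beta, the derivative of the energy
   of weight w_(n+1) integrates to 0 in time, and [transport_density] remains. The
   boundary term is harmful for b > 0 and favourable for b < 0. *)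
Lemma transport_estimate n b u ut ux alpha beta : - c <= b -> n.+1%:R <= sigma ->
  0 < alpha -> alpha < beta -> beta < T ->
  L2_continuous T u -> L2_continuous T ut -> L2_continuous T ux ->
  L2_derivative T u ut -> (forall t, 0 < t < T -> weak_derivative (u t) (ux t)) ->
  u alpha = (fun=> 0) -> u beta = (fun=> 0) ->
  kappa / 2 * \int[mu]_(t in `[alpha, beta]) inner (fun x => w n.+2 t x * u t x) (u t) <=
  2 / kappa * \int[mu]_(t in `[alpha, beta])
     inner (fun x => w n t x * (ut t x + b * ux t x)) (fun x => ut t x + b * ux t x) +
  b * \int[mu]_(t in `[alpha, beta]) (w n.+1 t 0 * trace (u t) ^+ 2).
Proof.
move=> cb ns a0 ab bT cu cut cux du uux ua ub.
have inT t : alpha <= t <= beta -> 0 < t < T.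
  by move=> /andP[at_ tb]; rewrite (lt_le_trans a0 at_) (le_lt_trans tb bT).
have K1 : weight_bound n.+1 <= weight_const n.+1 by rewrite lerDl.
have K2 : weight_deriv_bound c lambda n.+1 <= weight_const n.+1 by rewrite lerDr.
pose E s := inner (fun x => w n.+1 s x * u s x) (u s).
pose E' s := inner (fun x => w_t n.+1 s x * u s x) (u s) + 2 * inner (fun x => w n.+1 s x * u s x) (ut s).
have dE t : 0 < t < T -> is_derive t 1 E (E' t).
  apply: (is_derive_energy (bounded_weight_weight K1) (bounded_weight_weight_t K2)) => //.
  move=> s x /andP[s0 _]; rewrite halflineE => x0.
  exact: (is_derive_weight_t lambda sigma c0 n.+1 (ltW s0) (ltW x0)).
have cE' t : 0 < t < T -> {for t, continuous E'}.
  exact: (continuous_energy_density (bounded_weight_weight K1) (bounded_weight_weight_t K2)).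
have inner0 (g : R -> R) : inner (fun x => g x * 0) (fun=> 0) = 0.
  by rewrite /inner; under eq_Rintegral do rewrite mulr0; rewrite Rintegral_cst// mul0r.
have IE : \int[mu]_(t in `[alpha, beta]) E' t = 0.
  have dE2 t : alpha <= t <= beta -> is_derive t 1 E (E' t) by move/inT; exact: dE.
  rewrite (Rintegral_derivative ab dE2); last by move=> t /inT; exact: cE'.
  by rewrite /E ua ub !inner0 subrr.
pose F t x := ut t x + b * ux t x.
have cF : L2_continuous T F.
  apply: L2_continuousD => //; apply: (@L2_continuousZ _ _ (fun=> b)) => // t _.
  exact: cst_continuous.
pose X t := inner (fun x => w n.+2 t x * u t x) (u t).
pose Y t := inner (fun x => w n t x * F t x) (F t).
pose Z t := w n.+1 t 0 * trace (u t) ^+ 2.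
have cZ t : 0 < t < T -> {for t, continuous Z}.
  move=> tT; apply: cvgM; last exact: (continuous_sqr_trace cu cux uux tT).
  by apply: continuous_weight0; case/andP: tT.
have iE := continuous_integrable a0 bT cE'.
have iX := continuous_integrable a0 bT (weight_inner_continuous (n := n.+2) cu cu).
have iY := continuous_integrable a0 bT (weight_inner_continuous (n := n) cF cF).
have iZ := continuous_integrable a0 bT cZ.
have mI : measurable (`[alpha, beta]%classic : set (g_sigma_algebraType R.-ocitv.-measurable)).
  exact: measurable_itv.
have S k (h : R -> R) : mu.-integrable `[alpha, beta] (EFin \o h) ->
    mu.-integrable `[alpha, beta] (EFin \o (fun t => k * h t)).
  by move=> ih; exact: (integrableZl mI k ih).
have jX := S (kappa / 2) X iX; have jY := S (2 / kappa) Y iY; have jZ := S b Z iZ.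
suff : \int[mu]_(t in `[alpha, beta]) E' t + \int[mu]_(t in `[alpha, beta]) (kappa / 2 * X t) <=
    \int[mu]_(t in `[alpha, beta]) (2 / kappa * Y t) + \int[mu]_(t in `[alpha, beta]) (b * Z t).
  by rewrite IE add0r (RintegralZl _ mI iX) (RintegralZl _ mI iY) (RintegralZl _ mI iZ).
rewrite -(RintegralD mI iE jX) -(RintegralD mI jY jZ); apply: le_Rintegral => //.
- exact: (integrableD mI iE jX).
- exact: (integrableD mI jY jZ).
move=> t; rewrite /= in_itv/= => /inT tT.
have [Lu _] := cu t tT; have [Lut _] := cut t tT; have [Lux _] := cux t tT.
exact: (transport_density cb ns tT Lu Lut Lux (uux t tT)).
Qed.

End transport.

(** * Curves in Sobolev spaces *)

Section sobolev_curves.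
Context {R : realType}.
Local Notation mu := (@lebesgue_measure R).
Local Notation hl := (@halfline R).
Hypothesis step : exists P : R -> R, exists tau K, smooth_step P tau K.
Implicit Types (f g : R -> R) (t x s k : R) (n : nat) (u v z : R -> R -> R).

(** Test functions and their derivatives being square integrable, the calculus of
   weak derivatives reduces to that of [inner]. *)
Lemma weak_derivative_inner f g : weak_derivative f g <->
  (forall h, Cc_infty hl h -> inner f (derive1 h) = - inner g h).
Proof. by []. Qed.

Lemma weak_derivative_ae f f' g g' : L2 f -> L2 f' -> L2 g -> L2 g' ->
  ae_hl f f' -> ae_hl g g' -> weak_derivative f g -> weak_derivative f' g'.
Proof.
move=> Lf Lf' Lg Lg' ff' gg' /weak_derivative_inner fg.
apply/weak_derivative_inner => h ch.
have Lh := L2_test ch; have Lh' := L2_derive1_test ch.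
have r (e : R -> R) : ae_hl e e by apply: aeW.
by rewrite -(@ae_inner _ f f' _ _ Lf Lf' Lh' Lh' ff' (r _)) fg//
  (@ae_inner _ g g' _ _ Lg Lg' Lh Lh gg' (r _)).
Qed.

Lemma weak_derivativeD f f' g g' : L2 f -> L2 f' -> L2 g -> L2 g' ->
  weak_derivative f g -> weak_derivative f' g' ->
  weak_derivative (fun x => f x + f' x) (fun x => g x + g' x).
Proof.
move=> Lf Lf' Lg Lg' /weak_derivative_inner fg /weak_derivative_inner fg'.
apply/weak_derivative_inner => h ch.
have Lh := L2_test ch; have Lh' := L2_derive1_test ch.
by rewrite !innerDl// fg// fg'// opprD.
Qed.

Lemma weak_derivativeZ k f g : L2 f -> L2 g -> weak_derivative f g ->
  weak_derivative (fun x => k * f x) (fun x => k * g x).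
Proof.
move=> Lf Lg /weak_derivative_inner fg; apply/weak_derivative_inner => h ch.
have Lh := L2_test ch; have Lh' := L2_derive1_test ch.
by rewrite !innerZl// fg// mulrN.
Qed.

Lemma weak_derivativeB f f' g g' : L2 f -> L2 f' -> L2 g -> L2 g' ->
  weak_derivative f g -> weak_derivative f' g' ->
  weak_derivative (fun x => f x - f' x) (fun x => g x - g' x).
Proof.
move=> Lf Lf' Lg Lg' fg fg'.
have := weak_derivativeD Lf (L2Z (-1) Lf') Lg (L2Z (-1) Lg') fg (weak_derivativeZ (-1) Lf' Lg' fg').
have e (a b : R -> R) : (fun x => a x + -1 * b x) = (fun x => a x - b x).
  by apply/funext => x; rewrite mulN1r.
by rewrite !e.
Qed.

Lemma Dx_spec f g : L2 g -> weak_derivative f g ->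
  L2 (Dx f) /\ weak_derivative f (Dx f).
Proof.
move=> Lg fg; rewrite /Dx; case: xgetP => [h _ //|].
by move=> /(_ g) []; split.
Qed.

Lemma Dx_ae f g : L2 f -> L2 g -> weak_derivative f g -> ae_hl (Dx f) g.
Proof.
move=> Lf Lg fg; have [LD fD] := Dx_spec Lg fg.
exact: (weak_derivative_unique step Lf LD Lg fD fg).
Qed.

Lemma ae_hl_sym f g : ae_hl f g -> ae_hl g f.
Proof. by apply: ae_mono => x fg hx; rewrite fg. Qed.

Lemma sobolev1P f : sobolev 1 f -> [/\ L2 f, L2 (Dx f) & weak_derivative f (Dx f)].
Proof. by move=> [Lf [g [fg [Lg _]]]]; have [] := Dx_spec Lg fg; split. Qed.

Lemma sobolev2P f : sobolev 2 f -> [/\ L2 f, L2 (Dx f), weak_derivative f (Dx f),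
  L2 (Dx (Dx f)) & weak_derivative (Dx f) (Dx (Dx f))].
Proof.
move=> [Lf [g [fg [Lg [g' [gg' [Lg' _]]]]]]].
have [LD fD] := Dx_spec Lg fg; have gD := ae_hl_sym (Dx_ae Lf Lg fg).
have Dg' : weak_derivative (Dx f) g'.
  by apply: (weak_derivative_ae Lg LD Lg' Lg' gD) gg'; exact: aeW.
by have [] := Dx_spec Lg' Dg'; split.
Qed.

Lemma norm2_eq0 f : L2 f -> norm2 f = 0 -> ae_hl f (fun=> 0).
Proof.
move=> Lf f0; have i0 : inner f f = 0 by rewrite -sqr_norm2 f0 expr0n.
have If := integrable_mulL2 Lf Lf.
have : (\int[mu]_(x in hl) `|(EFin \o (fun x => (f x * f x)%R)) x| = 0)%E.
  transitivity (\int[mu]_(x in hl) (f x * f x)%R%:E)%E.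
    by apply: eq_integral => x _ /=; rewrite ger0_norm// -expr2 sqr_ge0.
  by rewrite EFin_Rintegral// -/(inner f f) i0.
move=> /(ae_eq_integral_abs mu measurable_halfline (measurable_int _ If)).
by apply: ae_mono => x /= H hx; move: (H hx) => -[/eqP]; rewrite mulf_eq0 orbb => /eqP.
Qed.

Lemma L2norm_ge0 f : (0 <= L2norm f)%E.
Proof. exact: Lnorm_ge0. Qed.

Lemma L2norm_le_Hnorm m j f : (j <= m)%N -> (L2norm (iter j Dx f) <= Hnorm m f)%E.
Proof.
move=> jm; rewrite /Hnorm.
have jm1 : (j < m.+1)%N by [].
rewrite (bigD1 (Ordinal jm1))//= leeDl//.
by apply: sume_ge0 => i _; exact: L2norm_ge0.
Qed.

(** Extracts from convergence in H^m that of one space derivative, read on any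
   representative k of it. *)
Lemma cvg_Hnorm_norm2 (F : set_system R) {FF : Filter F} m j (y k : R -> R -> R) :
  (j <= m)%N -> Hnorm m (y s) @[s --> F] --> 0%E ->
  (\forall s \near F, [/\ L2 (iter j Dx (y s)), L2 (k s) & ae_hl (iter j Dx (y s)) (k s)]) ->
  norm2 (k s) @[s --> F] --> 0.
Proof.
move=> jm y0 H.
have : (norm2 (k s))%:E @[s --> F] --> 0%E.
  apply: (squeeze_cvge _ (@cvg_cst _ 0%E _ _ _) y0).
  apply: filterS H => s [L1 L2' e]; rewrite lee_fin norm2_ge0/=.
  by rewrite -(ae_norm2 L1 L2' e) -L2normE// L2norm_le_Hnorm.
by move/fine_cvgP => [_].
Qed.

Variable T : R.

Lemma cvg_within_interior (U : topologicalType) (f : R -> U) (l : U) t : 0 < t < T ->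
  f s @[s --> within `[0, T]%classic (nbhs t)] --> l -> f s @[s --> t] --> l.
Proof.
move=> tT fl A /fl fA.
have fA' : \forall s \near t, `[0, T]%classic s -> A (f s) by exact: fA.
have : \forall s \near t, A (f s).
  near=> s; apply: (near fA' s) => //.
  have /andP[s0 sT] : 0 < s < T by near: s; exact: near_time.
  by rewrite /= in_itv/= !ltW.
by [].
Unshelve. all: by end_near. Qed.

Lemma cvg_dnbhs_shift (U : topologicalType) (f : R -> U) (l : U) t : 0 < t < T ->
  f s @[s --> within `[0, T]%classic t^'] --> l -> f (h + t) @[h --> (0 : R)^'] --> l.
Proof.
move=> tT fl A /fl fA.
have fA' : \forall s \near t, s != t -> `[0, T]%classic s -> A (f s) by exact: fA.
have c : h + t @[h --> (0 : R)] --> t.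
  have : h + t @[h --> (0 : R)] --> 0 + t by apply: cvgD; [exact: cvg_id|exact: cvg_cst].
  by rewrite add0r.
have cA := c _ fA'; have cT := c _ (near_time tT).
have : \forall h \near (0 : R), h != 0 -> A (f (h + t)).
  near=> h => h0.
  have H : h + t != t -> `[0, T]%classic (h + t) -> A (f (h + t)) by near: h.
  have /andP[s0 sT] : 0 < h + t < T by near: h.
  apply: H; first by rewrite -subr_eq0 addrK.
  by rewrite /= in_itv/= !ltW.
by [].
Unshelve. all: by end_near. Qed.

End sobolev_curves.

Section curve_regularity.
Context {R : realType}.
Local Notation mu := (@lebesgue_measure R).
Local Notation hl := (@halfline R).
Hypothesis step : exists P : R -> R, exists tau K, smooth_step P tau K.
Variable T : R.
Implicit Types (f g : R -> R) (t x s k : R) (n : nat) (u v z y : R -> R -> R).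

Let cc t : 0 < t < T -> 0 <= t <= T.
Proof. by move=> /andP[t0 tT]; rewrite !ltW. Qed.

Lemma ae_hl_refl f : ae_hl f f.
Proof. exact: aeW. Qed.

Lemma Hnorm0E f : Hnorm 0 f = L2norm f.
Proof. by rewrite /Hnorm big_ord1. Qed.

Lemma curve_derivative_le m z t g : curve_derivative T m z t g -> curve_derivative T 0 z t g.
Proof.
move=> H; apply: (squeeze_cvge _ (@cvg_cst _ 0%E _ _ _) H).
by apply: nearW => s; rewrite Hnorm0E L2norm_ge0/=; exact: (@L2norm_le_Hnorm _ m 0).
Qed.

Lemma curve_derivative_norm2 m j z t g (k : R -> R -> R) : (j <= m)%N -> 0 < t < T ->
  curve_derivative T m z t g ->
  (forall s, 0 < s < T ->
    let q := iter j Dx (fun x => (s - t)^-1 * (z s x - z t x) - g x) in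
    [/\ L2 q, L2 (k s) & ae_hl q (k s)]) ->
  norm2 (k (h + t)) @[h --> (0 : R)^'] --> 0.
Proof.
move=> jm tT H K; have H' := cvg_dnbhs_shift tT H.
apply: (cvg_Hnorm_norm2 jm H').
by apply: filterS (near_shift_time tT) => h /K.
Qed.

Lemma curve_derivative_L2 z t g : (forall s, 0 < s < T -> L2 (z s)) -> L2 g -> 0 < t < T ->
  curve_derivative T 0 z t g ->
  norm2 (fun x => h^-1 * (z (h + t) x - z t x) - g x) @[h --> (0 : R)^'] --> 0.
Proof.
move=> Lz Lg tT H.
have := @curve_derivative_norm2 0 0 z t g
  (fun s x => (s - t)^-1 * (z s x - z t x) - g x) (leqnn _) tT H.
under eq_fun do rewrite addrK.
apply => s sT /=; have Lq : L2 (fun x => (s - t)^-1 * (z s x - z t x) - g x).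
  by apply: L2B => //; apply: L2Z; apply: L2B; exact: Lz.
by split => //; exact: ae_hl_refl.
Qed.

Lemma curve_derivative_unique z t g1 g2 : (forall s, 0 < s < T -> L2 (z s)) ->
  L2 g1 -> L2 g2 -> 0 < t < T ->
  curve_derivative T 0 z t g1 -> curve_derivative T 0 z t g2 -> ae_hl g1 g2.
Proof.
move=> Lz L1 L2' tT /(curve_derivative_L2 Lz L1 tT) d1 /(curve_derivative_L2 Lz L2' tT) d2.
have LD : \forall h \near (0 : R)^', L2 (fun x => h^-1 * (z (h + t) x - z t x)).
  by apply: filterS (near_shift_time tT) => h hT; apply: L2Z; apply: L2B; exact: Lz.
have l1 : \forall h \near (0 : R)^', L2 (fun x => h^-1 * (z (h + t) x - z t x) - g1 x).
  by apply: filterS LD => h ?; exact: L2B.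
have l2 : \forall h \near (0 : R)^', L2 (fun x => h^-1 * (z (h + t) x - z t x) - g2 x).
  by apply: filterS LD => h ?; exact: L2B.
have m1 : norm2 (fun x => -1 * (h^-1 * (z (h + t) x - z t x) - g1 x)) @[h --> (0 : R)^'] --> 0.
  by apply: (@cvg_norm2Z _ _ _ (fun=> -1) (-1)) => //; exact: cvg_cst.
have m1L : \forall h \near (0 : R)^', L2 (fun x => -1 * (h^-1 * (z (h + t) x - z t x) - g1 x)).
  by apply: filterS l1 => h ?; exact: L2Z.
have c0 : (fun=> norm2 (fun x => g1 x - g2 x)) h @[h --> (0 : R)^'] --> 0.
  rewrite (_ : (fun=> norm2 _) = (fun h => norm2 (fun x =>
    (h^-1 * (z (h + t) x - z t x) - g2 x) +
    -1 * (h^-1 * (z (h + t) x - z t x) - g1 x)))); first exact: cvg_norm2D.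
  by apply/funext => h; congr norm2; apply/funext => x; ring.
have e : norm2 (fun x => g1 x - g2 x) = 0.
  by apply: (cvg_unique (@Rhausdorff R) _ c0); exact: cvg_cst.
have := norm2_eq0 (L2B L1 L2') e.
by apply: ae_mono => x H hx; apply/eqP; rewrite -subr_eq0 H.
Qed.

Lemma curve_derivative_ae y z t g : 0 < t < T -> L2 g ->
  (forall s, 0 < s < T -> [/\ L2 (y s), L2 (z s) & ae_hl (y s) (z s)]) ->
  curve_derivative T 0 y t g -> curve_derivative T 0 z t g.
Proof.
move=> tT Lg yz; apply: cvg_trans; apply: near_eq_cvg.
have : \forall s \near t, s != t -> `[0, T]%classic s -> 0 < s < T.
  by apply: filterS (near_time tT).
apply: filterS => s H st sT; have {}H := H st sT.
have [Lys Lzs e] := yz s H; have [Lyt Lzt et] := yz t tT.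
rewrite !Hnorm0E !L2normE; try by apply: L2B => //; apply: L2Z; exact: L2B.
congr EFin; apply: ae_norm2; try by apply: L2B => //; apply: L2Z; exact: L2B.
by apply: ae_mono2 e et => x e1 e2 hx; rewrite e1// e2.
Qed.

(** [Dt] is a choice among the derivatives in L2; any derivative for a stronger norm
   is one of them, and they agree almost everywhere. *)
Lemma Dt_spec m z t g : (forall s, 0 < s < T -> L2 (z s)) -> L2 g -> 0 < t < T ->
  curve_derivative T m z t g ->
  [/\ L2 (Dt T z t), curve_derivative T 0 z t (Dt T z t) & ae_hl g (Dt T z t)].
Proof.
move=> Lz Lg tT /curve_derivative_le d.
have [LD dD] : L2 (Dt T z t) /\ curve_derivative T 0 z t (Dt T z t).
  by rewrite /Dt; case: xgetP => [h _ //|]; move=> /(_ g) []; split.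
by split => //; exact: (curve_derivative_unique Lz Lg LD tT d dD).
Qed.

Variable z : R -> R -> R.
Hypotheses (z02 : CkH T 0 2 z) (z11 : CkH T 1 1 z) (z20 : CkH T 2 0 z).

Let zx t := Dx (z t).
Let zxx t := Dx (Dx (z t)).
Let zt t := Dt T z t.
Let ztx t := Dx (Dt T z t).
Let ztt t := Dt T (Dt T z) t.

Lemma sobolev_values t : 0 < t < T -> [/\ L2 (z t), L2 (zx t), weak_derivative (z t) (zx t),
  L2 (zxx t) & weak_derivative (zx t) (zxx t)].
Proof. by move=> tT; case: z02 => -[H _] _; exact: (sobolev2P step (H t (cc tT))). Qed.

Lemma space_continuity :
  [/\ L2_continuous T z, L2_continuous T zx & L2_continuous T zxx].
Proof.
case: z02 => -[_ cz] _.
have D s t : 0 < s < T -> 0 < t < T ->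
   [/\ L2 (fun x => z s x - z t x),
   L2 (Dx (fun x => z s x - z t x)) /\ L2 (Dx (Dx (fun x => z s x - z t x))),
   ae_hl (Dx (fun x => z s x - z t x)) (fun x => zx s x - zx t x) &
   ae_hl (Dx (Dx (fun x => z s x - z t x))) (fun x => zxx s x - zxx t x)].
  move=> sT tT.
  have [Ls Lxs ws Lxxs wws] := sobolev_values sT.
  have [Lt Lxt wt Lxxt wwt] := sobolev_values tT.
  have Ld := L2B Ls Lt; have Ldx := L2B Lxs Lxt; have Ldxx := L2B Lxxs Lxxt.
  have wd := weak_derivativeB Ls Lt Lxs Lxt ws wt.
  have wdd := weak_derivativeB Lxs Lxt Lxxs Lxxt wws wwt.
  have [LD _] := Dx_spec Ldx wd; have eD := Dx_ae step Ld Ldx wd.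
  have wD := weak_derivative_ae Ldx LD Ldxx Ldxx (ae_hl_sym eD) (ae_hl_refl _) wdd.
  have [LDD _] := Dx_spec Ldxx wD; have eDD := Dx_ae step LD Ldxx wD.
  by split.
split => t tT; have [Lt Lxt wt Lxxt wwt] := sobolev_values tT; split => //;
  have C := cvg_within_interior tT (cz t (cc tT)).
- apply: (@cvg_Hnorm_norm2 _ _ _ 2 0 (fun s x => z s x - z t x)) => //.
  apply: filterS (near_time tT) => s sT /=; have [Ld _ _ _] := D s t sT tT.
  by split => //; exact: ae_hl_refl.
- apply: (@cvg_Hnorm_norm2 _ _ _ 2 1 (fun s x => z s x - z t x)) => //.
  apply: filterS (near_time tT) => s sT /=; have [_ [L1 _] e _] := D s t sT tT.
  by have [Ls Lxs _ _ _] := sobolev_values sT; split => //; exact: L2B.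
- apply: (@cvg_Hnorm_norm2 _ _ _ 2 2 (fun s x => z s x - z t x)) => //.
  apply: filterS (near_time tT) => s sT /=; have [_ [_ L1] _ e] := D s t sT tT.
  by have [Ls _ _ Lxxs _] := sobolev_values sT; split => //; exact: L2B.
Qed.

Lemma time_values t : 0 < t < T ->
  [/\ L2 (zt t), L2 (ztx t) & weak_derivative (zt t) (ztx t)].
Proof.
move=> tT; case: z11 => _ [z1 [d1 [[s1 _] _]]].
have Lz s : 0 < s < T -> L2 (z s) by move=> /sobolev_values[].
have [L1 L1x w1] := sobolev1P (s1 t (cc tT)).
have [LD _ e] := Dt_spec Lz L1 tT (d1 t (cc tT)).
have wD := weak_derivative_ae L1 LD L1x L1x e (ae_hl_refl _) w1.
by have [] := Dx_spec L1x wD; split.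
Qed.

(** The difference quotients of z converge in H^1, hence so do their space derivatives
   in L2: the curve Dx z is differentiable and its derivative is Dx (Dt z). *)
Lemma time_regularity : [/\ L2_continuous T zt, L2_continuous T ztx,
  L2_derivative T z zt & L2_derivative T zx ztx].
Proof.
case: z11 => _ [z1 [d1 [[s1 c1] _]]].
have Lz s : 0 < s < T -> L2 (z s) by move=> /sobolev_values[].
have V s : 0 < s < T -> [/\ L2 (z1 s), L2 (Dx (z1 s)), weak_derivative (z1 s) (Dx (z1 s)),
    ae_hl (z1 s) (zt s) & ae_hl (Dx (z1 s)) (ztx s)].
  move=> sT; have [L1 L1x w1] := sobolev1P (s1 s (cc sT)).
  have [LD _ e] := Dt_spec Lz L1 sT (d1 s (cc sT)).
  have [_ _ wD] := time_values sT; have [LDt Lx _] := time_values sT.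
  have wD' := weak_derivative_ae L1 LD L1x L1x e (ae_hl_refl _) w1.
  by split => //; apply: ae_hl_sym; exact: (Dx_ae step LD L1x wD').
have cz1 : L2_continuous T z1 /\ L2_continuous T (fun t => Dx (z1 t)).
  split => t tT; have [L1 L1x w1 _ _] := V t tT; split => //;
    have C := cvg_within_interior tT (c1 t (cc tT)).
  - apply: (@cvg_Hnorm_norm2 _ _ _ 1 0 (fun s x => z1 s x - z1 t x)) => //.
    apply: filterS (near_time tT) => s sT /=; have [Ls _ _ _ _] := V s sT.
    by split; [exact: L2B|exact: L2B|exact: ae_hl_refl].
  - apply: (@cvg_Hnorm_norm2 _ _ _ 1 1 (fun s x => z1 s x - z1 t x)) => //.
    apply: filterS (near_time tT) => s sT /=; have [Ls Lsx ws _ _] := V s sT.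
    have Ld := L2B Ls L1; have Ldx := L2B Lsx L1x.
    have wd := weak_derivativeB Ls L1 Lsx L1x ws w1.
    by have [LD _] := Dx_spec Ldx wd; split => //; exact: Dx_ae.
have [cz1_ cz1x] := cz1; have [cz czx _] := space_continuity.
have ezt s : 0 < s < T -> L2 (zt s) /\ ae_hl (z1 s) (zt s).
  by move=> sT; have [? _ _] := time_values sT; have [_ _ _ ? _] := V s sT.
have eztx s : 0 < s < T -> L2 (ztx s) /\ ae_hl (Dx (z1 s)) (ztx s).
  by move=> sT; have [_ ? _] := time_values sT; have [_ _ _ _ ?] := V s sT.
have r u : L2_continuous T u -> forall s, 0 < s < T -> L2 (u s) /\ ae_hl (u s) (u s).
  by move=> cu s sT; have [Lu _] := cu s sT; split => //; exact: ae_hl_refl.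
split.
- exact: L2_continuous_ae cz1_ ezt.
- exact: L2_continuous_ae cz1x eztx.
- apply: (L2_derivative_ae cz cz1_ _ (r _ cz) ezt) => t tT.
  have [L1 _ _ _ _] := V t tT.
  exact: (curve_derivative_L2 Lz L1 tT (curve_derivative_le (d1 t (cc tT)))).
- apply: (L2_derivative_ae czx cz1x _ (r _ czx) eztx) => t tT.
  have [L1 L1x w1 _ _] := V t tT.
  have := @curve_derivative_norm2 1 1 z t (z1 t)
    (fun s x => (s - t)^-1 * (zx s x - zx t x) - Dx (z1 t) x) (leqnn _) tT (d1 t (cc tT)).
  under eq_fun do rewrite addrK.
  apply => s sT /=.
  have [Lzs Lxs ws _ _] := sobolev_values sT; have [Lzt Lxt wt _ _] := sobolev_values tT.
  have Lq : L2 (fun x => (s - t)^-1 * (z s x - z t x) - z1 t x).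
    by apply: L2B => //; apply: L2Z; exact: L2B.
  have Lqx : L2 (fun x => (s - t)^-1 * (zx s x - zx t x) - Dx (z1 t) x).
    by apply: L2B => //; apply: L2Z; exact: L2B.
  have wq : weak_derivative (fun x => (s - t)^-1 * (z s x - z t x) - z1 t x)
      (fun x => (s - t)^-1 * (zx s x - zx t x) - Dx (z1 t) x).
    apply: weak_derivativeB => //; try by apply: L2Z; exact: L2B.
    by apply: weak_derivativeZ; [exact: L2B|exact: L2B|exact: weak_derivativeB].
  by have [LD _] := Dx_spec Lqx wq; split => //; exact: Dx_ae.
Qed.

(** The hypothesis in C^2([0, T]; L2) comes with its own first derivative, which is
   identified with Dt z before differentiating again. *)
Lemma second_time_regularity : L2_continuous T ztt /\ L2_derivative T zt ztt.
Proof.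
case: z20 => _ [y1 [dy1 [[sy1 cy1] [y2 [dy2 [[sy2 cy2] _]]]]]].
have Lz s : 0 < s < T -> L2 (z s) by move=> /sobolev_values[].
have L1 s : 0 < s < T -> L2 (y1 s) by move=> /cc/sy1[].
have L2' s : 0 < s < T -> L2 (y2 s) by move=> /cc/sy2[].
have e1 s : 0 < s < T -> [/\ L2 (y1 s), L2 (zt s) & ae_hl (y1 s) (zt s)].
  move=> sT; have [LD _ e] := Dt_spec Lz (L1 s sT) sT (dy1 s (cc sT)).
  by split => //; exact: L1.
have Lzt s : 0 < s < T -> L2 (zt s) by move=> /e1[].
have e2 s : 0 < s < T -> L2 (ztt s) /\ ae_hl (y2 s) (ztt s).
  move=> sT; have d2 := curve_derivative_ae sT (L2' s sT) e1 (dy2 s (cc sT)).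
  by have [LD _ e] := Dt_spec Lzt (L2' s sT) sT d2.
have cont y : (forall t, 0 <= t <= T -> sobolev 0 (y t)) ->
    (forall t0, 0 <= t0 <= T -> Hnorm 0 (fun x => y t x - y t0 x)
      @[t --> within `[0, T]%classic (nbhs t0)] --> 0%E) -> L2_continuous T y.
  move=> sy cy t tT; have [Lt _] := sy t (cc tT); split => //.
  apply: (@cvg_Hnorm_norm2 _ _ _ 0 0 (fun s x => y s x - y t x) _ (leqnn _)
    (cvg_within_interior tT (cy t (cc tT)))).
  apply: filterS (near_time tT) => s sT /=; have [Ls _] := sy s (cc sT).
  by split; [exact: L2B|exact: L2B|exact: ae_hl_refl].
have c1 := cont y1 sy1 cy1; have c2 := cont y2 sy2 cy2.
split; first exact: L2_continuous_ae c2 e2.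
apply: (L2_derivative_ae c1 c2 _ _ e2).
  by move=> t tT; exact: (curve_derivative_L2 L1 (L2' t tT) tT (dy2 t (cc tT))).
by move=> s /e1[].
Qed.

End curve_regularity.

(** * Localization in time *)

Section localization.
Context {R : realType}.
Local Notation mu := (@lebesgue_measure R).
Local Notation hl := (@halfline R).
Variables (c lambda sigma T : R).
Hypotheses (c0 : 0 < c) (lambda0 : lambda < 0) (sigma3 : 3 <= sigma) (T0 : 0 < T).
Hypothesis step : exists P : R -> R, exists tau K, smooth_step P tau K.
Implicit Types (f g h : R -> R) (t x b : R) (n : nat).

Let sigma0 : 0 < sigma. Proof. by apply: lt_le_trans sigma3. Qed.

Local Notation w := (weight c lambda sigma).

(** A linear combination of continuous representatives is a continuous
   representative of the linear combination. *)
Lemma trace_linear (k1 k2 : R) f1 g1 f2 g2 : L2 f1 -> L2 g1 -> L2 f2 -> L2 g2 ->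
  weak_derivative f1 g1 -> weak_derivative f2 g2 ->
  trace (fun x => k1 * f1 x + k2 * f2 x) = k1 * trace f1 + k2 * trace f2.
Proof.
move=> Lf1 Lg1 Lf2 Lg2 w1 w2.
have [F1 [pF1 e1]] := sobolev_representative step Lf1 Lg1 w1.
have [F2 [pF2 e2]] := sobolev_representative step Lf2 Lg2 w2.
have c1 := primitive_continuous pF1; have c2 := primitive_continuous pF2.
rewrite (trace_eq c1 e1) (trace_eq c2 e2).
apply: (@trace_eq _ _ (fun x => k1 * F1 x + k2 * F2 x)).
  move=> x; apply: cvgD; apply: cvgM; try exact: cvg_cst.
    exact: c1.
  exact: c2.
by apply: ae_mono2 e1 e2 => x h1 h2 hx; rewrite h1// h2.
Qed.

Lemma weighted_ge0 n t f : 0 <= inner (fun x => w n t x * f x) f.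
Proof.
apply: Rintegral_ge0 => x _; rewrite -mulrA -expr2.
by rewrite mulr_ge0 ?sqr_ge0// weight_ge0.
Qed.

Lemma weighted_sqr3 n t (k1 k2 k3 : R) f1 f2 f3 : 0 < t -> L2 f1 -> L2 f2 -> L2 f3 ->
  inner (fun x => w n t x * (k1 * f1 x + k2 * f2 x + k3 * f3 x))
        (fun x => k1 * f1 x + k2 * f2 x + k3 * f3 x) <=
  3 * (k1 ^+ 2 * inner (fun x => w n t x * f1 x) f1 +
       k2 ^+ 2 * inner (fun x => w n t x * f2 x) f2 +
       k3 ^+ 2 * inner (fun x => w n t x * f3 x) f3).
Proof.
move=> t0 L1 L2' L3.
have Lw f : L2 f -> L2 (fun x => w n t x * f x) by exact: L2_weight.
have Lk : L2 (fun x => k1 * f1 x + k2 * f2 x + k3 * f3 x).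
  by apply: L2D; [apply: L2D|]; exact: L2Z.
have Z (k : R) g : mu.-integrable hl (EFin \o g) -> mu.-integrable hl (EFin \o (fun x => k * g x)).
  by move=> ig; exact: (integrableZl measurable_halfline k ig).
have D g1 g2 : mu.-integrable hl (EFin \o g1) -> mu.-integrable hl (EFin \o g2) ->
   mu.-integrable hl (EFin \o (fun x => g1 x + g2 x)).
  by move=> j1 j2; exact: (integrableD measurable_halfline j1 j2).
have i0 := integrable_mulL2 (Lw _ Lk) Lk.
have i1 := integrable_mulL2 (Lw _ L1) L1; have i2 := integrable_mulL2 (Lw _ L2') L2'.
have i3 := integrable_mulL2 (Lw _ L3) L3.
have j1 := Z (k1 ^+ 2) _ i1; have j2 := Z (k2 ^+ 2) _ i2; have j3 := Z (k3 ^+ 2) _ i3.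
have j12 := D _ _ j1 j2; have j123 := D _ _ j12 j3; have j := Z 3 _ j123.
rewrite /inner -!RintegralZl// -!RintegralD// -RintegralZl//.
apply: le_Rintegral => //.
move=> x _; have := weight_ge0 c lambda sigma0 n t x.
move: (w n t x) (f1 x) (f2 x) (f3 x) => W a b d W0.
have := mulr_ge0 W0 (sqr_ge0 (k1 * a - k2 * b)).
have := mulr_ge0 W0 (sqr_ge0 (k1 * a - k3 * d)).
have := mulr_ge0 W0 (sqr_ge0 (k2 * b - k3 * d)).
lra.
Qed.

Variable z : R -> R -> R.
Hypotheses (z02 : CkH T 0 2 z) (z11 : CkH T 1 1 z) (z20 : CkH T 2 0 z).
Let zx t := Dx (z t).
Let zxx t := Dx (Dx (z t)).
Let zt t := Dt T z t.
Let ztx t := Dx (Dt T z t).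
Let ztt t := Dt T (Dt T z) t.

Variables (eta : R -> R) (Istar : set R) (alpha beta M1 M2 : R).
Hypotheses (eta_smooth : smooth eta) (eta_supp : tsupport eta `<=` Istar).
Hypothesis Istar_sub : Istar `<=` `]alpha, beta[%classic.
Hypotheses (alpha0 : 0 < alpha) (alphabeta : alpha < beta) (betaT : beta < T).
Hypothesis eta01 : forall t, 0 <= eta t <= 1.
Hypothesis eta1 : forall t, `|derive1n 1 eta t| <= M1.
Hypothesis eta2 : forall t, `|derive1n 2 eta t| <= M2.

Local Notation d1 := (derive1n 1 eta).
Local Notation d2 := (derive1n 2 eta).

Let eta_out t : ~ Istar t -> eta t = 0.
Proof. by move=> nt; apply: (@derive1n_tsupport_out _ eta 0) => /eta_supp. Qed.
Let d1_out t : ~ Istar t -> d1 t = 0.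
Proof. by move=> nt; apply: (@derive1n_tsupport_out _ eta 1) => /eta_supp. Qed.

Let alpha_out : ~ Istar alpha.
Proof. by move=> /Istar_sub; rewrite /= in_itv/= ltxx. Qed.
Let beta_out : ~ Istar beta.
Proof. by move=> /Istar_sub; rewrite /= in_itv/= ltxx andbF. Qed.

Let dd0 t : is_derive t 1 eta (d1 t).
Proof. exact: (smooth_is_derive 0 t eta_smooth). Qed.
Let dd1 t : is_derive t 1 d1 (d2 t).
Proof. exact: (smooth_is_derive 1 t eta_smooth). Qed.
Let ce : forall t, 0 < t < T -> {for t, continuous eta}.
Proof. by move=> t _; exact: (is_derive_continuous (dd0 t)). Qed.
Let c1 : forall t, 0 < t < T -> {for t, continuous d1}.
Proof. by move=> t _; exact: (is_derive_continuous (dd1 t)). Qed.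
Let c2 : forall t, 0 < t < T -> {for t, continuous d2}.
Proof. by move=> t _; exact: (is_derive_continuous (smooth_is_derive 2 t eta_smooth)). Qed.

(** The null derivative [d/dt - b d/dx] of the localized solution [eta z]. *)
Definition null_derivative b t x := d1 t * z t x + eta t * (zt t x + - b * zx t x).

Definition localized t x := eta t * z t x.

(** The wave operator applied to [eta z], expanded by the Leibniz rule. *)
Definition localized_box t x := eta t * box c T z t x + 2 * d1 t * zt t x + d2 t * z t x.

Let cz : L2_continuous T z. Proof. by have [h _ _] := space_continuity step z02; exact: h. Qed.
Let czx : L2_continuous T zx. Proof. by have [_ h _] := space_continuity step z02; exact: h. Qed.
Let czxx : L2_continuous T zxx. Proof. by have [_ _ h] := space_continuity step z02; exact: h. Qed.
Let czt : L2_continuous T zt. Proof. by have [h _ _ _] := time_regularity step z02 z11; exact: h. Qed.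
Let cztx : L2_continuous T ztx. Proof. by have [_ h _ _] := time_regularity step z02 z11; exact: h. Qed.
Let cztt : L2_continuous T ztt. Proof. by have [h _] := second_time_regularity step z02 z20; exact: h. Qed.
Let dz : L2_derivative T z zt. Proof. by have [_ _ h _] := time_regularity step z02 z11; exact: h. Qed.
Let dzx : L2_derivative T zx ztx. Proof. by have [_ _ _ h] := time_regularity step z02 z11; exact: h. Qed.
Let dzt : L2_derivative T zt ztt. Proof. by have [_ h] := second_time_regularity step z02 z20; exact: h. Qed.
Let wz t : 0 < t < T -> weak_derivative (z t) (zx t).
Proof. by move=> tT; have [_ _ h _ _] := sobolev_values step z02 tT; exact: h. Qed.
Let wzx t : 0 < t < T -> weak_derivative (zx t) (zxx t).
Proof. by move=> tT; have [_ _ _ _ h] := sobolev_values step z02 tT; exact: h. Qed.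
Let wzt t : 0 < t < T -> weak_derivative (zt t) (ztx t).
Proof. by move=> tT; have [_ _ h] := time_values step z02 z11 tT; exact: h. Qed.

Let cb b : forall t, 0 < t < T -> {for t, continuous (fun=> b : R)}.
Proof. by move=> t _; exact: cst_continuous. Qed.

Let nx b : L2_continuous T (fun t x => zt t x + - b * zx t x).
Proof. exact: (L2_continuousD czt (L2_continuousZ (@cb (- b)) czx)). Qed.
Let ntx b : L2_continuous T (fun t x => ztt t x + - b * ztx t x).
Proof. exact: (L2_continuousD cztt (L2_continuousZ (@cb (- b)) cztx)). Qed.
Let nxx b : L2_continuous T (fun t x => ztx t x + - b * zxx t x).
Proof. exact: (L2_continuousD cztx (L2_continuousZ (@cb (- b)) czxx)). Qed.

Let null_t b t x := (d2 t * z t x + d1 t * zt t x) +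
  (d1 t * (zt t x + - b * zx t x) + eta t * (ztt t x + - b * ztx t x)).
Let null_x b t x := d1 t * zx t x + eta t * (ztx t x + - b * zxx t x).

Lemma null_derivative_continuous b : L2_continuous T (null_derivative b).
Proof. exact: (L2_continuousD (L2_continuousZ c1 cz) (L2_continuousZ ce (nx b))). Qed.

Let null_t_continuous b : L2_continuous T (null_t b).
Proof.
exact: (L2_continuousD (L2_continuousD (L2_continuousZ c2 cz) (L2_continuousZ c1 czt))
  (L2_continuousD (L2_continuousZ c1 (nx b)) (L2_continuousZ ce (ntx b)))).
Qed.

Let null_x_continuous b : L2_continuous T (null_x b).
Proof. exact: (L2_continuousD (L2_continuousZ c1 czx) (L2_continuousZ ce (nxx b))). Qed.

Let null_derivative_t b : L2_derivative T (null_derivative b) (null_t b).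
Proof.
have dn : L2_derivative T (fun t x => zt t x + - b * zx t x)
    (fun t x => ztt t x + - b * ztx t x).
  have cbx := L2_continuousZ (@cb (- b)) czx; have cbtx := L2_continuousZ (@cb (- b)) cztx.
  apply: (L2_derivativeD czt cbx cztt cbtx dzt).
  rewrite (_ : (fun t x => - b * ztx t x) = (fun t x => 0 * zx t x + - b * ztx t x)).
    exact: (L2_derivativeZ (k := fun=> - b) (k' := fun=> 0) czx cztx _ dzx).
  by apply/funext => t; apply/funext => x; rewrite mul0r add0r.
have l1 := L2_derivativeZ (k := d1) (k' := d2) cz czt (fun t _ => dd1 t) dz.
have l2 := L2_derivativeZ (k := eta) (k' := d1) (nx b) (ntx b) (fun t _ => dd0 t) dn.
apply: (L2_derivativeD _ _ _ _ l1 l2).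
- exact: (L2_continuousZ c1 cz).
- exact: (L2_continuousZ ce (nx b)).
- exact: (L2_continuousD (L2_continuousZ c2 cz) (L2_continuousZ c1 czt)).
- exact: (L2_continuousD (L2_continuousZ c1 (nx b)) (L2_continuousZ ce (ntx b))).
Qed.

Let null_derivative_x b t : 0 < t < T ->
  weak_derivative (null_derivative b t) (null_x b t).
Proof.
move=> tT.
have [Lz _] := cz tT; have [Lzx _] := czx tT; have [Lzxx _] := czxx tT.
have [Lzt _] := czt tT; have [Lztx _] := cztx tT.
have [Ln _] := nx b tT; have [Lnx _] := nxx b tT.
apply: weak_derivativeD; try exact: L2Z.
  by apply: weak_derivativeZ => //; exact: wz.
apply: weak_derivativeZ => //; apply: weak_derivativeD => //; try exact: L2Z.
  exact: wzt.
by apply: weak_derivativeZ => //; exact: wzx.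
Qed.

(** The factorization of the wave operator as (d/dt + b d/dx) (d/dt - b d/dx), which
   holds for b = c and for b = - c. *)
Let box_eq b : b ^+ 2 = c ^+ 2 ->
  (fun t x => null_t b t x + b * null_x b t x) = localized_box.
Proof.
move=> bc; apply/funext => t; apply/funext => x.
rewrite /localized_box /box -bc /null_t /null_x -/(ztt t) -/(zxx t) -/(zt t).
ring.
Qed.

Let box_continuous : L2_continuous T (box c T z).
Proof.
rewrite (_ : box c T z = (fun t x => ztt t x + - c ^+ 2 * zxx t x)).
  exact: (L2_continuousD cztt (L2_continuousZ (@cb (- c ^+ 2)) czxx)).
by apply/funext => t; apply/funext => x; rewrite /box mulNr.
Qed.

Lemma localized_box_continuous : L2_continuous T localized_box.
Proof.
have cd t : 0 < t < T -> {for t, continuous (fun t => 2 * d1 t)}.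
  by move=> tT; apply: cvgM; [exact: cvg_cst|exact: c1].
exact: (L2_continuousD (L2_continuousD (L2_continuousZ ce box_continuous)
  (L2_continuousZ cd czt)) (L2_continuousZ c2 cz)).
Qed.

Let vt t x := d1 t * z t x + eta t * zt t x.
Let vx t x := eta t * zx t x.

Lemma localized_continuous : L2_continuous T localized.
Proof. exact: (L2_continuousZ ce cz). Qed.

Let kappa := - lambda * c / (1 + c * T).
Let kappa0 : 0 < kappa. Proof. exact: kappa_gt0. Qed.

Let energy n u := \int[mu]_(t in `[alpha, beta]) inner (fun x => w n t x * u t x) (u t).
Let bdry := \int[mu]_(t in `[alpha, beta]) (w 1 t 0 * trace (null_derivative c t) ^+ 2).

Let null_zero b t : ~ Istar t -> null_derivative b t = (fun=> 0).
Proof.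
by move=> nt; apply/funext => x; rewrite /null_derivative d1_out// eta_out// !mul0r addr0.
Qed.

Let energy_ge0 n u : 0 <= energy n u.
Proof. by apply: Rintegral_ge0 => t _; exact: weighted_ge0. Qed.

Let invert (x y r : R) : kappa / 2 * x <= 2 / kappa * y + r ->
  x <= 4 / kappa ^+ 2 * y + 2 / kappa * r.
Proof.
have k2 : 0 < kappa / 2 := divr_gt0 kappa0 (ltr0Sn R 1).
rewrite -(ler_pdivlMl _ _ k2) => /le_trans; apply.
rewrite le_eqVlt; apply/orP; left; apply/eqP; move: kappa kappa0 => k k0.
by field; rewrite gt_eqF.
Qed.

(** The null derivative d/dt - c d/dx solves the transport equation in the direction
   d/dt + c d/dx, that of waves entering through x = 0: its trace has to be paid. *)
Let incoming : energy 2 (null_derivative c) <=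
  4 / kappa ^+ 2 * energy 0 localized_box + 2 / kappa * (c * bdry).
Proof.
apply: invert.
have n1 : 0.+1%:R <= sigma by apply: le_trans sigma3; rewrite ler_nat.
have cc : - c <= c by rewrite ge0_cp// ltW.
have := transport_estimate c0 lambda0 sigma0 T0 step cc n1 alpha0 alphabeta betaT
  (null_derivative_continuous c) (null_t_continuous c) (null_x_continuous c)
  (null_derivative_t c) (fun t tT => @null_derivative_x c t tT) (null_zero c alpha_out) (null_zero c beta_out).
by rewrite -(box_eq (erefl (c ^+ 2))).
Qed.

(** In the direction d/dt - c d/dx the boundary term has a favourable sign. *)
Let outgoing : energy 2 (null_derivative (- c)) <= 4 / kappa ^+ 2 * energy 0 localized_box.
Proof.
have n1 : 0.+1%:R <= sigma by apply: le_trans sigma3; rewrite ler_nat.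
have := transport_estimate c0 lambda0 sigma0 T0 step (lexx (- c)) n1 alpha0 alphabeta betaT
  (null_derivative_continuous (- c)) (null_t_continuous (- c)) (null_x_continuous (- c))
  (null_derivative_t (- c)) (fun t tT => @null_derivative_x (- c) t tT) (null_zero (- c) alpha_out) (null_zero (- c) beta_out).
rewrite -(box_eq (sqrrN c)) => H.
rewrite -[leRHS]addr0 -(mulr0 (2 / kappa)); apply: invert; apply: le_trans H _.
rewrite lerD2l mulNr oppr_le0 mulr_ge0 ?(ltW c0)//.
by apply: Rintegral_ge0 => t _; rewrite mulr_ge0 ?sqr_ge0// weight_ge0.
Qed.

(** The amplitude eta z is itself transported, along d/dt - c d/dx, with the null
   derivative as its source; n = 2 gives the weights w_4 and w_2. *)
Let amplitude : energy 4 localized <= 4 / kappa ^+ 2 * energy 2 (null_derivative c).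
Proof.
have z0 t : ~ Istar t -> localized t = (fun=> 0).
  by move=> nt; apply/funext => x; rewrite /localized eta_out// mul0r.
have vtc : L2_continuous T vt := L2_continuousD (L2_continuousZ c1 cz) (L2_continuousZ ce czt).
have vxc : L2_continuous T vx := L2_continuousZ ce czx.
have dv : L2_derivative T localized vt := L2_derivativeZ cz czt (fun t _ => dd0 t) dz.
have wv t : 0 < t < T -> weak_derivative (localized t) (vx t).
  move=> tT; have [Lz _] := cz tT; have [Lzx _] := czx tT.
  by apply: weak_derivativeZ => //; exact: wz.
have := transport_estimate c0 lambda0 sigma0 T0 step (lexx (- c)) sigma3 alpha0 alphabeta betaT
  localized_continuous vtc vxc dv wv (z0 _ alpha_out) (z0 _ beta_out).
rewrite (_ : null_derivative c = (fun t x => vt t x + - c * vx t x)); last first.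
  by apply/funext => t; apply/funext => x; rewrite /vt /vx /null_derivative; ring.
move=> H; rewrite -[leRHS]addr0 -(mulr0 (2 / kappa)); apply: invert; apply: le_trans H _.
rewrite lerD2l mulNr oppr_le0 mulr_ge0 ?(ltW c0)//.
by apply: Rintegral_ge0 => t _; rewrite mulr_ge0 ?sqr_ge0// weight_ge0.
Qed.

Lemma localized_estimate (K : R) : 0 <= K ->
  energy 4 localized + K * (energy 2 (null_derivative c) + energy 2 (null_derivative (- c))) <=
  ((4 / kappa ^+ 2 + K) * (4 / kappa ^+ 2) + K * (4 / kappa ^+ 2)) * energy 0 localized_box +
  (4 / kappa ^+ 2 + K) * (2 / kappa * c) * bdry.
Proof.
move=> K0.
have A0 : 0 <= 4 / kappa ^+ 2 by rewrite divr_ge0// exprn_ge0// ltW.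
have e1 := energy_ge0 0 localized_box; have e2 := energy_ge0 2 (null_derivative c).
move: amplitude incoming outgoing.
move: (energy 4 _) (energy 2 _) (energy 2 _) (energy 0 _) bdry (4 / kappa ^+ 2) (2 / kappa) A0 e1 e2.
move=> X1 X3 X2 P Z A B A0 P0 X20 h1 h2 h3.
have k2 : (A + K) * X2 <= (A + K) * (A * P + B * (c * Z)) by rewrite ler_wpM2l// addr_ge0.
have k3 : K * X3 <= K * (A * P) by rewrite ler_wpM2l.
lra.
Qed.

Let lhs_density t := inner (fun x => w 3 t x * z t x) (z t) +
  sigma * (inner (fun x => w 0 t x * zt t x) (zt t) + inner (fun x => w 0 t x * zx t x) (zx t)).
Let box_density t := inner (fun x => w 0 t x * box c T z t x) (box c T z t).
Let bdry_density t := w 3 t 0 * trace (z t) ^+ 2 +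
  w 1 t 0 * (trace (zt t) ^+ 2 + trace (zx t) ^+ 2).
Let cut_density t := inner (fun x => w 0 t x * zt t x) (zt t) +
  inner (fun x => w 0 t x * z t x) (z t).

Let cw n u v : L2_continuous T u -> L2_continuous T v -> forall t, 0 < t < T ->
  {for t, continuous (fun s => inner (fun x => w n s x * u s x) (v s))}.
Proof. exact: weight_inner_continuous. Qed.

Let lhs_continuous t : 0 < t < T -> {for t, continuous lhs_density}.
Proof.
move=> tT; apply: cvgD; first exact: cw.
by apply: cvgM; [exact: cvg_cst|apply: cvgD; exact: cw].
Qed.

Let box_density_continuous t : 0 < t < T -> {for t, continuous box_density}.
Proof. by move=> tT; exact: cw. Qed.

Let cut_continuous t : 0 < t < T -> {for t, continuous cut_density}.
Proof. by move=> tT; apply: cvgD; exact: cw. Qed.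

Let bdry_continuous t : 0 < t < T -> {for t, continuous bdry_density}.
Proof.
move=> tT; have /andP[t0 _] := tT.
have w3 : {for t, continuous (fun s => w 3 s 0)} by exact: continuous_weight0.
have w1 : {for t, continuous (fun s => w 1 s 0)} by exact: continuous_weight0.
apply: cvgD; apply: cvgM => //.
  exact: (continuous_sqr_trace step cz czx wz tT).
apply: cvgD.
  exact: (continuous_sqr_trace step czt cztx wzt tT).
exact: (continuous_sqr_trace step czx czxx wzx tT).
Qed.

Let inT t : alpha <= t <= beta -> 0 < t < T.
Proof. by move=> /andP[at_ tb]; rewrite (lt_le_trans alpha0 at_) (le_lt_trans tb betaT). Qed.

Lemma integrable_density (h : R -> R) (A : set R) : measurable A ->
  A `<=` `[alpha, beta]%classic -> (forall t, 0 < t < T -> {for t, continuous h}) ->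
  mu.-integrable A (EFin \o h).
Proof.
move=> mA sA ch; have := continuous_integrable alpha0 betaT ch.
by apply: integrableS => //; exact: measurable_itv.
Qed.

Let mI : measurable (`[alpha, beta]%classic : set (g_sigma_algebraType R.-ocitv.-measurable)).
Proof. exact: measurable_itv. Qed.

Lemma integrable_restricted (h : R -> R) (A : set R) : measurable A ->
  A `<=` `[alpha, beta]%classic -> (forall t, 0 < t < T -> {for t, continuous h}) ->
  mu.-integrable `[alpha, beta] (EFin \o (h \_ A)).
Proof.
move=> mA sA ch; rewrite -restrict_EFin; apply/integrable_restrict => //.
by rewrite setIidr//; exact: integrable_density.
Qed.

Lemma Rintegral_restricted (h : R -> R) (A : set R) : A `<=` `[alpha, beta]%classic ->
  \int[mu]_(t in `[alpha, beta]) (h \_ A) t = \int[mu]_(t in A) h t.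
Proof. by move=> sA; rewrite -Rintegral_mkcondr setIidr. Qed.

Hypothesis Istar_open : open Istar.
Let cutset := tsupport (derive1 eta) `|` tsupport (derive1n 2 eta).

Let mIstar : measurable Istar. Proof. exact: open_measurable. Qed.
Let sIstar : Istar `<=` `[alpha, beta]%classic.
Proof. by move=> t /Istar_sub /=; rewrite !in_itv/= => /andP[? ?]; rewrite !ltW. Qed.
Let mcutset : measurable cutset.
Proof. by apply: measurableU; apply: closed_measurable; exact: closed_closure. Qed.
Let scutset : cutset `<=` `[alpha, beta]%classic.
Proof.
move=> t tc; apply: sIstar; apply: eta_supp; apply: contrapT => nt.
have key n : closure [set s | derive1n n eta s != 0] `<=` tsupport eta.
  rewrite [X in _ `<=` X](closure_id _).1; last exact: closed_closure.
  apply: closureS => s /eqP ds; apply: contrapT => ns; apply: ds.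
  exact: derive1n_tsupport_out.
by case: tc => [/(key 1)|/(key 2)].
Qed.

(** The commutator 2 eta' z_t + eta'' z of the wave operator with eta lives on the
   supports of the derivatives of eta. *)
Let box_bound : energy 0 localized_box <=
  3 * \int[mu]_(t in Istar) box_density t +
  3 * (4 * M1 ^+ 2 + M2 ^+ 2) * \int[mu]_(t in cutset) cut_density t.
Proof.
have iB := integrable_restricted mIstar sIstar box_density_continuous.
have iC := integrable_restricted mcutset scutset cut_continuous.
have iE := continuous_integrable alpha0 betaT
  (fun t => @cw 0 _ _ localized_box_continuous localized_box_continuous t).
rewrite -(Rintegral_restricted box_density sIstar) -(Rintegral_restricted cut_density scutset).
have S k (h : R -> R) : mu.-integrable `[alpha, beta] (EFin \o h) ->
    mu.-integrable `[alpha, beta] (EFin \o (fun t => k * h t)).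
  by move=> ih; exact: (integrableZl mI k ih).
have jB := S 3 _ iB; have jC := S (3 * (4 * M1 ^+ 2 + M2 ^+ 2)) _ iC.
rewrite -(RintegralZl _ mI iB) -(RintegralZl _ mI iC) -RintegralD//.
apply: le_Rintegral => //; first exact: (integrableD mI jB jC).
move=> t; rewrite /= in_itv/= => /inT tT; have /andP[t0 _] := tT.
have [Lb _] := box_continuous tT; have [Lzt _] := czt tT; have [Lz _] := cz tT.
have := weighted_sqr3 0 (eta t) (2 * d1 t) (d2 t) t0 Lb Lzt Lz.
move/le_trans; apply.
have b0 : 0 <= box_density t by exact: weighted_ge0.
have zt0 := weighted_ge0 0 t (zt t); have z0 := weighted_ge0 0 t (z t).
rewrite -/(box_density t).
have H1 : eta t ^+ 2 * box_density t <= (box_density \_ Istar) t.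
  rewrite patchE; case: ifPn => [_|/negP nt].
    by rewrite ler_piMl// expr_le1//; have /andP[] := eta01 t.
  by rewrite eta_out ?expr0n ?mul0r// => It; apply: nt; rewrite inE.
have H2 : (2 * d1 t) ^+ 2 * inner (fun x => w 0 t x * zt t x) (zt t) +
    d2 t ^+ 2 * inner (fun x => w 0 t x * z t x) (z t) <=
    (4 * M1 ^+ 2 + M2 ^+ 2) * (cut_density \_ cutset) t.
  rewrite patchE; case: ifPn => [_|/negP nt].
    have m1 : d1 t ^+ 2 <= M1 ^+ 2.
      by rewrite -(real_normK (num_real (d1 t))) lerXn2r ?nnegrE// (le_trans _ (eta1 t)).
    have m2 : d2 t ^+ 2 <= M2 ^+ 2.
      by rewrite -(real_normK (num_real (d2 t))) lerXn2r ?nnegrE// (le_trans _ (eta2 t)).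
    rewrite /cut_density; move: m1 m2 (sqr_ge0 M1) (sqr_ge0 M2) zt0 z0.
    rewrite exprMn; move: (d1 t ^+ 2) (d2 t ^+ 2) (M1 ^+ 2) (M2 ^+ 2) (inner _ _) (inner _ _).
    move=> p q m n X Y h1 h2 m0 n0 X0 Y0.
    have := ler_wpM2r X0 h1; have := ler_wpM2r Y0 h2.
    have := mulr_ge0 n0 X0; have := mulr_ge0 m0 Y0; rewrite !mulrDr !mulrDl. lra.
  have nd n : (forall s, closure [set s | derive1n n eta s != 0] s -> cutset s) ->
      derive1n n eta t = 0.
    move=> H; apply/eqP/negPn/negP => dn; apply: nt; rewrite inE; apply: H.
    exact: subset_closure.
  rewrite (nd 1%N); last by move=> s; left.
  rewrite (nd 2%N); last by move=> s; right.
  by rewrite mulr0 expr0n !mul0r mulr0 addr0.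
lra.
Qed.

(** The trace of the null derivative is a combination of those of z, z_t and z_x; the
   weight w_1 that it carries is at most the w_3 available for z. *)
Let bdry_bound : bdry <= 3 * (M1 ^+ 2 + 1 + c ^+ 2) * \int[mu]_(t in Istar) bdry_density t.
Proof.
have iB := integrable_restricted mIstar sIstar bdry_continuous.
rewrite -(Rintegral_restricted bdry_density sIstar) -(RintegralZl _ mI iB).
apply: le_Rintegral => //.
- apply: (continuous_integrable alpha0 betaT) => t tT; have /andP[t0 _] := tT.
  apply: cvgM; first exact: (continuous_weight0 c0).
  exact: (continuous_sqr_trace step (null_derivative_continuous c) (null_x_continuous c)
    (fun t tT => @null_derivative_x c t tT) tT).
- exact: (integrableZl mI _ iB).
move=> t; rewrite /= in_itv/= => /inT tT; have /andP[t0 _] := tT.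
have [Lz _] := cz tT; have [Lzx _] := czx tT; have [Lzxx _] := czxx tT.
have [Lzt _] := czt tT; have [Lztx _] := cztx tT.
have [Ln _] := nx c tT; have [Lnx _] := nxx c tT.
have e : (fun x => 1 * zt t x + - c * zx t x) = (fun x => zt t x + - c * zx t x).
  by apply/funext => x; rewrite mul1r.
have wn : weak_derivative (fun x => zt t x + - c * zx t x) (fun x => ztx t x + - c * zxx t x).
  apply: weak_derivativeD; [exact: Lzt|exact: L2Z|exact: Lztx|exact: L2Z|exact: wzt|].
  exact: (weak_derivativeZ (- c) Lzx Lzxx (wzx tT)).
have -> : trace (null_derivative c t) =
    d1 t * trace (z t) + eta t * (trace (zt t) - c * trace (zx t)).
  rewrite (trace_linear (d1 t) (eta t) Lz Lzx Ln Lnx (wz tT) wn) -e.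
  by rewrite (trace_linear 1 (- c) Lzt Lztx Lzx Lzxx (wzt tT) (wzx tT)) mul1r mulNr.
have w1 := weight_ge0 c lambda sigma0 1 t 0.
have w13 : w 1 t 0 <= w 3 t 0.
  have a1 : 1 <= scaled_phi c lambda sigma t 0.
    apply: le_trans (scaled_phi_ge c0 lambda0 sigma0 (ltW t0) (lexx 0)).
    by apply: le_trans sigma3; rewrite ler1n.
  rewrite !(weightS _ _ _ _ t 0) in w1 *; set a := scaled_phi c lambda sigma t 0 in a1 w1 *.
  have -> : a * (a * (a * w 0 t 0)) = (a * a) * (a * w 0 t 0) by ring.
  by rewrite ler_peMl//; nra.
rewrite patchE; case: ifPn => [_|/negP nt]; last first.
  rewrite d1_out ?eta_out; try by move=> It; apply: nt; rewrite inE.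
  by rewrite !mul0r addr0 expr0n !mulr0.
rewrite /bdry_density; have /andP[e0 e1] := eta01 t.
have m1 : d1 t ^+ 2 <= M1 ^+ 2.
  by rewrite -(real_normK (num_real (d1 t))) lerXn2r ?nnegrE// (le_trans _ (eta1 t)).
have ee : eta t ^+ 2 <= 1 by rewrite expr_le1.
move: m1 ee w1 w13 (sqr_ge0 M1).
move: (w 1 t 0) (w 3 t 0) (d1 t) (eta t) (trace (z t)) (trace (zt t)) (trace (zx t)) (M1 ^+ 2).
move=> W1 W3 p q a b d m pm q1 W10 W13 m0.
have s3 : (p * a + q * (b - c * d)) ^+ 2 <= 3 * (p ^+ 2 * a ^+ 2 + q ^+ 2 * b ^+ 2 + q ^+ 2 * (c ^+ 2 * d ^+ 2)).
  have := sqr_ge0 (p * a - q * b); have := sqr_ge0 (p * a + q * c * d).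
  have := sqr_ge0 (q * b + q * c * d); lra.
have t1 : p ^+ 2 * a ^+ 2 <= m * a ^+ 2 by rewrite ler_wpM2r ?sqr_ge0.
have t2 : q ^+ 2 * b ^+ 2 <= b ^+ 2 by rewrite ler_piMl ?sqr_ge0.
have t3 : q ^+ 2 * (c ^+ 2 * d ^+ 2) <= c ^+ 2 * d ^+ 2 by apply: ler_piMl => //; exact: (mulr_ge0 (sqr_ge0 c) (sqr_ge0 d)).
have s4 : (p * a + q * (b - c * d)) ^+ 2 <= 3 * (m * a ^+ 2 + b ^+ 2 + c ^+ 2 * d ^+ 2) by lra.
have a2 := sqr_ge0 a; have b2 := sqr_ge0 b; have d2' := sqr_ge0 d; have cc := sqr_ge0 c.
move: a2 b2 d2' cc s4; move: (a ^+ 2) (b ^+ 2) (d ^+ 2) (c ^+ 2) ((_ + _) ^+ 2).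
move=> A B D E X A0 B0 D0 E0 h.
apply: (@le_trans _ _ (W1 * (3 * (m * A + B + E * D)))); first by rewrite ler_wpM2l.
have r1 : W1 * A <= W3 * A by rewrite ler_wpM2r.
have WA := mulr_ge0 (le_trans W10 W13) A0.
have WB := mulr_ge0 W10 B0; have WD := mulr_ge0 W10 D0.
have := ler_wpM2l m0 r1; have := mulr_ge0 E0 WA; have := mulr_ge0 m0 WB.
have := mulr_ge0 E0 WB; have := mulr_ge0 m0 WD.
lra.
Qed.

Variable I : set R.
Hypotheses (I_open : open I) (I_sub : I `<=` Istar) (eta_I : forall t, I t -> eta t = 1).

Let mI' : measurable I. Proof. exact: open_measurable. Qed.
Let sI : I `<=` `[alpha, beta]%classic. Proof. exact: subset_trans sIstar. Qed.

Let K := 1 + (c ^+ 2)^-1.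
Let K0 : 0 <= K. Proof. by rewrite addr_ge0// invr_ge0 sqr_ge0. Qed.

(** On I the cutoff is 1, and the null derivatives p, q in the directions c and - c
   satisfy p^2 + q^2 = 2 z_t^2 + 2 c^2 z_x^2. Since sigma phi >= sigma >= 1, the
   weights w_4 and w_2 dominate w_3 and sigma w_0. *)
Let lhs_bound : \int[mu]_(t in I) lhs_density t <=
  energy 4 localized + K * (energy 2 (null_derivative c) + energy 2 (null_derivative (- c))).
Proof.
have iL := integrable_restricted mI' sI lhs_continuous.
have i1 := continuous_integrable alpha0 betaT
  (fun t => @cw 4 _ _ localized_continuous localized_continuous t).
have i2 := continuous_integrable alpha0 betaT
  (fun t => @cw 2 _ _ (null_derivative_continuous c) (null_derivative_continuous c) t).
have i3 := continuous_integrable alpha0 betaT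
  (fun t => @cw 2 _ _ (null_derivative_continuous (- c)) (null_derivative_continuous (- c)) t).
have i23 := integrableD mI i2 i3; have i123 := integrableZl mI K i23.
rewrite -(Rintegral_restricted lhs_density sI) /energy.
rewrite -(RintegralD mI i2 i3) -(RintegralZl K mI i23) -(RintegralD mI i1 i123).
apply: le_Rintegral => //; first exact: (integrableD mI i1 i123).
move=> t; rewrite /= in_itv/= => /inT tT; have /andP[t0 _] := tT.
rewrite patchE; case: ifPn => [|_]; last first.
  apply: addr_ge0 (weighted_ge0 _ _ _) (mulr_ge0 K0 _).
  exact: addr_ge0 (weighted_ge0 _ _ _) (weighted_ge0 _ _ _).
rewrite inE => It.
have d10 : d1 t = 0.
  have : {near t, eta =1 cst 1}.
    by have := open_nbhs_nbhs (conj I_open It); apply: filterS => s /eta_I.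
  by move=> /(derive1n_near 1)/nbhs_singleton ->; rewrite derive1n_cst.
have locE : localized t = z t by apply/funext => x; rewrite /localized eta_I// mul1r.
have nE b : null_derivative b t = (fun x => zt t x + - b * zx t x).
  by apply/funext => x; rewrite /null_derivative eta_I// d10 mul0r add0r mul1r.
rewrite locE !nE.
have [Lz _] := cz tT; have [Lzx _] := czx tT; have [Lzt _] := czt tT.
have [Lp _] := nx c tT; have [Lm _] := nx (- c) tT.
have Lw n f : L2 f -> L2 (fun x => w n t x * f x) by exact: L2_weight.
have Z (k : R) g : mu.-integrable hl (EFin \o g) -> mu.-integrable hl (EFin \o (fun x => k * g x)).
  by move=> ig; exact: (integrableZl measurable_halfline k ig).
have D g1 g2 : mu.-integrable hl (EFin \o g1) -> mu.-integrable hl (EFin \o g2) ->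
   mu.-integrable hl (EFin \o (fun x => g1 x + g2 x)).
  by move=> j1 j2; exact: (integrableD measurable_halfline j1 j2).
have j1 := integrable_mulL2 (Lw 3 _ Lz) Lz; have j2 := integrable_mulL2 (Lw 0 _ Lzt) Lzt.
have j3 := integrable_mulL2 (Lw 0 _ Lzx) Lzx; have j4 := integrable_mulL2 (Lw 4 _ Lz) Lz.
have j5 := integrable_mulL2 (Lw 2 _ Lp) Lp; have j6 := integrable_mulL2 (Lw 2 _ Lm) Lm.
have l1 := D _ _ j2 j3; have l2 := Z sigma _ l1; have l3 := D _ _ j1 l2.
have r1 := D _ _ j5 j6; have r2 := Z K _ r1; have r3 := D _ _ j4 r2.
rewrite /lhs_density /inner -(RintegralD measurable_halfline j2 j3) -(RintegralZl _ measurable_halfline l1).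
rewrite -(RintegralD measurable_halfline j1 l2) -(RintegralD measurable_halfline j5 j6).
rewrite -(RintegralZl _ measurable_halfline r1) -(RintegralD measurable_halfline j4 r2).
apply: le_Rintegral => // x; rewrite halflineE => x0.
have as_ := scaled_phi_ge c0 lambda0 sigma0 (ltW t0) (ltW x0).
have w0 := weight_ge0 c lambda sigma0 0 t x.
have w3 := weight_ge0 c lambda sigma0 3 t x.
rewrite (weightS _ _ _ 3) (weightS _ _ _ 1) (weightS _ _ _ 0).
move: (scaled_phi c lambda sigma t x) (w 0 t x) (w 3 t x) (z t x) (zt t x) (zx t x) as_ w0 w3.
move=> a W W3 y p q sa W0 W30.
have a1 : 1 <= a by apply: le_trans sa; apply: le_trans sigma3; rewrite ler1n.
have sa2 : sigma <= a * a by apply: (le_trans sa); rewrite ler_peMl// (le_trans _ a1).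
have h1 : W3 * y * y <= a * W3 * y * y.
  by rewrite -!mulrA ler_peMl// mulr_ge0// -expr2 sqr_ge0.
have pq0 : 0 <= W * (p ^+ 2 + q ^+ 2) by rewrite mulr_ge0// addr_ge0 ?sqr_ge0.
have h2 : sigma * (W * (p ^+ 2 + q ^+ 2)) <= a * a * (W * (p ^+ 2 + q ^+ 2)).
  by rewrite ler_wpM2r.
have ci : c ^+ 2 * (c ^+ 2)^-1 = 1 by rewrite mulfV// gt_eqF// exprn_gt0.
have ci0 : 0 <= (c ^+ 2)^-1 by rewrite invr_ge0 sqr_ge0.
have h3 : p ^+ 2 + q ^+ 2 <= K * (2 * p ^+ 2 + 2 * (c ^+ 2 * q ^+ 2)).
  have -> : K * (2 * p ^+ 2 + 2 * (c ^+ 2 * q ^+ 2)) =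
    2 * p ^+ 2 + 2 * ((c ^+ 2)^-1 * p ^+ 2) + 2 * (c ^+ 2 * q ^+ 2) +
    2 * (c ^+ 2 * (c ^+ 2)^-1) * q ^+ 2 by rewrite /K; ring.
  rewrite ci; have := mulr_ge0 ci0 (sqr_ge0 p); have := mulr_ge0 (sqr_ge0 c) (sqr_ge0 q).
  have := sqr_ge0 p; have := sqr_ge0 q; lra.
have aaW : 0 <= a * a * W by rewrite !mulr_ge0// (le_trans _ a1).
have h4 := ler_wpM2l aaW h3.
lra.
Qed.

Let A := 4 / kappa ^+ 2.
Let L := (A + K) * A + K * A.
Let L' := (A + K) * (2 / kappa * c).

Lemma carleman_estimate : \int[mu]_(t in I) lhs_density t <=
  3 * L * \int[mu]_(t in Istar) box_density t +
  3 * (M1 ^+ 2 + 1 + c ^+ 2) * L' * \int[mu]_(t in Istar) bdry_density t +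
  3 * (4 * M1 ^+ 2 + M2 ^+ 2) * L * \int[mu]_(t in cutset) cut_density t.
Proof.
apply: (le_trans lhs_bound); apply: (le_trans (localized_estimate K0)).
rewrite -/A -/L -/L'.
have A0 : 0 <= A by rewrite divr_ge0// exprn_ge0// ltW.
have AK0 : 0 <= A + K by exact: addr_ge0.
have L0 : 0 <= L by exact: addr_ge0 (mulr_ge0 AK0 A0) (mulr_ge0 K0 A0).
have L'0 : 0 <= L'.
  by rewrite mulr_ge0// mulr_ge0 ?(ltW c0)// divr_ge0// ltW.
move: (ler_wpM2l L0 box_bound) (ler_wpM2l L'0 bdry_bound).
move: (energy 0 localized_box) bdry (\int[mu]_(t in Istar) box_density t).
move: (\int[mu]_(t in Istar) bdry_density t) (\int[mu]_(t in cutset) cut_density t) => X Y e b Z.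
move: L L' (4 * M1 ^+ 2 + M2 ^+ 2) (M1 ^+ 2 + 1 + c ^+ 2) => l l' p q; lra.
Qed.

Local Notation s := (- sigma).

Let density_cut t x : expR (2 * s * phi c lambda x t) * (`|zt t x| ^+ 2 + `|z t x| ^+ 2) =
  w 0 t x * zt t x * zt t x + w 0 t x * z t x * z t x.
Proof.
rewrite /weight /scaled_phi !real_normK ?num_real// expr0 mul1r.
rewrite (_ : 2 * - sigma * phi c lambda x t = - (2 * (sigma * phi c lambda x t))); last by ring.
by ring.
Qed.

Let density_box t x : expR (2 * s * phi c lambda x t) * `|box c T z t x| ^+ 2 =
  w 0 t x * box c T z t x * box c T z t x.
Proof.
rewrite /weight /scaled_phi !real_normK ?num_real// expr0 mul1r.
rewrite (_ : 2 * - sigma * phi c lambda x t = - (2 * (sigma * phi c lambda x t))); last by ring.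
by ring.
Qed.

Let density_lhs t x : expR (2 * s * phi c lambda x t) *
    ((- s) ^+ 3 * phi c lambda x t ^+ 3 * `|z t x| ^+ 2 +
     (- s) * (`|zt t x| ^+ 2 + `|zx t x| ^+ 2)) =
  w 3 t x * z t x * z t x +
  sigma * (w 0 t x * zt t x * zt t x + w 0 t x * zx t x * zx t x).
Proof.
rewrite /weight /scaled_phi !real_normK ?num_real// expr0 mul1r.
rewrite (_ : 2 * - sigma * phi c lambda x t = - (2 * (sigma * phi c lambda x t))); last by ring.
by ring.
Qed.

Let density_bdry t : expR (2 * s * phi c lambda 0 t) *
    ((- s) ^+ 3 * phi c lambda 0 t ^+ 3 * `|trace (z t)| ^+ 2 +
     (- s) * phi c lambda 0 t * (`|trace (zt t)| ^+ 2 + `|trace (zx t)| ^+ 2)) =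
  bdry_density t.
Proof.
rewrite /bdry_density /weight /scaled_phi !real_normK ?num_real// expr1.
rewrite (_ : 2 * - sigma * phi c lambda 0 t = - (2 * (sigma * phi c lambda 0 t))); last by ring.
by ring.
Qed.

Let integrable_weighted n t f : 0 < t -> L2 f ->
  mu.-integrable hl (EFin \o (fun x => w n t x * f x * f x)).
Proof. by move=> t0 Lf; exact: (integrable_mulL2 (L2_weight _ _ _ _ _ Lf) Lf). Qed.

(** The inner integrals are real numbers depending continuously on time, so the
   iterated integral is a real integral. *)
Let space_time (J : set R) (F : R -> R -> R) (d : R -> R) : measurable J ->
  J `<=` `[alpha, beta]%classic -> (forall t, 0 < t < T -> {for t, continuous d}) ->
  (forall t, 0 < t < T -> (\int[mu]_(x in hl) (F t x)%:E)%E = (d t)%:E) ->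
  int_space_time J F = (\int[mu]_(t in J) d t)%:E.
Proof.
move=> mJ sJ cd Fd; rewrite -(EFin_Rintegral mJ (integrable_density mJ sJ cd)).
apply: eq_integral => t; rewrite inE => /sJ; rewrite /= in_itv/= => /inT; exact: Fd.
Qed.

Lemma carleman_estimate_ereal :
  (int_space_time I (fun t x =>
     (expR (2 * s * phi c lambda x t) *
      ((- s) ^+ 3 * phi c lambda x t ^+ 3 * `|z t x| ^+ 2 +
       (- s) * (`|Dt T z t x| ^+ 2 + `|Dx (z t) x| ^+ 2)))%R)
   <=
   (3 * L)%R%:E * int_space_time Istar (fun t x =>
     (expR (2 * s * phi c lambda x t) * `|box c T z t x| ^+ 2)%R)
   + (3 * (M1 ^+ 2 + 1 + c ^+ 2) * L')%R%:E * \int[mu]_(t in Istar)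
      (expR (2 * s * phi c lambda 0 t) *
       ((- s) ^+ 3 * phi c lambda 0 t ^+ 3 * `|trace (z t)| ^+ 2 +
        (- s) * phi c lambda 0 t *
        (`|trace (Dt T z t)| ^+ 2 + `|trace (Dx (z t))| ^+ 2)))%R%:E
   + (3 * (4 * M1 ^+ 2 + M2 ^+ 2) * L)%R%:E * int_space_time
      (tsupport (derive1 eta) `|` tsupport (derive1n 2 eta)) (fun t x =>
     (expR (2 * s * phi c lambda x t) *
      (`|Dt T z t x| ^+ 2 + `|z t x| ^+ 2))%R))%E.
Proof.
have -> : (\int[mu]_(t in Istar)
      (expR (2 * s * phi c lambda 0 t) *
       ((- s) ^+ 3 * phi c lambda 0 t ^+ 3 * `|trace (z t)| ^+ 2 +
        (- s) * phi c lambda 0 t *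
        (`|trace (Dt T z t)| ^+ 2 + `|trace (Dx (z t))| ^+ 2)))%R%:E)%E =
    (\int[mu]_(t in Istar) bdry_density t)%:E.
  rewrite -(EFin_Rintegral mIstar (integrable_density mIstar sIstar bdry_continuous)).
  by apply: eq_integral => t _; rewrite density_bdry.
rewrite (space_time mI' sI lhs_continuous); last first.
  move=> t tT; have /andP[t0 _] := tT.
  have [Lz _] := cz tT; have [Lzx _] := czx tT; have [Lzt _] := czt tT.
  have j1 := integrable_weighted 3 t0 Lz; have j2 := integrable_weighted 0 t0 Lzt.
  have j3 := integrable_weighted 0 t0 Lzx.
  have j23 := integrableD measurable_halfline j2 j3.
  have js := integrableZl measurable_halfline sigma j23.
  under eq_integral do rewrite density_lhs.
  rewrite (EFin_Rintegral measurable_halfline (integrableD measurable_halfline j1 js)).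
  congr EFin; rewrite /lhs_density /inner.
  rewrite -(RintegralD measurable_halfline j2 j3) -(RintegralZl _ measurable_halfline j23).
  by rewrite -(RintegralD measurable_halfline j1 js).
rewrite (space_time mIstar sIstar box_density_continuous); last first.
  move=> t tT; have /andP[t0 _] := tT; have [Lb _] := box_continuous tT.
  under eq_integral do rewrite density_box.
  by rewrite (EFin_Rintegral measurable_halfline (integrable_weighted 0 t0 Lb)).
rewrite (space_time mcutset scutset cut_continuous); last first.
  move=> t tT; have /andP[t0 _] := tT.
  have [Lz _] := cz tT; have [Lzt _] := czt tT.
  have j1 := integrable_weighted 0 t0 Lz; have j2 := integrable_weighted 0 t0 Lzt.
  under eq_integral do rewrite density_cut.
  rewrite (EFin_Rintegral measurable_halfline (integrableD measurable_halfline j2 j1)).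
  by congr EFin; rewrite /cut_density /inner -(RintegralD measurable_halfline j2 j1).
rewrite -!EFinM -!EFinD lee_fin; exact: carleman_estimate.
Qed.

End localization.

(** * The Carleman estimate *)

(** The extrema of the compact closure of J lie in ]0, T[; the midpoints between them
   and the ends of ]0, T[ leave a margin on both sides. *)
Lemma compactly_contained_bounds (R : realType) (J : set R) (T : R) : J !=set0 ->
  compactly_contained J `]0, T[%classic ->
  exists alpha, exists beta, [/\ 0 < alpha, alpha < beta, beta < T & J `<=` `]alpha, beta[%classic].
Proof.
move=> J0 [cJ sJ].
have cJ0 : closure J !=set0 by move: J0 => [t Jt]; exists t; exact: subset_closure.
have cid_ : {within closure J, continuous (id : R -> R)}.
  by apply: continuous_subspaceT => t; exact: cvg_id.
have [m /[!inE] Jm hm] := compact_EVT_min cJ0 cJ cid_.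
have [M /[!inE] JM hM] := compact_EVT_max cJ0 cJ cid_.
have /= := sJ _ Jm; rewrite in_itv/= => /andP[m0 _].
have /= := sJ _ JM; rewrite in_itv/= => /andP[_ MT].
have mM : m <= M by apply: hm; rewrite inE.
exists (m / 2), ((M + T) / 2); split; [lra..|].
move=> t Jt; have cJt : t \in closure J by rewrite inE; exact: subset_closure.
by rewrite /= in_itv/=; have /= := hm _ cJt; have /= := hM _ cJt; lra.
Qed.

Theorem theorem4p1 (R : realType) (c T lambda beta : R)
  (hc : 0 < c) (hT : 0 < T)
  (hlambda : - 3^-1 < lambda < 0)
  (hbeta : 0 < beta < 1 - (4 * lambda + 2) /
             Num.sqrt ((2 * lambda + 3) * (8 * lambda + 3))) :
  exists N : nat, forall M : nat -> R,
  exists C Ceta S : R, [/\ 0 < C, 0 < Ceta & 1 <= S] /\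
  forall (I Istar : set R) (eta : R -> R),
    open I -> is_interval I -> open Istar -> is_interval Istar ->
    compactly_contained I Istar ->
    compactly_contained Istar `]0, T[%classic ->
    Cc_infty Istar eta ->
    (forall t, 0 <= eta t <= 1) ->
    (forall t, I t -> eta t = 1) ->
    (forall k, (k <= N)%N -> forall t, `|derive1n k eta t| <= M k) ->
  forall (z : R -> R -> R),
    CkH T 0 2 z -> CkH T 1 1 z -> CkH T 2 0 z ->
  forall s : R, s <= - S ->
  (int_space_time I (fun t x =>
     (expR (2 * s * phi c lambda x t) *
      ((- s) ^+ 3 * phi c lambda x t ^+ 3 * `|z t x| ^+ 2 +
       (- s) * (`|Dt T z t x| ^+ 2 + `|Dx (z t) x| ^+ 2)))%R)
   <=
   C%:E * int_space_time Istar (fun t x =>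
     (expR (2 * s * phi c lambda x t) * `|box c T z t x| ^+ 2)%R)
   + C%:E * \int[lebesgue_measure]_(t in Istar)
      (expR (2 * s * phi c lambda 0 t) *
       ((- s) ^+ 3 * phi c lambda 0 t ^+ 3 * `|trace (z t)| ^+ 2 +
        (- s) * phi c lambda 0 t *
        (`|trace (Dt T z t)| ^+ 2 + `|trace (Dx (z t))| ^+ 2)))%R%:E
   + Ceta%:E * int_space_time
      (tsupport (derive1 eta) `|` tsupport (derive1n 2 eta)) (fun t x =>
     (expR (2 * s * phi c lambda x t) *
      (`|Dt T z t x| ^+ 2 + `|z t x| ^+ 2))%R))%E.
Proof.
have /andP[_ lambda0] := hlambda.
exists 2 => M.
pose A := 4 / (- lambda * c / (1 + c * T)) ^+ 2; pose K := 1 + (c ^+ 2)^-1.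
pose L := (A + K) * A + K * A.
pose L' := (A + K) * (2 / (- lambda * c / (1 + c * T)) * c).
pose CB := 3 * L; pose CE := 3 * (M 1 ^+ 2 + 1 + c ^+ 2) * L'.
pose CC := 3 * (4 * M 1 ^+ 2 + M 2 ^+ 2) * L.
have kappa0 : 0 < - lambda * c / (1 + c * T).
  by rewrite divr_gt0 ?mulr_gt0 ?oppr_gt0// ltr_pwDl// mulr_ge0// ltW.
have A0 : 0 <= A by rewrite divr_ge0// exprn_ge0// ltW.
have K0 : 0 <= K by rewrite addr_ge0// invr_ge0 sqr_ge0.
have AK0 : 0 <= A + K by exact: addr_ge0.
have L0 : 0 <= L by exact: addr_ge0 (mulr_ge0 AK0 A0) (mulr_ge0 K0 A0).
have L'0 : 0 <= L' by rewrite mulr_ge0// mulr_ge0 ?(ltW hc)// divr_ge0// ltW.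
have CB0 : 0 <= CB by rewrite mulr_ge0.
have CE0 : 0 <= CE.
  apply: mulr_ge0 => //; apply: mulr_ge0; first exact: ler0n.
  by rewrite !addr_ge0 ?sqr_ge0.
have CC0 : 0 <= CC.
  apply: mulr_ge0 => //; apply: mulr_ge0; first exact: ler0n.
  by apply: addr_ge0; [apply: mulr_ge0; rewrite ?ler0n//|]; exact: sqr_ge0.
(* The summand 1 only serves to make the constants positive. *)
exists (CB + CE + 1), (CC + 1), 3; split.
  by split; rewrite ?ler1n ?ltr_wpDl// addr_ge0.
move=> I J eta oI _ oJ _ [_ IJ] cJ [smooth_eta _ eta_J] eta01 eta_I bound z z02 z11 z20 s s3.
have sigma3 : 3 <= - s by rewrite lerNr.
have s0 : 0 <= - s by apply: le_trans sigma3.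
have phi0 x t : 0 <= phi c lambda x t by exact: expR_ge0.
set F := (X in int_space_time I X).
set B := int_space_time J _.
set E := (X in (_ <= _ + _ * X + _)%E).
set D := int_space_time (_ `|` _) _.
have B0 : (0 <= B)%E.
  apply: integral_ge0 => t _; apply: integral_ge0 => x _; rewrite lee_fin.
  by rewrite mulr_ge0 ?expR_ge0// exprn_ge0.
have E0 : (0 <= E)%E.
  apply: integral_ge0 => t _; rewrite lee_fin.
  by rewrite mulr_ge0 ?expR_ge0// addr_ge0 ?mulr_ge0 ?addr_ge0 ?exprn_ge0.
have D0 : (0 <= D)%E.
  apply: integral_ge0 => t _; apply: integral_ge0 => x _; rewrite lee_fin.
  by rewrite mulr_ge0 ?expR_ge0// addr_ge0 ?exprn_ge0.
(* Over an empty I the left-hand side vanishes; otherwise I provides tau. *)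
have [I0|/set0P [tau Itau]] := eqVneq I set0.
  rewrite /int_space_time I0 integral_set0.
  have CBE : (0 <= (CB + CE + 1)%:E)%E by rewrite lee_fin !addr_ge0.
  have CC1 : (0 <= (CC + 1)%:E)%E by rewrite lee_fin addr_ge0.
  exact: adde_ge0 (adde_ge0 (mule_ge0 CBE B0) (mule_ge0 CBE E0)) (mule_ge0 CC1 D0).
have IsubJ : I `<=` J by move=> t /subset_closure/IJ.
have [alpha [gamma [alpha0 ag gT Jag]]] :=
  compactly_contained_bounds (ex_intro _ tau (IsubJ _ Itau)) cJ.
have tau0 : 0 < tau.
  by have := Jag _ (IsubJ _ Itau); rewrite /= in_itv/= => /andP[+ _]; exact: lt_trans.
have eta_le0 y : y <= 0 -> eta y = 0.
  move=> y0; apply: (@derive1n_tsupport_out _ eta 0) => /eta_J/Jag.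
  by rewrite /= in_itv/= => /andP[/(lt_trans alpha0)]; rewrite ltNge y0.
have eta_tau : {near tau, eta =1 cst 1}.
  by have := open_nbhs_nbhs (conj oI Itau); apply: filterS => t /eta_I.
have step : exists P : R -> R, exists tau K, smooth_step P tau K.
  have [P [k stepP]] := smooth_step_of_cutoff smooth_eta eta01 eta_le0 tau0 eta_tau.
  by exists P, tau, k.
have := carleman_estimate_ereal hc lambda0 sigma3 hT step z02 z11 z20 smooth_eta eta_J
  Jag alpha0 ag gT eta01 (bound 1 isT) (bound 2 isT) oJ oI IsubJ eta_I.
rewrite !opprK => /le_trans; apply.
have CBl : (CB%:E <= (CB + CE + 1)%:E)%E by rewrite lee_fin -addrA lerDl addr_ge0.
have CEl : (CE%:E <= (CB + CE + 1)%:E)%E by rewrite lee_fin addrAC lerDr addr_ge0.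
have CCl : (CC%:E <= (CC + 1)%:E)%E by rewrite lee_fin lerDl.
exact: leeD (leeD (lee_wpmul2r B0 CBl) (lee_wpmul2r E0 CEl)) (lee_wpmul2r D0 CCl).
Qed.
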